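(* Let $n\ge 3$. If $\mu\in A_{n-2}(\mathbb{R}^n)$, i.e. $\mu$ is an angular valuation in $\mathrm{Val}_{n-2}^+(\mathbb{R}^n)$, then the function $f\colon\mathrm{Gr}_2(\mathbb{R}^n)\to\mathbb{C}$, $f(E)=\mathrm{Kl}_\mu(E^\perp)$, satisfies $$(n-1)\int_{\{-1,1\}^{n-1}} f\Big(\frac{1}{\sqrt{n-1}}\sum_{i=1}^{n-1}\epsilon_i\,u_i\wedge u_n\Big)\,d\epsilon=\sum_{i=1}^{n-1}f(u_i\wedge u_n)$$ for every orthonormal basis $u_1,\dots,u_n$ of $\mathbb{R}^n$, where $d\epsilon$ denotes the uniform probability measure on $\{-1,1\}^{n-1}$.
   Context: $\mathcal{K}(\mathbb{R}^n)$ is the space of convex bodies in $\mathbb{R}^n$ with the Hausdorff metric. A valuation is a function $\mu\colon\mathcal{K}(\mathbb{R}^n)\to\mathbb{C}$ with $\mu(K\cup L)=\mu(K)+\mu(L)-\mu(K\cap L)$ whenever $K\cup L$ is convex. $\mathrm{Val}_k^+(\mathbb{R}^n)$ is the space of continuous, translation-invariant, $k$-homogeneous ($\mu(tK)=t^k\mu(K)$ for $t>0$), even ($\mu(-K)=\mu(K)$) valuations. For $\mu\in\mathrm{Val}_k^+$ and a $k$-dimensional linear subspace $E$, the restriction of $\mu$ to convex bodies in $E$ is a multiple of $k$-dimensional volume, $\mu|_E=\mathrm{Kl}_\mu(E)\,\mathrm{vol}_k$; the function $\mathrm{Kl}_\mu\colon\mathrm{Gr}_k(\mathbb{R}^n)\to\mathbb{C}$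 is the Klain function of $\mu$. A valuation $\mu\in\mathrm{Val}_k^+(\mathbb{R}^n)$ is angular if $\mu(P)=\sum_F\mathrm{Kl}_\mu(\overline F)\gamma(F,P)\mathrm{vol}_k(F)$ for every polytope $P\subset\mathbb{R}^n$. Here the sum is over the $k$-dimensional faces $F$ of $P$, $\overline F$ is the translate of the affine hull of $F$ containing the origin, and $\gamma(F,P)$ is the external angle of $P$ at $F$, i.e. the fraction of the unit sphere of $\overline F^\perp$ occupied by the normal cone of $P$ at $F$. The space of angular valuations is denoted $A_k(\mathbb{R}^n)$. A function $f$ on $\mathrm{Gr}_2(\mathbb{R}^n)$ is evaluated on a nonzero simple $2$-vector $w_1\wedge w_2$ by $f(w_1\wedge w_2)=f(\mathrm{span}\{w_1,w_2\})$. Note that $\sum_i\epsilon_i u_i\wedge u_n=(\sum_i\epsilon_iu_i)\wedge u_n$ is simple. *)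

(* Defs.v *)
From HB Require Import structures.
From mathcomp Require Import all_boot all_order all_algebra.
From mathcomp Require Import all_classical all_reals all_analysis.
From mathcomp Require Import complex.

Set Implicit Arguments.
Unset Strict Implicit.
Unset Printing Implicit Defensive.

Import Order.TTheory GRing.Theory Num.Theory.
Import numFieldNormedType.Exports.

Local Open Scope classical_set_scope.
Local Open Scope ring_scope.
Local Open Scope complex_scope.

Definition dot (R : realType) (n : nat) (x y : 'rV[R]_n) : R :=
  (x *m y^T) 0 0.

(* The library's norm on matrices is the sup norm; the Euclidean one is needed
   for lengths and spheres. *)
Definition enorm (R : realType) (n : nat) (x : 'rV[R]_n) : R :=
  Num.sqrt (dot x x).

Definition orthonormal_family (R : realType) (I : eqType) (n : nat)
    (u : I -> 'rV[R]_n) : Prop :=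
  forall i j, dot (u i) (u j) = (i == j)%:R.

Definition orthv (R : realType) (n : nat) (E : {vspace 'rV[R]_n}) :
    {vspace 'rV[R]_n} :=
  lker (linfun (mulmxr (\matrix_(i < \dim E) (vbasis E)`_i)^T)).

Lemma mem_orthv (R : realType) (n : nat) (E : {vspace 'rV[R]_n})
    (v : 'rV[R]_n) :
  v \in orthv E <-> (forall u, u \in E -> dot v u = 0).
Proof.
rewrite memv_ker lfunE /=; split=> [/eqP v0 u uE | vE].
  rewrite (coord_vbasis uE) /dot linear_sum mulmx_sumr summxE big1// => i _.
  rewrite linearZ /= -scalemxAr mxE -[RHS](mulr0 (coord (vbasis E) i u)).
  congr (_ * _); move/matrixP: v0 => /(_ 0 i); rewrite !mxE => v0.
  by rewrite -[RHS]v0; apply: eq_bigr => j _; rewrite !mxE.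
apply/eqP/matrixP => i j; rewrite ord1 [RHS]mxE.
have jE : (vbasis E)`_j \in E by apply/vbasis_mem/mem_nth; rewrite size_tuple.
rewrite -[RHS](vE _ jE) /dot !mxE; apply: eq_bigr => l _.
by rewrite !mxE.
Qed.

Record convexBody (R : realType) (n : nat) := ConvexBody {
  cb_set :> set 'rV[R]_n ;
  cb_nonempty : cb_set !=set0 ;
  cb_compact : compact cb_set ;
  cb_convex : convex_set cb_set }.

Definition hausdorff_dist (R : realType) (n : nat) (K L : convexBody R n) : R :=
  inf [set r : R | [/\ 0 <= r,
    (forall x, cb_set K x -> exists2 y, cb_set L y & enorm (x - y) <= r) &
    (forall y, cb_set L y -> exists2 x, cb_set K x & enorm (x - y) <= r)]].

(* Lebesgue (outer) measure on R^k.  The index set D of the covering family is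
   allowed to be any subset of nat so that the case k = 0, where every box has
   volume 1, yields the counting measure. *)
Definition lebesgue_rV (R : realType) (k : nat) (A : set 'rV[R]_k) : \bar R :=
  ereal_inf [set x : \bar R | exists (D : set nat) (a b : nat -> 'rV[R]_k),
    [/\ (forall j i, a j 0 i <= b j 0 i),
        A `<=` \bigcup_(j in D) [set y | forall i, a j 0 i <= y 0 i <= b j 0 i] &
        x = (\esum_(j in D) (\prod_(i < k) (b j 0 i - a j 0 i))%:E)%E]].

(* \dim E orthonormal vectors of E necessarily form a basis of E. *)
Definition onb (R : realType) (n : nat) (E : {vspace 'rV[R]_n}) :
    'M[R]_(\dim E, n) :=
  xget 0 [set B | orthonormal_family (fun i => row i B) /\
                  forall i, row i B \in E].

(* vol_k of a subset A of a translate of E, where k = \dim E: the Lebesgue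
   measure of the set of coordinates (<x, b_1>, ..., <x, b_k>), x in A, in an
   orthonormal basis b of E. *)
Definition volume (R : realType) (n : nat) (E : {vspace 'rV[R]_n})
    (A : set 'rV[R]_n) : R :=
  fine (lebesgue_rV [set x *m (onb E)^T | x in A]).

Definition sphere (R : realType) (n : nat) (E : {vspace 'rV[R]_n}) :
    set 'rV[R]_n :=
  [set v | v \in E /\ enorm v = 1].

(* Surface measure on the unit sphere of E: \dim E times the volume of the
   cone { t v | 0 <= t <= 1, v in A } over A. *)
Definition sphere_measure (R : realType) (n : nat) (E : {vspace 'rV[R]_n})
    (A : set 'rV[R]_n) : R :=
  (\dim E)%:R *
  volume E [set x | exists t v, [/\ 0 <= t <= 1, A v & x = t *: v]].

Definition aff_hull (R : realType) (n : nat) (A : set 'rV[R]_n) :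
    set 'rV[R]_n :=
  [set x | exists (k : nat) (p : 'I_k -> 'rV[R]_n) (l : 'I_k -> R),
    [/\ forall i, A (p i), \sum_i l i = 1 & x = \sum_i l i *: p i]].

Definition conv_hull (R : realType) (n : nat) (A : set 'rV[R]_n) :
    set 'rV[R]_n :=
  [set x | exists (k : nat) (p : 'I_k -> 'rV[R]_n) (l : 'I_k -> R),
    [/\ forall i, A (p i), forall i, 0 <= l i, \sum_i l i = 1 &
        x = \sum_i l i *: p i]].

Definition is_polytope (R : realType) (n : nat) (P : set 'rV[R]_n) : Prop :=
  exists2 V : set 'rV[R]_n, finite_set V & P = conv_hull V.

(* The linear subspace parallel to the affine hull of F (for F nonempty). *)
Definition direction (R : realType) (n : nat) (F : set 'rV[R]_n) :
    {vspace 'rV[R]_n} :=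
  xget 0%VS [set E : {vspace 'rV[R]_n} |
    exists x, aff_hull F = [set x + v | v in [set` E]]].

(* Nonempty faces; P itself is one (take a = 0 and b = 0). *)
Definition is_face (R : realType) (n : nat) (P F : set 'rV[R]_n) : Prop :=
  F !=set0 /\ exists (a : 'rV[R]_n) (b : R),
    (forall x, P x -> dot a x <= b) /\ F = P `&` [set x | dot a x = b].

Definition faces (R : realType) (n : nat) (k : nat) (P : set 'rV[R]_n) :
    set (set 'rV[R]_n) :=
  [set F | is_face P F /\ \dim (direction F) = k].

Definition normal_cone (R : realType) (n : nat) (P F : set 'rV[R]_n) :
    set 'rV[R]_n :=
  [set v | forall x y, F x -> P y -> dot v y <= dot v x].

(* When the face is full-dimensional the unit sphere is empty and the angle is
   1 by convention. *)
Definition external_angle (R : realType) (n : nat) (F P : set 'rV[R]_n) : R :=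
  let E := orthv (direction F) in
  if E == 0%VS then 1
  else sphere_measure E (normal_cone P F `&` sphere E) /
       sphere_measure E (sphere E).

Section Valuations.
Variables (R : realType) (n : nat).
Implicit Types (mu : convexBody R n -> R[i]) (K L M N : convexBody R n).

(* M exists as a convex body iff K `|` L is convex, and N then exists too. *)
Definition is_valuation mu : Prop :=
  forall K L M N, M = K `|` L :> set _ -> N = K `&` L :> set _ ->
    mu M = mu K + mu L - mu N.

Definition val_continuous mu : Prop :=
  forall K (e : R), 0 < e -> exists2 d : R, 0 < d &
    forall L, hausdorff_dist K L < d -> `|mu K - mu L| < e%:C.

Definition translation_invariant mu : Prop :=
  forall K L (x : 'rV[R]_n), L = [set x + y | y in K] :> set _ -> mu L = mu K.

Definition homogeneous (k : nat) mu : Prop :=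
  forall K L (t : R), 0 < t -> L = [set t *: y | y in K] :> set _ ->
    mu L = (t ^+ k)%:C * mu K.

Definition val_even mu : Prop :=
  forall K L, L = [set - y | y in K] :> set _ -> mu L = mu K.

Definition Val_even (k : nat) mu : Prop :=
  [/\ is_valuation mu, val_continuous mu, translation_invariant mu,
      homogeneous k mu & val_even mu].

(* Kl_mu(E): the constant c such that mu = c * vol_k on the convex bodies
   contained in E.  Functions on the Grassmannian Gr_k(R^n) are represented by
   functions on all subspaces, of which only the values at k-dimensional
   subspaces matter. *)
Definition klain mu (E : {vspace 'rV[R]_n}) : R[i] :=
  xget 0 [set c : R[i] | forall K, K `<=` [set` E] ->
    mu K = c * (volume E K)%:C].

Definition angular (k : nat) mu : Prop :=
  Val_even k mu /\
  forall P : convexBody R n, is_polytope P ->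
    mu P = \sum_(F \in faces k P)
      klain mu (direction F) * (external_angle F P)%:C *
      (volume (direction F) F)%:C.

(* Value of a function f on Gr_2(R^n) at the simple 2-vector w1 /\ w2. *)
Definition eval_wedge (f : {vspace 'rV[R]_n} -> R[i]) (w1 w2 : 'rV[R]_n) :
    R[i] :=
  f <<[:: w1; w2]>>%VS.

End Valuations.

(* Integral of g over T with respect to the uniform probability measure. *)
Definition uniform_mean (R : realType) (T : finType) (g : T -> R[i]) : R[i] :=
  (#|T|%:R)^-1 * \sum_(x : T) g x.

(* Main.v *)
(* If the affine hull of a polytope is a k-plane, angularity evaluates mu on it as
   Kl times volume, so mu(P) is the sum of gamma(F, P) mu(F) over the k-faces F.

   Let d = n - 3 and let s be an orthonormal basis of the orthogonal complement
   of span(x, y, u).  The d-fold difference nu(K) of mu along s is the limit of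
   N^-d mu(K + N C), C being the cube spanned by s; it is a 1-homogeneous
   continuous valuation with nu([0, w]) = |w| Kl(span(w, s)) for w orthogonal to s,
   and on a polytope K in span(x, y, u) it is the sum over the edges of K of the
   external angle times nu(edge).

   For the pyramid with apex 0 and base eta u + conv(+-A, +-B), where A and B are
   close to a = alpha x and b = beta y, comparing the edges of the pyramid with
   those of its base yields, as eta -> 0,
     (nu(pyramid) - nu(base)) / eta -> D,
   where D is a multiple of
     |a| nu([0, a]) + |b| nu([0, b]) - |a + b| (nu([0, a + b]) + nu([0, a - b])) / 2.
   On the other hand, interpolating z = p^2 + r^2 on the grid of mesh eta gives a
   polyhedral epigraph, from which about eta^-2 such pyramids, scaled by eta, can be
   cut off.  Before and after the cut the body is O(eta^2)-close to the epigraph of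
   the paraboloid, so by continuity the total change tends to 0; but it equals
   eta^-2 . eta . eta D up to a constant factor.  Hence D = 0.

   Thus F(e) = |e|^2 Kl((span(e, u))^perp) satisfies the parallelogram law for
   orthogonal vectors, and averaging over signs one coordinate at a time gives
   the claim. *)

Require Import Defs.
From mathcomp Require Import all_boot all_order all_algebra.
From mathcomp Require Import all_classical all_reals all_analysis.
From mathcomp Require Import complex ring lra zify.

Set Implicit Arguments.
Unset Strict Implicit.
Unset Printing Implicit Defensive.

Import Order.TTheory GRing.Theory Num.Theory.
Import numFieldNormedType.Exports.

Local Open Scope classical_set_scope.
Local Open Scope ring_scope.

(** * Lebesgue measure on row vectors *)

(** Continuity of a valuation comes without any rate, so a first-order limit on one pyramid
    contradicts nothing; many pyramids have to leave a body that hardly moves. A quadratic profile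
    suits this because its interpolant looks the same at every grid point up to a shear. The shear
    tilts the pyramids, turning a and b into a + sigma u and b + rho u, with slopes that do not tend
    to 0 with eta at a fixed point of the paraboloid. Hence the limit D is needed uniformly in small
    slopes, and only the cells over a small fixed patch near the origin are cut; their number is
    still of order eta^-2.

    The reduction to edges works because a face of K + N C that collapses some segment of N C is, up
    to translation, a sum with fewer than d segments, so the valuation grows on it like N^(d-1) at
    most.

    External angles are ratios of planar areas, and no arc length is evaluated: thin sectors are
    squeezed between triangles, and the ratio of the areas of a triangle and the disk only has to be
    positive. The argument is run for real-valued valuations; mu enters through its real and
    imaginary parts. *)

Section Dot.
Variables (R : realType) (n : nat).
Implicit Types (x y z : 'rV[R]_n) (c : R).

Lemma dotE x y : dot x y = \sum_i x 0 i * y 0 i.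
Proof. by rewrite /dot mxE; apply: eq_bigr => i _; rewrite mxE. Qed.

Lemma dotC x y : dot x y = dot y x.
Proof. by rewrite !dotE; apply: eq_bigr => i _; rewrite mulrC. Qed.

Lemma dotDl x y z : dot (x + y) z = dot x z + dot y z.
Proof. by rewrite /dot mulmxDl mxE. Qed.

Lemma dotDr x y z : dot x (y + z) = dot x y + dot x z.
Proof. by rewrite dotC dotDl !(dotC x). Qed.

Lemma dotZl c x y : dot (c *: x) y = c * dot x y.
Proof. by rewrite /dot -scalemxAl mxE. Qed.

Lemma dotZr c x y : dot x (c *: y) = c * dot x y.
Proof. by rewrite dotC dotZl dotC. Qed.

Lemma dotNl x y : dot (- x) y = - dot x y.
Proof. by rewrite -scaleN1r dotZl mulN1r. Qed.

Lemma dotNr x y : dot x (- y) = - dot x y.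
Proof. by rewrite dotC dotNl dotC. Qed.

Lemma dotBl x y z : dot (x - y) z = dot x z - dot y z.
Proof. by rewrite dotDl dotNl. Qed.

Lemma dotBr x y z : dot x (y - z) = dot x y - dot x z.
Proof. by rewrite dotDr dotNr. Qed.

Lemma dot0l x : dot 0 x = 0.
Proof. by rewrite /dot mul0mx mxE. Qed.

Lemma dot0r x : dot x 0 = 0.
Proof. by rewrite dotC dot0l. Qed.

Lemma dot_suml (I : Type) (r : seq I) (P : pred I) (F : I -> 'rV[R]_n) y :
  dot (\sum_(i <- r | P i) F i) y = \sum_(i <- r | P i) dot (F i) y.
Proof. by rewrite /dot mulmx_suml summxE. Qed.

Definition dotD := (dotDl, dotDr, dotBl, dotBr, dotNl, dotNr, dotZl, dotZr,
  dot0l, dot0r).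

Lemma dot_ge0 x : 0 <= dot x x.
Proof. by rewrite dotE sumr_ge0// => i _; rewrite -expr2 sqr_ge0. Qed.

Lemma dot_eq0 x : (dot x x == 0) = (x == 0).
Proof.
apply/eqP/eqP => [|->]; last by rewrite dot0l.
rewrite dotE => /eqP; rewrite psumr_eq0 => [/allP x0|i _]; last first.
  by rewrite -expr2 sqr_ge0.
apply/rowP => i; rewrite mxE; apply/eqP; rewrite -sqrf_eq0 expr2.
exact: (x0 i (mem_index_enum i)).
Qed.

Lemma dot_gt0 x : x != 0 -> 0 < dot x x.
Proof. by move=> x0; rewrite lt_neqAle eq_sym dot_eq0 x0 dot_ge0. Qed.

Lemma enorm_ge0 x : 0 <= enorm x.
Proof. exact: sqrtr_ge0. Qed.

Lemma sqr_enorm x : enorm x ^+ 2 = dot x x.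
Proof. by rewrite sqr_sqrtr// dot_ge0. Qed.

Lemma enormZ c x : enorm (c *: x) = `|c| * enorm x.
Proof.
by rewrite /enorm !dotD mulrA -expr2 sqrtrM ?sqr_ge0// sqrtr_sqr.
Qed.

Lemma enormN x : enorm (- x) = enorm x.
Proof. by rewrite /enorm !dotD opprK. Qed.

Lemma enorm0 : enorm (0 : 'rV[R]_n) = 0.
Proof. by rewrite /enorm dot0l sqrtr0. Qed.

Lemma enorm_eq0 x : (enorm x == 0) = (x == 0).
Proof. by rewrite -dot_eq0 -sqr_enorm sqrf_eq0. Qed.

Lemma dot_le_enorm x y : dot x y <= enorm x * enorm y.
Proof.
have [->|y0] := eqVneq y 0; first by rewrite dot0r enorm0 mulr0.
have dy := dot_gt0 y0.
have : 0 <= dot (dot y y *: x - dot x y *: y) (dot y y *: x - dot x y *: y).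
  exact: dot_ge0.
rewrite !dotD [dot y x]dotC => h.
have {}h : dot x y ^+ 2 <= dot x x * dot y y by rewrite -(ler_pM2l dy); lra.
apply: le_trans (ler_norm _) _; rewrite -sqrtr_sqr /enorm -sqrtrM ?dot_ge0//.
by rewrite ler_sqrt// mulr_ge0 ?dot_ge0.
Qed.

Lemma enormD x y : enorm (x + y) <= enorm x + enorm y.
Proof.
rewrite -(@ler_pXn2r _ 2) ?nnegrE ?addr_ge0 ?enorm_ge0//.
rewrite sqr_enorm sqrrD !sqr_enorm !dotD [dot y x]dotC.
by have := dot_le_enorm x y; lra.
Qed.

Lemma coord_le_enorm x i : `|x 0 i| <= enorm x.
Proof.
rewrite -sqrtr_sqr ler_sqrt ?dot_ge0// dotE (bigD1 i)//= expr2.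
by rewrite lerDl sumr_ge0// => j _; rewrite -expr2 sqr_ge0.
Qed.

End Dot.

(** * Lebesgue outer measure: linear images and the unit cube *)

Section LebesgueOuter.
Variables (R : realType) (k : nat).
Implicit Types (A B : set 'rV[R]_k) (a b : 'rV[R]_k).

Definition box a b : set 'rV[R]_k := [set y | forall i, a 0 i <= y 0 i <= b 0 i].

Definition bvol a b : R := \prod_(i < k) (b 0 i - a 0 i).

Lemma bvol_ge0 a b : (forall i, a 0 i <= b 0 i) -> 0 <= bvol a b.
Proof. by move=> ab; apply: prodr_ge0 => i _; rewrite subr_ge0. Qed.

(** Reduces covers indexed by any countable type to the nat-indexed covers of the definition:
    indices are encoded by [pickle], and codes outside [J] get a degenerate box only to satisfy the
    ordering condition. *)
Lemma lebesgue_rV_le_cover (T : countType) (J : set T) (a b : T -> 'rV[R]_k) A :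
  (forall j, J j -> forall i, a j 0 i <= b j 0 i) ->
  A `<=` \bigcup_(j in J) box (a j) (b j) ->
  (lebesgue_rV A <= \esum_(j in J) (bvol (a j) (b j))%:E)%E.
Proof.
move=> ab Acov.
pose ext (c : T -> 'rV[R]_k) n : 'rV[R]_k :=
  if pickle_inv n is Some j then (if `[< J j >] then c j else 0) else 0.
have extE c j : J j -> ext c (pickle j) = c j.
  by move=> Jj; rewrite /ext pickleK_inv asboolT.
apply: ereal_inf_lbound; exists (pickle @` J), (ext a), (ext b); split.
- move=> n i; rewrite /ext; case: pickle_inv => [j|]; last by [].
  by case: asboolP => // Jj; exact: ab.
- move=> x /Acov[j Jj xj]; exists (pickle j); first by exists j.
  by rewrite /= !extE.
- rewrite (@reindex_esum R T nat J _ pickle).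
    by apply: eq_esum => j Jj; rewrite !extE.
  split; [by move=> j Jj; exists j | | by move=> n [j Jj <-]; exists j].
  by move=> i j _ _; exact: (pcan_inj pickleK).
Qed.

Lemma lebesgue_rV_ge A (x : \bar R) :
  (forall (D : set nat) (a b : nat -> 'rV[R]_k),
     (forall j i, a j 0 i <= b j 0 i) ->
     A `<=` \bigcup_(j in D) box (a j) (b j) ->
     (x <= \esum_(j in D) (bvol (a j) (b j))%:E)%E) ->
  (x <= lebesgue_rV A)%E.
Proof. by move=> H; apply/ereal_infP => y [D [a [b [ab Acov ->]]]]; exact: H. Qed.

Lemma lebesgue_rV_ge0 A : (0 <= lebesgue_rV A)%E.
Proof.
apply: lebesgue_rV_ge => D a b ab _; apply: esum_ge0 => j _.
by rewrite lee_fin bvol_ge0.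
Qed.

Lemma le_lebesgue_rV A B : A `<=` B -> (lebesgue_rV A <= lebesgue_rV B)%E.
Proof.
move=> AB; apply: lebesgue_rV_ge => D a b ab Bcov.
by apply: lebesgue_rV_le_cover => [j _ i|]; [exact: ab|exact: subset_trans Bcov].
Qed.

Lemma lebesgue_rV_box a b : (forall i, a 0 i <= b 0 i) ->
  (lebesgue_rV (box a b) <= (bvol a b)%:E)%E.
Proof.
move=> ab.
apply: le_trans (lebesgue_rV_le_cover (T := unit) (J := setT) (a := fun=> a)
  (b := fun=> b) _ _) _ => //; first by move=> x xab; exists tt.
rewrite (_ : setT = [set tt]); last by apply/seteqP; split=> [[]|].
by rewrite esum_set1// lee_fin bvol_ge0.
Qed.

Lemma lebesgue_rV_bigcup (X : nat -> set 'rV[R]_k) :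
  (lebesgue_rV (\bigcup_j X j) <= \esum_(j in setT) lebesgue_rV (X j))%E.
Proof.
have [/eqP ->|/eqP fin] := boolP ((\esum_(j in setT) lebesgue_rV (X j))%E == +oo%E).
  by rewrite leey.
have Xfin j : lebesgue_rV (X j) \is a fin_num.
  rewrite ge0_fin_numE ?lebesgue_rV_ge0//.
  apply: contra_notT fin; rewrite -leNgt leye_eq => /eqP Xj.
  apply/eqP; rewrite -leye_eq -Xj.
  by apply: esum_ge; exists [set j]; rewrite ?fsbig_set1//; split.
apply/lee_addgt0Pr => e e0.
have /choice[c cP] : forall j, exists c : set nat * (nat -> 'rV[R]_k) * (nat -> 'rV[R]_k),
   [/\ forall j i, c.1.2 j 0 i <= c.2 j 0 i,
     X j `<=` \bigcup_(l in c.1.1) box (c.1.2 l) (c.2 l) &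
     (\esum_(l in c.1.1) (bvol (c.1.2 l) (c.2 l))%:E <=
      lebesgue_rV (X j) + (e / (2 ^ j.+1)%:R)%:E)%E].
  move=> j.
  have [] := @lb_ereal_inf_adherent R [set x : \bar R | exists (D : set nat) (a b : nat -> 'rV[R]_k),
    [/\ (forall j i, a j 0 i <= b j 0 i),
        X j `<=` \bigcup_(j in D) [set y | forall i, a j 0 i <= y 0 i <= b j 0 i] &
        x = (\esum_(j in D) (\prod_(i < k) (b j 0 i - a j 0 i))%:E)%E]]
     (e / (2 ^ j.+1)%:R) _ (Xfin j).
    by rewrite divr_gt0// ltr0n expn_gt0.
  move=> _ [D [a [b [ab Xcov ->]]]] lt.
  by exists (D, a, b); split => //; exact: ltW.
apply: (@le_trans _ _ (\esum_(p in setT `*`` (fun j => (c j).1.1))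
   (bvol ((c p.1).1.2 p.2) ((c p.1).2 p.2))%:E)%E).
  apply: (@lebesgue_rV_le_cover _ _ (fun p => (c p.1).1.2 p.2)
    (fun p => (c p.1).2 p.2)).
    by move=> [j l] _ i /=; have [+ _ _] := cP j; exact.
  move=> x [j _ Xjx]; have [_ /(_ x Xjx)[l lD xl] _] := cP j.
  by exists (j, l).
rewrite -(@esum_esum _ _ _ setT (fun j => (c j).1.1)
   (fun j l => (bvol ((c j).1.2 l) ((c j).2 l))%:E)); last first.
  by move=> j l _ _; rewrite lee_fin bvol_ge0//; have [+ _ _] := cP j; exact.
apply: (@le_trans _ _ (\esum_(j in setT) (lebesgue_rV (X j) + (e / (2 ^ j.+1)%:R)%:E))%E).
  by apply: le_esum => j _; have [] := cP j.
rewrite esumD; last 2 first.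
- by move=> j _; exact: lebesgue_rV_ge0.
- by move=> j _; rewrite lee_fin divr_ge0// ltW.
rewrite leeD2l// -nneseries_esumT; last by move=> j; rewrite lee_fin divr_ge0// ltW.
by apply: epsilon_trick0; exact: ltW.
Qed.

Lemma lebesgue_rV0 : lebesgue_rV (set0 : set 'rV[R]_k) = 0%E.
Proof.
apply/eqP; rewrite eq_le lebesgue_rV_ge0 andbT.
apply: le_trans (lebesgue_rV_le_cover (T := void) (J := set0)
  (a := fun=> 0) (b := fun=> 0) _ _) _ => //.
by rewrite esum_set0.
Qed.

Lemma lebesgue_rVU A B :
  (lebesgue_rV (A `|` B) <= lebesgue_rV A + lebesgue_rV B)%E.
Proof.
pose X (j : nat) := if j is 0%N then A else if j is 1%N then B else set0.
apply: (@le_trans _ _ (lebesgue_rV (\bigcup_j X j))).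
  by apply: le_lebesgue_rV => x [Ax|Bx]; [exists 0%N|exists 1%N].
apply: le_trans (lebesgue_rV_bigcup _) _.
rewrite (_ : \esum_(_ in _) _ = \esum_(j in `I_2) lebesgue_rV (X j))%E.
  rewrite esum_fset//; last by move=> j _; exact: lebesgue_rV_ge0.
  by rewrite -fsbig_ord big_ord_recl big_ord1.
rewrite (esum_mkcond `I_2); apply: eq_esum => -[|[|j]] _ /=.
- by rewrite mem_set.
- by rewrite mem_set.
- by rewrite memNset//= lebesgue_rV0.
Qed.

Lemma lebesgue_rV_mulmx_le (T : 'M[R]_k) (c : R) : 0 < c ->
  (forall a b, (forall i, a 0 i <= b 0 i) ->
     (lebesgue_rV [set x *m T | x in box a b] <= (c * bvol a b)%:E)%E) ->
  forall A, (lebesgue_rV [set x *m T | x in A] <= c%:E * lebesgue_rV A)%E.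
Proof.
move=> c0 Tbox A; rewrite -lee_pdivrMl//.
apply: lebesgue_rV_ge => D a b ab Acov; rewrite lee_pdivrMl//.
pose X j := if j \in D then [set x *m T | x in box (a j) (b j)] else set0.
apply: (@le_trans _ _ (lebesgue_rV (\bigcup_j X j))).
  apply: le_lebesgue_rV => _ [x Ax <-]; have [j Dj xj] := Acov x Ax.
  by exists j => //; rewrite /X mem_set//; exists x.
apply: le_trans (lebesgue_rV_bigcup _) _.
rewrite (esum_mkcond D) -!nneseries_esumT; last 2 first.
- by move=> j; case: ifP => // _; rewrite lee_fin bvol_ge0.
- by move=> j; exact: lebesgue_rV_ge0.
rewrite -nneseriesZl; last first.
  by move=> j _; case: ifP => // _; rewrite lee_fin bvol_ge0.
apply: lee_nneseries => [j _ _|j _]; first exact: lebesgue_rV_ge0.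
rewrite /X; case: ifP => _; last by rewrite lebesgue_rV0 mule0.
by rewrite -EFinM Tbox.
Qed.

(** Caratheodory's inequality for a coordinate half-space: cutting each covering box at 0 costs
    nothing, because max(x, 0) + min(x, 0) = x makes the two volumes add up. This is the only source
    of additivity for areas. *)
Lemma lebesgue_rV_split (i : 'I_k) A :
  (lebesgue_rV (A `&` [set x | (0 <= x 0 i)%R]) +
   lebesgue_rV (A `&` [set x | (x 0 i <= 0)%R]) <= lebesgue_rV A)%E.
Proof.
apply: lebesgue_rV_ge => D a b ab Acov.
pose upd (c : 'rV[R]_k) (f : R -> R) : 'rV[R]_k :=
  \row_l (if l == i then f (c 0 l) else c 0 l).
pose pos (x : R) := Num.max x 0; pose neg (x : R) := Num.min x 0.
have pos_homo x y : x <= y -> pos x <= pos y.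
  by move=> xy; rewrite /pos ge_max !le_max xy lexx orbT.
have neg_homo x y : x <= y -> neg x <= neg y.
  by move=> xy; rewrite /neg le_min !ge_min xy lexx orbT.
have posneg x : pos x + neg x = x by rewrite /pos /neg addr_max_min addr0.
have upd_le f j l : {homo f : x y / x <= y} -> upd (a j) f 0 l <= upd (b j) f 0 l.
  by move=> fh; rewrite !mxE; case: ifP => _; [apply: fh|]; apply: ab.
have updE j : bvol (a j) (b j) =
    bvol (upd (a j) pos) (upd (b j) pos) + bvol (upd (a j) neg) (upd (b j) neg).
  have bD (f : 'I_k -> R) : \prod_l f l = f i * \prod_(l | l != i) f l.
    by rewrite (bigD1 i).
  rewrite /bvol !bD !mxE eqxx.
  rewrite [in RHS](eq_bigr (fun l => b j 0 l - a j 0 l)); last first.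
    by move=> l /negPf li; rewrite !mxE li.
  rewrite [X in _ = _ + _ * X](eq_bigr (fun l => b j 0 l - a j 0 l)); last first.
    by move=> l /negPf li; rewrite !mxE li.
  rewrite -mulrDl; congr (_ * _).
  by have := posneg (a j 0 i); have := posneg (b j 0 i); lra.
rewrite (eq_esum (b := fun j => (bvol (upd (a j) pos) (upd (b j) pos))%:E +
   (bvol (upd (a j) neg) (upd (b j) neg))%:E)%E); last first.
  by move=> j _; rewrite updE.
rewrite esumD; last 2 first.
- by move=> j _; rewrite lee_fin bvol_ge0// => l; exact: upd_le.
- by move=> j _; rewrite lee_fin bvol_ge0// => l; exact: upd_le.
apply: leeD.
- apply: lebesgue_rV_le_cover; first by move=> j _ l; exact: upd_le.
  move=> x [/Acov[j Dj xj] x0]; exists j => // l; rewrite !mxE.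
  have /andP[al bl] := xj l; case: eqP => [li|_]; last by rewrite al.
  by subst l; rewrite /= in x0; rewrite /pos ge_max le_max al x0 bl.
- apply: lebesgue_rV_le_cover; first by move=> j _ l; exact: upd_le.
  move=> x [/Acov[j Dj xj] x0]; exists j => // l; rewrite !mxE.
  have /andP[al bl] := xj l; case: eqP => [li|_]; last by rewrite al.
  by subst l; rewrite /= in x0; rewrite /neg ge_min le_min al x0 bl.
Qed.

Lemma lebesgue_rV_diag (c : 'rV[R]_k) : (forall i, c 0 i != 0) -> forall A,
  (lebesgue_rV [set x *m diag_mx c | x in A] <= `|\det (diag_mx c)|%:E * lebesgue_rV A)%E.
Proof.
move=> c0; have d0 : 0 < `|\det (diag_mx c)|.
  by rewrite normr_gt0 det_diag; apply/prodf_neq0 => i _.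
apply: lebesgue_rV_mulmx_le => // a b ab.
pose a' : 'rV[R]_k := \row_i Num.min (a 0 i * c 0 i) (b 0 i * c 0 i).
pose b' : 'rV[R]_k := \row_i Num.max (a 0 i * c 0 i) (b 0 i * c 0 i).
have E i : b' 0 i - a' 0 i = `|c 0 i| * (b 0 i - a 0 i).
  rewrite !mxE; have := ab i; have [ci|ci] := lerP 0 (c 0 i) => abi.
    by rewrite max_r ?min_l ?ler_wpM2r// ger0_norm//; ring.
  by rewrite max_l ?min_r ?(ler_wnM2r (ltW ci))// ltr0_norm//; ring.
rewrite (_ : _ * _ = bvol a' b'); last first.
  rewrite det_diag normr_prod /bvol -big_split /=.
  by apply: eq_bigr => i _; rewrite E.
apply: le_trans (lebesgue_rV_box _) => [|i]; last first.
  by rewrite -subr_ge0 E mulr_ge0// subr_ge0.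
apply: le_lebesgue_rV => _ [x xab <-] i; rewrite mul_mx_diag !mxE.
have /andP[ax xb] := xab i; rewrite ge_min le_max.
have [ci|ci] := lerP 0 (c 0 i).
  by rewrite (ler_wpM2r ci ax) (ler_wpM2r ci xb) orbT.
by rewrite (ler_wnM2r (ltW ci) ax) (ler_wnM2r (ltW ci) xb) orbT.
Qed.

Lemma esum_finType (I : finType) (f : I -> R) : (forall i, 0 <= f i) ->
  \esum_(i in [set: I]) (f i)%:E = (\sum_i f i)%:E.
Proof.
move=> f0; rewrite esum_fset//; last 2 first.
- exact: finite_finset.
- by move=> i _; rewrite lee_fin.
rewrite (fsbigE (index_enum I)) ?index_enum_uniq//; last first.
  by move=> i _; rewrite mem_index_enum.
by rewrite (eq_bigl xpredT) ?sumEFin// => i; rewrite in_setT.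
Qed.

(** Acts on row vectors by adding [x_r c] to [x]. Allowing a whole row [c] (with [c_r = 0]) lets a
    single shear clear a row of a matrix. *)
Definition shear (r : 'I_k) (c : 'rV[R]_k) : 'M[R]_k :=
  1%:M + delta_mx r 0 *m c.

Lemma mul_row_shear r (c x : 'rV[R]_k) : x *m shear r c = x + x 0 r *: c.
Proof.
rewrite mulmxDr mulmx1 mulmxA -colE; congr (_ + _).
by apply/rowP => l; rewrite !mxE big_ord1 !mxE.
Qed.

Lemma mul_shear r (c c' : 'rV[R]_k) : c 0 r = 0 ->
  shear r c *m shear r c' = shear r (c + c').
Proof.
move=> cr; apply/row_matrixP => i; rewrite !rowE mulmxA !mul_row_shear.
by apply/rowP => l; rewrite !mxE cr; ring.
Qed.

(** Conjugation by the diagonal matrix that flips the sign of coordinate r turns [shear r c] into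
    its inverse [shear r (- c)], so the determinant has square 1. *)
Lemma abs_det_shear r (c : 'rV[R]_k) : c 0 r = 0 -> `|\det (shear r c)| = 1.
Proof.
move=> cr; pose D : 'M[R]_k := diag_mx (\row_l (if l == r then -1 else 1)).
have DSD : D *m shear r c *m D = shear r (- c).
  apply/row_matrixP => i; rewrite !rowE -!mulmxA mulmxA [_ *m D]mul_mx_diag.
  rewrite mulmxA !mul_row_shear mul_mx_diag; apply/rowP => l; rewrite !mxE/=.
  have [-> //=|li] := eqVneq l r; first by rewrite eqxx cr; ring.
  have [ir|ir] := eqVneq r i; last by rewrite ?eqxx /=; ring.
  by subst i; rewrite ?eqxx ?(negPf li)/=; ring.
have D2 : \det D * \det D = 1.
  rewrite -det_mulmx (_ : D *m D = 1%:M) ?det1// mulmx_diag -diag_const_mx.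
  by congr diag_mx; apply/rowP => l; rewrite !mxE; case: ifP => _; ring.
have : \det (shear r c *m shear r (- c)) = 1.
  by rewrite mul_shear// subrr /shear mulmx0 addr0 det1.
rewrite det_mulmx -DSD !det_mulmx mulrAC mulrA D2.
move=> h; have {}h : `|\det (shear r c)| ^+ 2 = 1.
  rewrite -normrX expr2 -[RHS](@normr1 R); congr (`|_|).
  by rewrite -[RHS]h; move: D2; set d := \det D; set e := \det _ => D2; ring: D2.
by apply/eqP; rewrite -(@eqrXn2 _ 2)// h expr1n.
Qed.

Lemma mem_subinterval (a h x : R) (M : nat) : a <= x <= a + M.+1%:R * h ->
  exists2 s : 'I_M.+1, true & a + s%:R * h <= x <= a + s.+1%:R * h.
Proof.
elim: M => [|M IH] /andP[ax xb]; first by exists ord0 => //=; rewrite mul0r addr0 ax.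
have [xM|xM] := lerP x (a + M.+1%:R * h); last first.
  by exists ord_max => //=; rewrite (ltW xM) xb.
have [|s _ sP] := IH; first by rewrite ax.
by exists (widen_ord (leqnSn _) s).
Qed.

(** The box is cut into M + 1 slabs across coordinate r. On a slab x_r varies by at most h, so the
    sheared slab fits into a box whose i-th side is longer by 2 |c_i| h; letting M grow removes the
    excess. *)
Lemma lebesgue_rV_shear_box r (c : 'rV[R]_k) a b : c 0 r = 0 -> (forall i, a 0 i <= b 0 i) ->
  forall M : nat, (lebesgue_rV [set x *m shear r c | x in box a b] <=
    (\prod_(i < k) ((b 0 i - a 0 i) +
       2 * `|c 0 i| * (b 0 r - a 0 r) * M.+1%:R^-1))%:E)%E.
Proof.
move=> cr ab M; set w := b 0 r - a 0 r; pose h := w * M.+1%:R^-1.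
have w0 : 0 <= w by rewrite subr_ge0.
have h0 : 0 <= h by rewrite mulr_ge0.
have Mh : M.+1%:R * h = w by rewrite mulrC divfK.
pose lo (s : 'I_M.+1) : 'rV[R]_k := \row_l (if l == r then a 0 r + s%:R * h
  else a 0 l + c 0 l * (a 0 r + s%:R * h) - `|c 0 l| * h).
pose hi (s : 'I_M.+1) : 'rV[R]_k := \row_l (if l == r then a 0 r + s.+1%:R * h
  else b 0 l + c 0 l * (a 0 r + s%:R * h) + `|c 0 l| * h).
have lohi s l : lo s 0 l <= hi s 0 l.
  rewrite !mxE; case: eqP => _; first by rewrite lerD2l ler_wpM2r// ler_nat.
  have := ab l; have : 0 <= `|c 0 l| * h by rewrite mulr_ge0.
  by lra.
apply: le_trans (lebesgue_rV_le_cover (T := 'I_M.+1) (J := setT)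
  (a := lo) (b := hi) (fun j _ => lohi j) _) _.
  move=> _ [x xab <-]; have [|s _ /andP[s1 s2]] := @mem_subinterval (a 0 r) h (x 0 r) M.
    by rewrite Mh /w addrC subrK; exact: xab.
  exists s => // l; rewrite mul_row_shear !mxE.
  case: eqP => [->|/eqP lr]; first by rewrite cr mulr0 addr0 s1 s2.
  have /andP[al bl] := xab l.
  have : `|c 0 l * (x 0 r - (a 0 r + s%:R * h))| <= `|c 0 l| * h.
    rewrite normrM ler_wpM2l// ger0_norm; last by rewrite subr_ge0.
    by move: s2; rewrite -natr1; lra.
  by rewrite ler_norml => /andP[]; lra.
rewrite esum_finType; last by move=> s; rewrite bvol_ge0.
rewrite lee_fin.
rewrite (eq_bigr (fun=> M.+1%:R^-1 * \prod_(i < k) (b 0 i - a 0 i +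
   2 * `|c 0 i| * w * M.+1%:R^-1))); last first.
  move=> s _; rewrite /bvol !(bigD1 (P := xpredT) r)//= cr normr0 !mxE eqxx.
  have -> : a 0 r + s.+1%:R * h - (a 0 r + s%:R * h) = h by rewrite -natr1; ring.
  rewrite mulr0 !mul0r addr0 -/w mulrA [_ * w]mulrC -/h; congr (_ * _).
  apply: eq_bigr => l /negPf lr; rewrite !mxE lr /h; ring.
rewrite sumr_const card_ord -[leLHS]mulr_natl mulrA divff// mul1r//.
Qed.

Lemma lebesgue_rV_shear r (c : 'rV[R]_k) : c 0 r = 0 -> forall A,
  (lebesgue_rV [set x *m shear r c | x in A] <= lebesgue_rV A)%E.
Proof.
move=> cr A; rewrite -[leRHS]mul1e; apply: lebesgue_rV_mulmx_le => // a b ab.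
rewrite mul1r; pose f (t : R) := \prod_(i < k) ((b 0 i - a 0 i) +
       2 * `|c 0 i| * (b 0 r - a 0 r) * t).
have bndf M : (lebesgue_rV [set x *m shear r c | x in box a b] <= (f M.+1%:R^-1)%:E)%E.
  exact: lebesgue_rV_shear_box.
have fin : lebesgue_rV [set x *m shear r c | x in box a b] \is a fin_num.
  by rewrite ge0_fin_numE ?lebesgue_rV_ge0// (le_lt_trans (bndf 0%N))// ltry.
rewrite -(fineK fin) lee_fin.
have fcv : f n.+1%:R^-1 @[n --> \oo] --> bvol a b.
  have -> : bvol a b = f 0.
    by apply: eq_bigr => i _; rewrite mulr0 addr0.
  have fc : {for 0, continuous f}.
    by apply: (@cvg_big) => //; first exact: mul_continuous; move=> i _;
      apply: cvgD; [exact: cvg_cst|apply: cvgMr; exact: cvg_id].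
  exact: continuous_cvg fc (@cvg_harmonic R).
apply: (ler_cvg_to (cvg_cst _) fcv); apply: nearW => M.
by rewrite -lee_fin fineK.
Qed.

Definition mulmx_bound (T : 'M[R]_k) := forall A,
  (lebesgue_rV [set x *m T | x in A] <= `|\det T|%:E * lebesgue_rV A)%E.

Lemma mulmx_boundM S T : mulmx_bound S -> mulmx_bound T -> mulmx_bound (S *m T).
Proof.
move=> bS bT A.
rewrite (_ : [set x *m (S *m T) | x in A] =
   [set x *m T | x in [set x *m S | x in A]]); last first.
  by rewrite image_comp; apply: eq_imagel => x _ /=; rewrite mulmxA.
apply: le_trans (bT _) _.
rewrite det_mulmx normrM mulrC EFinM -muleA.
by rewrite lee_wpmul2l// lee_fin.
Qed.

Lemma mulmx_bound_shear T r (c : 'rV[R]_k) : c 0 r = 0 ->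
  mulmx_bound (T *m shear r c) -> mulmx_bound T.
Proof.
move=> cr bT.
have -> : T = (T *m shear r c) *m shear r (- c).
  by rewrite -mulmxA mul_shear// subrr /shear mulmx0 addr0 mulmx1.
have cr' : (- c) 0 r = 0 by rewrite mxE cr oppr0.
apply: mulmx_boundM bT _ => A.
by rewrite abs_det_shear// mul1e lebesgue_rV_shear.
Qed.

Lemma mulmx_bound_diag T (c : 'rV[R]_k) : (forall i, c 0 i != 0) ->
  mulmx_bound (T *m diag_mx c) -> mulmx_bound T.
Proof.
move=> c0 bT; pose c' : 'rV[R]_k := \row_i (c 0 i)^-1.
have -> : T = (T *m diag_mx c) *m diag_mx c'.
  rewrite -mulmxA mulmx_diag (_ : diag_mx _ = 1%:M) ?mulmx1//.
  rewrite -diag_const_mx; congr diag_mx; apply/rowP => i.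
  by rewrite !mxE divff.
apply: mulmx_boundM bT _; apply: lebesgue_rV_diag => i.
by rewrite mxE invr_eq0.
Qed.

(** Otherwise row r would be a combination of the earlier rows, which are unit vectors, and the
    corresponding [v] would be a nonzero vector with [v *m T = 0]. *)
Lemma unitmx_pivot (T : 'M[R]_k) (r : 'I_k) : T \in unitmx ->
  (forall i : 'I_k, (i < r)%N -> row i T = delta_mx 0 i) ->
  exists2 j : 'I_k, (r <= j)%N & T r j != 0.
Proof.
move=> uT Tr; apply: contrapT => noj.
have Trj (j : 'I_k) : (r <= j)%N -> T r j = 0.
  by move=> rj; apply/eqP; apply: contrapT => /negP Tj; apply: noj; exists j.
pose v : 'rV[R]_k := delta_mx 0 r - \sum_(j < k | (j < r)%N) T r j *: delta_mx 0 j.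
have vT : v *m T = 0.
  rewrite mulmxBl -rowE mulmx_suml; apply/rowP => l; rewrite !mxE summxE.
  rewrite (eq_bigr (fun j : 'I_k => if l == j then T r j else 0)); last first.
    move=> j jr; rewrite -scalemxAl -rowE Tr// !mxE eqxx /=.
    by case: eqP; rewrite ?mulr1 ?mulr0.
  have [lr|lr] := ltnP l r.
    rewrite (bigD1 l)//= eqxx big1 ?addr0 ?subrr// => j /andP[_].
    by rewrite eq_sym => /negPf ->.
  rewrite Trj// big1 ?subr0// => j jr; case: eqP => // lj.
  by move: lr; rewrite lj leqNgt jr.
have v0 : v = 0 by rewrite -(mulmxK uT v) vT mul0mx.
have /eqP := congr1 (fun w : 'rV[R]_k => w 0 r) v0.
rewrite !mxE !eqxx summxE big1 ?subr0 ?oner_eq0// => j jr.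
by rewrite !mxE /= [r == j]eq_sym -val_eqE /= (ltn_eqF jr) mulr0.
Qed.

(** Gaussian elimination by column operations: right multiplication by shears and diagonal matrices
    turns the rows into unit vectors from the top down, and the inverses of these factors satisfy
    the bound. The counter [s] is the number of rows still to be treated. *)
Lemma mulmx_bound_unit (T : 'M[R]_k) : T \in unitmx -> mulmx_bound T.
Proof.
suff H s : (s <= k)%N -> forall T : 'M[R]_k, T \in unitmx ->
    (forall i : 'I_k, (i < k - s)%N -> row i T = delta_mx 0 i) -> mulmx_bound T.
  by move=> uT; apply: (H k) => // i; rewrite subnn.
elim: s => [_ {}T uT Trow|s IH sk {}T uT Trow].
  have -> : T = 1%:M.
    by apply/row_matrixP => i; rewrite Trow ?subn0// row1.
  move=> A; rewrite det1 normr1 mul1e le_lebesgue_rV// => _ [x Ax <-].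
  by rewrite mulmx1.
have ksk : (k - s.+1 < k)%N by lia.
pose r : 'I_k := Ordinal ksk.
have shearu q (c : 'rV[R]_k) : c 0 q = 0 -> shear q c \in unitmx.
  by move=> cq; rewrite unitmxE unitfE -normr_eq0 abs_det_shear ?oner_eq0.
(* A zero pivot is repaired by adding to column r a later column that is nonzero in row r. *)
wlog Trr : T uT Trow / T r r != 0.
  move=> W; have [Trr0|] := eqVneq (T r r) 0; last exact: W.
  have [j rj Tj] := unitmx_pivot (r := r) uT Trow.
  have jr : r != j by apply: contra_neq Tj => <-.
  have d0 : (delta_mx 0 r : 'rV[R]_k) 0 j = 0 by rewrite !mxE eqxx eq_sym (negPf jr).
  have rE i : row i (T *m shear j (delta_mx 0 r)) = row i T + T i j *: delta_mx 0 r.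
    by rewrite row_mul mul_row_shear mxE.
  apply: (mulmx_bound_shear d0); apply: W.
  - by rewrite unitmx_mul uT shearu.
  - move=> i ir; rewrite rE Trow//.
    have -> : T i j = 0; last by rewrite scale0r addr0.
    have /rowP/(_ j) := Trow i ir; rewrite !mxE => ->.
    by have /negPf -> : j != i by rewrite neq_ltn (leq_trans ir rj) orbT.
  - have /rowP/(_ r) := rE r; rewrite !mxE !eqxx /= Trr0 mulr1 add0r.
    by move=> ->.
pose dg : 'rV[R]_k := \row_i (if i == r then (T r r)^-1 else 1).
have dg0 i : dg 0 i != 0 by rewrite mxE; case: ifP => _; rewrite ?invr_eq0 ?oner_eq0.
apply: (mulmx_bound_diag dg0).
have rE i : row i (T *m diag_mx dg) = \row_l (T i l * dg 0 l).
  by apply/rowP => l; rewrite mul_mx_diag !mxE.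
set T1 := T *m diag_mx dg in rE *.
have uT1 : T1 \in unitmx.
  by rewrite unitmx_mul uT unitmxE unitfE det_diag; apply/prodf_neq0 => i _.
have T1row (i : 'I_k) : (i < k - s.+1)%N -> row i T1 = delta_mx 0 i.
  move=> ir; have /rowP Ti := Trow i ir; rewrite rE; apply/rowP => l.
  have := Ti l; rewrite !mxE eqxx/= => ->.
  have [->|] := eqVneq l i; last by rewrite mul0r.
  by rewrite -val_eqE /= (ltn_eqF ir) mulr1.
have T1rr : T1 r r = 1.
  by have /rowP/(_ r) := rE r; rewrite !mxE eqxx divff.
clearbody T1; clear rE.
(* With pivot 1, the shear by the negated rest of row r clears that row. *)
pose c : 'rV[R]_k := \row_l (if l == r then 0 else - T1 r l).
have cr : c 0 r = 0 by rewrite mxE eqxx.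
apply: (mulmx_bound_shear cr); apply: IH; first exact: ltnW.
  by rewrite unitmx_mul uT1 shearu.
move=> i ir; rewrite row_mul mul_row_shear mxE.
have [->|ri] := eqVneq i r.
  apply/rowP => l; rewrite !mxE T1rr !eqxx/=.
  by have [->|lr] := eqVneq l r; rewrite ?T1rr /=; ring.
have {}ir : (i < k - s.+1)%N.
  move: ir ri; rewrite -val_eqE /=; lia.
rewrite T1row//; have -> : T1 i r = 0; last by rewrite scale0r addr0.
have /rowP/(_ r) := T1row i ir; rewrite !mxE => ->.
by rewrite eq_sym (negPf ri).
Qed.

(** The reverse inequality is the bound for [invmx T], applied to the image of A. *)
Lemma lebesgue_rV_mulmx (T : 'M[R]_k) A : T \in unitmx ->
  lebesgue_rV [set x *m T | x in A] = (`|\det T|%:E * lebesgue_rV A)%E.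
Proof.
move=> uT; apply/eqP; rewrite eq_le mulmx_bound_unit//=.
have uT' : invmx T \in unitmx by rewrite unitmx_inv.
have d0 : 0 < `|\det T| by rewrite normr_gt0 -unitfE -unitmxE.
rewrite -lee_pdivlMl// -normfV -det_inv.
apply: le_trans (mulmx_bound_unit uT' _).
by apply: le_lebesgue_rV => x Ax; exists (x *m T); [exists x|rewrite mulmxK].
Qed.

Lemma card_ord_interval (M : nat) (A : {set 'I_M}) (u v : R) : u <= v ->
  (forall m : 'I_M, m \in A -> u <= (m : nat)%:R <= v) -> (#|A|)%:R <= v - u + 1.
Proof.
move=> uv Auv; have [->|[m mA]] := finset.set_0Vmem A.
  by rewrite finset.cards0; lra.
have [m0 m0A m0min] := arg_minnP (P := mem A) (fun i : 'I_M => i : nat) mA.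
have [m1 m1A m1max] := arg_maxnP (P := mem A) (fun i : 'I_M => i : nat) mA.
have cA : (#|A| <= m1 - m0 + 1)%N.
  rewrite cardE -(size_map val) -[leqRHS](size_iota m0).
  apply: uniq_leq_size; first by rewrite map_inj_uniq ?enum_uniq//; exact: val_inj.
  move=> _ /seq.mapP [i + ->]; rewrite mem_enum mem_iota => iA.
  have := m0min _ iA; have := m1max _ iA => /=; lia.
have m01 : (m0 <= m1)%N by apply: m0min.
apply: (@le_trans _ _ (m1 - m0 + 1)%:R); first by rewrite ler_nat.
rewrite natrD natrB//.
have /andP[h0 _] := Auv _ m0A; have /andP[_ h1] := Auv _ m1A.
lra.
Qed.

(** Counting replaces integration: each of the (M + 1)^k grid points of the cube lies in some box,
    and a box contains at most the product over its sides of (side times (M + 1)) + 1 of them. *)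
Lemma cover_cube_count (J : finType) (a b : J -> 'rV[R]_k) :
  (forall j i, a j 0 i <= b j 0 i) ->
  box 0 (const_mx 1) `<=` \bigcup_j box (a j) (b j) ->
  forall M : nat, 1 <= \sum_j \prod_(i < k) (b j 0 i - a j 0 i + M.+1%:R^-1).
Proof.
move=> ab cov M; set m : R := M.+1%:R.
have m0 : 0 < m by rewrite ltr0n.
pose pt (g : {ffun 'I_k -> 'I_M.+1}) : 'rV[R]_k := \row_i ((g i : nat)%:R / m).
have /choice[f fP] : forall g, exists j, box (a j) (b j) (pt g).
  move=> g; have [|j _ jP] := cov (pt g); last by exists j.
  move=> i; rewrite !mxE; apply/andP; split.
    by rewrite divr_ge0 ?ler0n// ltW.
  by rewrite ler_pdivrMr// mul1r ler_nat ltnW.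
have : m ^+ k = \sum_j (#|[set g | f g == j]%SET|)%:R.
  rewrite -natr_sum (_ : (\sum_j _)%N = #|{ffun 'I_k -> 'I_M.+1}|).
    by rewrite card_ffun !card_ord natrX.
  rewrite -sum1_card (partition_big f xpredT)//=.
  by apply: eq_bigr => j _; rewrite -sum1dep_card.
have mk0 : 0 < m ^+ k by rewrite exprn_gt0.
move=> E; rewrite -(ler_pM2l mk0) mulr1 {1}E mulr_sumr; apply: ler_sum => j _.
pose A i := [set n : 'I_M.+1 | a j 0 i * m <= (n : nat)%:R <= b j 0 i * m]%SET.
apply: (@le_trans _ _ (\prod_i (#|A i|)%:R)).
  rewrite -natr_prod ler_nat.
  have -> : (\prod_i #|A i|)%N = #|family A|.
    by rewrite card_family foldrE big_map big_enum.
  apply: subset_leq_card.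
  apply/fintype.subsetP => g; rewrite inE => /eqP fg; apply/familyP => i.
  have := fP g; rewrite fg => /(_ i); rewrite !mxE inE.
  by rewrite ler_pdivlMr// ler_pdivrMr.
rewrite -[X in m ^+ X](card_ord k) -prodr_const -big_split /=.
apply: ler_prod => i _; rewrite ler0n /=.
apply: le_trans (@card_ord_interval _ (A i) (a j 0 i * m) (b j 0 i * m) _ _) _.
- by rewrite ler_pM2r.
- by move=> n; rewrite inE.
rewrite mulrDr divff ?gt_eqF//; lra.
Qed.

Lemma prod_widen_cvg (w : 'rV[R]_k) (c : R) :
  (\prod_(i < k) (w 0 i + c * t)) @[t --> (0 : R)] --> \prod_(i < k) w 0 i.
Proof.
have -> : \prod_(i < k) w 0 i = \prod_(i < k) (w 0 i + c * 0).
  by apply: eq_bigr => i _; rewrite mulr0 addr0.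
apply: (@cvg_big) => //; first exact: mul_continuous.
by move=> i _; apply: cvgD; [exact: cvg_cst|apply: cvgMr; exact: cvg_id].
Qed.

Definition cube : set 'rV[R]_k := box 0 (const_mx 1).

(** The boxes are enlarged slightly to open ones, compactness leaves finitely many, and the grid
    count applies to these; a finer and finer grid removes the rounding error. *)
Lemma lebesgue_rV_cube_ge1 : (1 <= lebesgue_rV cube)%E.
Proof.
apply: lebesgue_rV_ge => D a b ab Dcov; apply/lee_addgt0Pr => e e0.
have e1 j : 0 < e / (2 ^ j.+1)%:R by rewrite divr_gt0// ltr0n expn_gt0.
(* The margin [t j] costs at most e / 2^(j+1) of volume, so all margins together cost at most e. *)
have /choice[t tP] : forall j, exists t : R, 0 < t /\
   \prod_(i < k) (b j 0 i - a j 0 i + 2 * t) <=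
   bvol (a j) (b j) + e / (2 ^ j.+1)%:R.
  move=> j; have := @prod_widen_cvg (b j - a j) 2.
  move=> /cvgrPdist_lt/(_ _ (e1 j))[d /= d0 dP].
  exists (d / 2); split; first by rewrite divr_gt0.
  have := dP (d / 2); rewrite /= sub0r normrN gtr0_norm ?divr_gt0//.
  move=> /(_ ltac:(lra)); rewrite distrC => /ltW/ler_normlW.
  have -> : \prod_(i < k) (b j - a j) 0 i = bvol (a j) (b j).
    by apply: eq_bigr => i _; rewrite !mxE.
  suff -> : \prod_(i < k) ((b j - a j) 0 i + 2 * (d / 2)) =
    \prod_(i < k) (b j 0 i - a j 0 i + 2 * (d / 2)) by rewrite lerBlDl.
  by apply: eq_bigr => i _; rewrite !mxE.
pose O j : set 'rV[R]_k := [set y | forall i, a j 0 i - t j < y 0 i < b j 0 i + t j].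
have Oop j : open (O j).
  rewrite openE => y Oy; rewrite /interior.
  pose f (i : 'I_k) : set 'rV[R]_k := [set z | a j 0 i - t j < z 0 i < b j 0 i + t j].
  suff H i : nbhs y (f i) by exact: (@filter_forall _ _ f (nbhs y) _ H).
  have cy : (fun z : 'rV[R]_k => z 0 i) z @[z --> y] --> y 0 i.
    exact: coord_continuous.
  have /andP[y1 y2] := Oy i; rewrite /f; near=> z; apply/andP; split.
    by near: z; apply: (cvgr_gt _ cy); exact: y1.
  by near: z; apply: (cvgr_lt _ cy); exact: y2.
have Qc : compact cube.
  rewrite (_ : cube = [set v : 'rV[R]_k | forall i, (`[0, 1]%classic : set R) (v 0 i)]).
    by apply: (@rV_compact R k (fun=> `[0, 1]%classic)) => i; exact: segment_compact.
  by apply/seteqP; split => v H i; have := H i; rewrite !mxE /= in_itv/=.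
move: Qc; rewrite compact_cover => /(_ nat D O (fun j _ => Oop j)).
case=> [x /Dcov[j Dj xj]|D' D'D D'cov].
  exists j => // i; have /andP[x1 x2] := xj i; have [t0 _] := tP j.
  by apply/andP; split; lra.
pose s := finmap.enum_fset D'.
have us : uniq s by exact: finmap.fset_uniq.
have sD j : j \in s -> D j by move=> /D'D; rewrite inE.
have sum_s (f : nat -> R) (E : set nat) : (forall j, 0 <= f j) -> {subset s <= E} ->
    ((\sum_(j <- s) f j)%:E <= \esum_(j in E) (f j)%:E)%E.
  move=> f0 sE; apply: esum_ge; exists [set` s].
    split; first exact: finite_seq.
    by move=> j /= js; apply: set_mem; exact: sE.
  by rewrite -fsbig_seq// sumEFin.
pose a' (i : 'I_(size s)) := a (nth 0%N s i) - const_mx (t (nth 0%N s i)).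
pose b' (i : 'I_(size s)) := b (nth 0%N s i) + const_mx (t (nth 0%N s i)).
have ab' j i : a' j 0 i <= b' j 0 i.
  have [t0 _] := tP (nth 0%N s j); rewrite !mxE.
  by have := ab (nth 0%N s j) i; lra.
have cov' : cube `<=` \bigcup_j box (a' j) (b' j).
  move=> x /D'cov[j /= js xj]; have js' : (index j s < size s)%N by rewrite index_mem.
  exists (Ordinal js') => // i; rewrite !mxE /= nth_index//.
  by have /andP[x1 x2] := xj i; rewrite !ltW.
have cnt := cover_cube_count ab' cov'.
have lim1 : 1 <= \sum_(j < size s) \prod_(i < k) (b' j 0 i - a' j 0 i).
  suff sumcv : \sum_j \prod_(i < k) (b' j 0 i - a' j 0 i + n.+1%:R^-1)
      @[n --> \oo] --> \sum_(j < size s) \prod_(i < k) (b' j 0 i - a' j 0 i).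
    by apply: (ler_cvg_to (cvg_cst (1 : R)) sumcv); exact: nearW cnt.
  apply: (@cvg_big) => //; first exact: add_continuous.
  move=> j _; have := cvg_comp _ _ (@cvg_harmonic R) (@prod_widen_cvg (b' j - a' j) 1).
  rewrite (eq_bigr (fun i => b' j 0 i - a' j 0 i)); last by move=> i _; rewrite !mxE.
  apply: cvg_trans; apply: near_eq_cvg; apply: nearW => n /=.
  by apply: eq_bigr => i _; rewrite mul1r !mxE.
have e2 j : 0 <= e / (2 ^ j.+1)%:R by rewrite ltW.
apply: (@le_trans _ _ ((\sum_(j <- s) bvol (a j) (b j))%:E +
   (\sum_(j <- s) e / (2 ^ j.+1)%:R)%:E)%E).
  rewrite -EFinD lee_fin (le_trans lim1)// -big_split/=.
  rewrite [leRHS](big_nth 0%N) big_mkord; apply: ler_sum => j _.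
  have [_] := tP (nth 0%N s j); apply: le_trans; apply: ler_prod => i _.
  rewrite subr_ge0 ab' /=; rewrite !mxE; lra.
apply: leeD.
  apply: sum_s => [j|j js]; first exact: bvol_ge0.
  by rewrite inE; exact: sD.
apply: le_trans (sum_s _ setT e2 _) _; first by move=> j; rewrite in_setT.
rewrite -nneseries_esumT; last by move=> j; rewrite lee_fin.
exact: epsilon_trick0 (ltW e0).
Unshelve. all: by end_near. Qed.

Lemma lebesgue_rV_fin A a b : A `<=` box a b -> lebesgue_rV A \is a fin_num.
Proof.
move=> Aab; rewrite ge0_fin_numE ?lebesgue_rV_ge0//.
have [[i bai]|/forallNP ab] := pselect (exists i, b 0 i < a 0 i).
  rewrite (_ : A = set0) ?lebesgue_rV0 ?ltry//.
  apply/seteqP; split => // x /Aab/(_ i)/andP[ax xb].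
  by have := le_trans ax xb; rewrite leNgt bai.
apply: le_lt_trans (le_lebesgue_rV Aab) (le_lt_trans (lebesgue_rV_box _) (ltry _)).
by move=> i; rewrite leNgt; apply/negP/ab.
Qed.

Lemma lebesgue_rV_cube : lebesgue_rV cube = 1%E.
Proof.
apply/eqP; rewrite eq_le lebesgue_rV_cube_ge1 andbT.
apply: le_trans (lebesgue_rV_box _) _ => [i|]; first by rewrite !mxE.
rewrite lee_fin /bvol big1// => i _; by rewrite !mxE subr0.
Qed.

End LebesgueOuter.

(** * Areas of planar sectors of the unit disk *)

Section PlaneSectors.
Variable R : realType.
Implicit Types (p q x y : 'rV[R]_2) (A : set 'rV[R]_2).

Lemma ord2P (i : 'I_2) : i = 0 \/ i = 1.
Proof. by case: i => [[|[|]]] // ?; [left|right]; exact: val_inj. Qed.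

Lemma sum_ord2 (f : 'I_2 -> R) : \sum_i f i = f 0 + f 1.
Proof. by rewrite big_ord_recl big_ord1; congr (_ + f _); exact: val_inj. Qed.

Definition area A : R := fine (lebesgue_rV A).

Definition unit_disk : set 'rV[R]_2 := [set x | dot x x <= 1].

Definition sector p q : set 'rV[R]_2 :=
  [set x | exists s t, [/\ 0 <= s, 0 <= t & x = s *: p + t *: q]].

Definition triangle : set 'rV[R]_2 := sector (delta_mx 0 0) (delta_mx 0 1)
  `&` [set x | x 0 0 + x 0 1 <= 1].

Lemma area_ge0 A : 0 <= area A.
Proof. by rewrite fine_ge0// lebesgue_rV_ge0. Qed.

Lemma unit_disk_box : unit_disk `<=` box (const_mx (-1)) (const_mx 1).
Proof.
move=> x x1 i; rewrite !mxE -ler_norml.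
apply: le_trans (coord_le_enorm _ _) _.
by rewrite -(@ler_pXn2r _ 2) ?nnegrE ?enorm_ge0// sqr_enorm expr1n.
Qed.

Lemma area_unit_disk_fin A : A `<=` unit_disk -> lebesgue_rV A \is a fin_num.
Proof. by move=> A1; apply: lebesgue_rV_fin (subset_trans A1 unit_disk_box). Qed.

Lemma le_area A B : A `<=` B -> B `<=` unit_disk -> area A <= area B.
Proof.
move=> AB B1; rewrite fine_le ?area_unit_disk_fin ?le_lebesgue_rV//.
exact: subset_trans AB B1.
Qed.

Lemma mem_triangle x : triangle x <-> [/\ 0 <= x 0 0, 0 <= x 0 1 & x 0 0 + x 0 1 <= 1].
Proof.
split=> [[[s [t [s0 t0 ->]]]]|[x0 x1 x01]].
  by rewrite /= !mxE /= !mulr1 !mulr0 !addr0 !add0r.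
split=> //; exists (x 0 0), (x 0 1); split=> //.
apply/rowP => i; rewrite !mxE /=.
by case: (ord2P i) => ->; rewrite /= ?mulr1 ?mulr0 ?addr0 ?add0r.
Qed.

Lemma area_mulmx (T : 'M[R]_2) A : T \in unitmx ->
  area [set x *m T | x in A] = `|\det T| * area A.
Proof.
move=> uT; rewrite /area lebesgue_rV_mulmx//.
have [Afin|] := boolP (lebesgue_rV A \is a fin_num); first by rewrite fineM.
rewrite ge0_fin_numE ?lebesgue_rV_ge0// ltey negbK => /eqP ->.
by rewrite gt0_muley /= ?mulr0// lte_fin normr_gt0 -unitfE -unitmxE.
Qed.

Definition mx_rows p q : 'M[R]_2 := \matrix_(i, j) (if i == 0 then p 0 j else q 0 j).

Lemma mul_mx_rows x p q : x *m mx_rows p q = x 0 0 *: p + x 0 1 *: q.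
Proof. by apply/rowP => j; rewrite !mxE sum_ord2 !mxE. Qed.

Definition det2 p q : R := p 0 0 * q 0 1 - p 0 1 * q 0 0.

Lemma det_mx_rows p q : \det (mx_rows p q) = det2 p q.
Proof.
rewrite (expand_det_row _ 0) sum_ord2 /cofactor !det_mx11 !mxE /=.
rewrite /det2 expr0 expr1 /bump /= !mul1r.
rewrite (_ : lift 0 0 = 1); last exact: val_inj.
rewrite (_ : lift 1 0 = 0); last exact: val_inj.
by rewrite mulN1r mulrN.
Qed.

Lemma mx_rows_unit p q : det2 p q != 0 -> mx_rows p q \in unitmx.
Proof. by rewrite unitmxE unitfE det_mx_rows. Qed.

Lemma det2Z c p q : det2 (c *: p) (c *: q) = c ^+ 2 * det2 p q.
Proof. by rewrite /det2 !mxE; ring. Qed.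

Lemma dot2E x y : dot x y = x 0 0 * y 0 0 + x 0 1 * y 0 1.
Proof. by rewrite dotE sum_ord2. Qed.

Lemma sqr_det2 p q : det2 p q ^+ 2 = dot p p * dot q q - dot p q ^+ 2.
Proof. by rewrite /det2 !dot2E; ring. Qed.

Lemma triangle_disk : triangle `<=` unit_disk.
Proof.
move=> x /mem_triangle[x0 x1 x01]; rewrite /unit_disk /= dot2E.
have : 0 <= x 0 0 * x 0 1 by rewrite mulr_ge0.
have : (x 0 0 + x 0 1) ^+ 2 <= 1 by rewrite expr_le1// addr_ge0.
rewrite sqrrD mulr2n !expr2; lra.
Qed.

Lemma area_triangle_gt0 : 0 < area triangle.
Proof.
have h0 : (1/2 : R) != 0 by rewrite mulf_neq0 ?invr_eq0 ?oner_eq0 ?pnatr_eq0.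
have : area [set x *m (1/2)%:M | x in @cube R 2] <= area triangle.
  apply: le_area triangle_disk => _ [x xc <-]; apply/mem_triangle.
  rewrite mul_mx_scalar !mxE; have := xc 0; have := xc 1; rewrite !mxE.
  by move=> /andP[? ?] /andP[? ?]; split; lra.
apply: lt_le_trans; rewrite area_mulmx ?unitmxE ?unitfE ?det_scalar ?expf_neq0//.
by rewrite /area lebesgue_rV_cube mulr1 normr_gt0 expf_neq0.
Qed.

Lemma area_unit_disk_gt0 : 0 < area unit_disk.
Proof.
by apply: lt_le_trans area_triangle_gt0 _; apply: le_area => //; exact: triangle_disk.
Qed.

(** If the segment from p to q stays in the disk of radius hi, the triangle 0, p/hi, q/hi lies in
    the sector of the unit disk. Triangles are linear images of [triangle], so determinants give
    their areas. *)
Lemma sector_area_ge p q (hi : R) : 0 < hi -> det2 p q != 0 ->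
  (forall s t, 0 <= s -> 0 <= t -> s + t = 1 ->
     dot (s *: p + t *: q) (s *: p + t *: q) <= hi ^+ 2) ->
  `|det2 p q| * area triangle / hi ^+ 2 <= area (sector p q `&` unit_disk).
Proof.
move=> hi0 d0 H.
have d1 : det2 (hi^-1 *: p) (hi^-1 *: q) != 0.
  by rewrite det2Z mulf_neq0// expf_neq0// invr_eq0 gt_eqF.
have -> : `|det2 p q| * area triangle / hi ^+ 2 =
    area [set x *m mx_rows (hi^-1 *: p) (hi^-1 *: q) | x in triangle].
  rewrite area_mulmx ?mx_rows_unit// det_mx_rows det2Z normrM.
  by rewrite ger0_norm ?sqr_ge0// exprVn; ring.
apply: le_area => [|x []//]; move=> _ [x /mem_triangle[x0 x1 x01] <-].
rewrite mul_mx_rows; split.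
  exists (x 0 0 / hi), (x 0 1 / hi); rewrite !divr_ge0 ?(ltW hi0)//.
  by rewrite !scalerA.
rewrite /unit_disk /=; set r := x 0 0 + x 0 1.
have [r0|r0] := eqVneq r 0.
  have -> : x 0 0 = 0 by rewrite /r in r0; lra.
  have -> : x 0 1 = 0 by rewrite /r in r0; lra.
  by rewrite !scale0r addr0 dot0l.
have rp : 0 < r by rewrite lt_neqAle eq_sym r0 addr_ge0.
have -> : x 0 0 *: (hi^-1 *: p) + x 0 1 *: (hi^-1 *: q) =
   (r / hi) *: ((x 0 0 / r) *: p + (x 0 1 / r) *: q).
  by rewrite scalerDr !scalerA; congr (_ *: _ + _ *: _); field; rewrite r0 gt_eqF.
rewrite dotZl dotZr mulrA -expr2.
apply: (@le_trans _ _ ((r / hi) ^+ 2 * hi ^+ 2)).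
  rewrite ler_wpM2l ?sqr_ge0// H ?divr_ge0 ?(ltW rp)//.
  by rewrite -mulrDl divff.
rewrite expr_div_n divfK ?expf_neq0 ?gt_eqF//.
by rewrite expr_le1// ltW.
Qed.

(** The opposite inclusion: if that segment stays at distance at least lo from 0, the triangle 0,
    p/lo, q/lo contains the sector of the unit disk. *)
Lemma sector_area_le p q (lo : R) : 0 < lo -> det2 p q != 0 ->
  (forall s t, 0 <= s -> 0 <= t -> s + t = 1 ->
     lo ^+ 2 <= dot (s *: p + t *: q) (s *: p + t *: q)) ->
  area (sector p q `&` unit_disk) <= `|det2 p q| * area triangle / lo ^+ 2.
Proof.
move=> lo0 d0 H.
have d1 : det2 (lo^-1 *: p) (lo^-1 *: q) != 0.
  by rewrite det2Z mulf_neq0// expf_neq0// invr_eq0 gt_eqF.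
have -> : `|det2 p q| * area triangle / lo ^+ 2 =
    area [set x *m mx_rows (lo^-1 *: p) (lo^-1 *: q) | x in triangle].
  rewrite area_mulmx ?mx_rows_unit// det_mx_rows det2Z normrM.
  by rewrite ger0_norm ?sqr_ge0// exprVn; ring.
apply: fine_le.
- by apply: area_unit_disk_fin => x [].
- rewrite lebesgue_rV_mulmx ?mx_rows_unit// fin_numM//.
  by apply: area_unit_disk_fin; exact: triangle_disk.
apply: le_lebesgue_rV => _ [[s [t [s0 t0 ->]]]] yd.
exists (\row_j (if j == 0 then lo * s else lo * t)); last first.
  by rewrite mul_mx_rows !mxE /= !scalerA; congr (_ *: _ + _ *: _); field; rewrite gt_eqF.
apply/mem_triangle; rewrite !mxE /=; split; rewrite ?mulr_ge0 ?(ltW lo0)//.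
rewrite -mulrDr; set r := s + t.
have [r0|r0] := eqVneq r 0; first by rewrite r0 mulr0.
have rp : 0 < r by rewrite lt_neqAle eq_sym r0 addr_ge0.
rewrite -(@expr_le1 _ 2)// ?mulr_ge0 ?(ltW rp) ?(ltW lo0)//.
apply: le_trans yd.
have -> : s *: p + t *: q = r *: ((s / r) *: p + (t / r) *: q).
  by rewrite scalerDr !scalerA; congr (_ *: _ + _ *: _); field.
rewrite dotZl dotZr mulrA -expr2 exprMn mulrC ler_wpM2l ?sqr_ge0//.
by rewrite H ?divr_ge0 ?(ltW rp)// -mulrDl divff.
Qed.

Lemma area_split (c : 'rV[R]_2) A : c != 0 -> A `<=` unit_disk ->
  area A = area (A `&` [set x | 0 <= dot x c]) + area (A `&` [set x | dot x c <= 0]).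
Proof.
(* [c'] is [c] turned by a right angle; in the coordinates given by [T] the sign of [dot x c] is the
   sign of the first coordinate. *)
move=> c0 A1; pose c' : 'rV[R]_2 := \row_j (if j == 0 then - c 0 1 else c 0 0).
pose T := (mx_rows c c')^T.
have dT : \det T = dot c c.
  by rewrite det_tr det_mx_rows /det2 !mxE /= dot2E; ring.
have uT : T \in unitmx by rewrite unitmxE unitfE dT dot_eq0.
have T0 x : (x *m T) 0 0 = dot x c.
  by rewrite !mxE sum_ord2 !mxE dot2E.
have A1' (B : set 'rV[R]_2) : lebesgue_rV (A `&` B) \is a fin_num.
  by apply: area_unit_disk_fin; apply: subset_trans A1 => x [].
apply/eqP; rewrite eq_le; apply/andP; split.
  rewrite /area -fineD// fine_le// ?fin_numD ?A1' ?area_unit_disk_fin//.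
  apply: le_trans (lebesgue_rVU _ _); apply: le_lebesgue_rV => x Ax.
  by have /orP[h|h] := le_total 0 (dot x c); [left|right].
rewrite /area -fineD// fine_le// ?fin_numD ?A1' ?area_unit_disk_fin//.
have d0 : 0 < `|\det T| by rewrite dT normr_gt0 dot_eq0.
rewrite -(@lee_pmul2l _ `|\det T|%:E)// ge0_muleDr ?lebesgue_rV_ge0//.
rewrite -!lebesgue_rV_mulmx//.
apply: le_trans (lebesgue_rV_split 0 _).
apply: leeD; apply: le_lebesgue_rV => _ [x [Ax xc] <-]; split; rewrite /= ?T0//; by exists x.
Qed.

(** The map x to -x exchanges the two halves and preserves area. *)
Lemma area_half_disk (c : 'rV[R]_2) : c != 0 ->
  area (unit_disk `&` [set x | 0 <= dot x c]) = area unit_disk / 2.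
Proof.
move=> c0; rewrite (@area_split c unit_disk)//.
suff -> : area (unit_disk `&` [set x | 0 <= dot x c]) =
  area (unit_disk `&` [set x | dot x c <= 0]) by lra.
have -> : unit_disk `&` [set x | 0 <= dot x c] =
   [set x *m (-1)%:M | x in unit_disk `&` [set x | dot x c <= 0]].
  apply/seteqP; split=> [x [x1 xc]|_ [x [x1 xc] <-]].
    exists (- x); last by rewrite mul_mx_scalar scaleN1r opprK.
    split; first by rewrite /unit_disk /= !dotD opprK.
    by rewrite /= dotNl oppr_le0.
  rewrite mul_mx_scalar scaleN1r; split; first by rewrite /unit_disk /= !dotD opprK.
  by rewrite /= dotNl oppr_ge0.
have d1 : \det ((-1)%:M : 'M[R]_2) = 1 by rewrite det_scalar sqrrN expr1n.
by rewrite area_mulmx ?unitmxE ?unitfE d1 ?oner_eq0// normr1 mul1r.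
Qed.

End PlaneSectors.

(** * Convex bodies and differences of valuations *)

Section Bodies.
Variables (R : realType) (n : nat).
Implicit Types (K L M N S : convexBody R n) (x y w : 'rV[R]_n) (t : R).

Definition segment_closed (A : set 'rV[R]_n) := forall x y t, A x -> A y ->
  0 <= t <= 1 -> A (t *: x + (1 - t) *: y).

Lemma convex_setP (A : set 'rV[R]_n) : convex_set A <-> segment_closed A.
Proof.
split=> [cA x y t Ax Ay /andP[t0 t1]|cA x y l].
  have := cA x y (Itv01 t0 t1); rewrite !inE; apply=> //.
rewrite !inE => Ax Ay; apply: cA => //.
by apply/andP; split.
Qed.

Lemma cb_segment_closed K : segment_closed K.
Proof. by apply/convex_setP; exact: cb_convex. Qed.

Lemma cb_inj K L : K = L :> set _ -> K = L.
Proof.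
case: K => A nA cA vA; case: L => B nB cB vB /= AB; subst B.
by congr ConvexBody; exact: Prop_irrelevance.
Qed.

Lemma dot_continuousr (c : 'rV[R]_n) : continuous (fun x => dot x c).
Proof.
rewrite (_ : (fun x => dot x c) = fun x => \sum_i x 0 i * c 0 i); last first.
  by apply/funext => x; rewrite dotE.
move=> x; apply: (@cvg_big _ _ _ _ _ (@add_continuous R^o) _ (nbhs x)).
by move=> i _; apply: cvgMl; exact: coord_continuous.
Qed.

Lemma dot_self_continuous : continuous (fun x : 'rV[R]_n => dot x x).
Proof.
rewrite (_ : (fun x => dot x x) = fun x => \sum_i x 0 i * x 0 i); last first.
  by apply/funext => x; rewrite dotE.
move=> x; apply: (@cvg_big _ _ _ _ _ (@add_continuous R^o) _ (nbhs x)).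
by move=> i _; apply: cvgM; exact: coord_continuous.
Qed.

Lemma cb_bounded K : exists2 B, 0 <= B & forall x, cb_set K x -> enorm x <= B.
Proof.
have [|c _ cmax] := @compact_EVT_max 'rV[R]_n R (fun x => dot x x) K (cb_nonempty K) (@cb_compact _ _ K).
  by apply: continuous_subspaceT; exact: dot_self_continuous.
exists (enorm c); first exact: enorm_ge0.
move=> x Kx; rewrite ler_sqrt ?dot_ge0//.
by apply: cmax; rewrite inE.
Qed.

Lemma cb_closed K : closed (cb_set K).
Proof. by apply: compact_closed (@cb_compact _ _ K); exact: norm_hausdorff. Qed.

Lemma scale_continuousl (w : 'rV[R]_n) : continuous (fun t : R => t *: w).
Proof. by move=> t; apply: cvgZr_tmp; exact: cvg_id. Qed.

Definition cb_map (f : 'rV[R]_n -> 'rV[R]_n) (cf : continuous f)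
    (af : forall x y t, f (t *: x + (1 - t) *: y) = t *: f x + (1 - t) *: f y) K :
  convexBody R n.
Proof.
refine (@ConvexBody R n [set f x | x in K] _ _ _).
- by have [x Kx] := @cb_nonempty _ _ K; exists (f x); exists x.
- by apply: continuous_compact (@cb_compact _ _ K); exact: continuous_subspaceT.
- apply/convex_setP => _ _ t [x Kx <-] [y Ky <-] t01.
  by exists (t *: x + (1 - t) *: y); [exact: cb_segment_closed|rewrite af].
Defined.

Definition cb_add K L : convexBody R n.
Proof.
refine (@ConvexBody R n [set x + y | x in K & y in L] _ _ _).
- have [x Kx] := @cb_nonempty _ _ K; have [y Ly] := @cb_nonempty _ _ L.
  by exists (x + y), x => //; exists y.
- rewrite (_ : [set x + y | x in K & y in L] =
      [set z.1 + z.2 | z in cb_set K `*` cb_set L]); last first.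
    apply/seteqP; split => [_ [x Kx [y Ly <-]]|_ [[x y] [Kx Ly] <-]].
      by exists (x, y).
    by exists x => //; exists y.
  apply: continuous_compact; last first.
    by apply: compact_setX; [exact: (@cb_compact _ _ K)|exact: (@cb_compact _ _ L)].
  by apply: continuous_subspaceT; exact: add_continuous.
- apply/convex_setP => _ _ t [x Kx [y Ly <-]] [x' Kx' [y' Ly' <-]] t01.
  exists (t *: x + (1 - t) *: x'); first exact: cb_segment_closed.
  exists (t *: y + (1 - t) *: y'); first exact: cb_segment_closed.
  by rewrite !scalerDr addrACA.
Defined.

Definition cb_point x : convexBody R n.
Proof.
refine (@ConvexBody R n [set x] _ _ _); first by exists x.
- exact: compact_set1.
- apply/convex_setP => _ _ t -> -> _.
  by rewrite -scalerDl addrC subrK scale1r.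
Defined.

Definition cb_seg w : convexBody R n.
Proof.
refine (@ConvexBody R n [set t *: w | t in [set t | 0 <= t <= 1]] _ _ _).
- by exists (0 *: w), 0 => //=; rewrite lexx ler01.
- apply: continuous_compact; last first.
    rewrite (_ : [set t | 0 <= t <= 1] = `[0, 1]%classic); first exact: segment_compact.
    by apply/seteqP; split => t /=; rewrite in_itv.
  by apply: continuous_subspaceT; exact: scale_continuousl.
- apply/convex_setP => _ _ t [a /andP[a0 a1] <-] [b /andP[b0 b1] <-] /andP[t0 t1].
  exists (t * a + (1 - t) * b : R); last by rewrite [LHS]scalerDl -!scalerA.
  apply/andP; split.
    by rewrite addr_ge0// mulr_ge0// subr_ge0.
  have : t * a <= t by rewrite ler_piMr.
  have : (1 - t) * b <= 1 - t by rewrite ler_piMr// subr_ge0.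
  lra.
Defined.

Definition cb_scale t K : convexBody R n.
Proof.
apply: (@cb_map (fun x => t *: x)) K; first exact: scaler_continuous.
by move=> x y s; rewrite scalerDr !scalerA !(mulrC t).
Defined.

Definition cb_shift (z : 'rV[R]_n) K : convexBody R n.
Proof.
apply: (@cb_map (fun x => z + x)) K.
  by move=> x; apply: (@cvgD _ _ _ (nbhs x) _ (fun=> z) id); [exact: cvg_cst|exact: cvg_id].
move=> x y s; rewrite !scalerDr addrACA -scalerDl.
by rewrite (addrC s) subrK scale1r.
Defined.

End Bodies.

(** * Real valuations and Minkowski addition of segments *)

Section RealValuations.
Variables (R : realType) (n : nat).
Implicit Types (K L M N S : convexBody R n) (x y w : 'rV[R]_n) (t : R)
  (m : convexBody R n -> R).

Definition is_real_valuation m := forall K L M N, M = K `|` L :> set _ ->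
  N = K `&` L :> set _ -> m M = m K + m L - m N.

Definition real_val_continuous m := forall K (e : R), 0 < e -> exists2 d : R, 0 < d &
  forall L, hausdorff_dist K L < d -> `|m K - m L| < e.

Definition real_translation_invariant m := forall K L x,
  L = [set x + y | y in K] :> set _ -> m L = m K.

Definition real_val m := [/\ is_real_valuation m, real_val_continuous m &
  real_translation_invariant m].

(** Connectedness of [0, 1]: if K and L were disjoint along the segment, the parameters of its
    points in K would form a nonempty subset that is both open and closed. *)
Lemma union_convex_crossing K L M x y : M = K `|` L :> set _ ->
  cb_set K x -> cb_set L y ->
  exists2 t, 0 <= t <= 1 & (K `&` L) (t *: x + (1 - t) *: y).
Proof.
move=> MKL Kx Ly; pose z t := t *: x + (1 - t) *: y.
have zc : continuous z.
  move=> t; apply: cvgD; first exact: scale_continuousl.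
  apply: cvgZr_tmp; apply: cvgB; [exact: cvg_cst|exact: cvg_id].
apply: contrapT => noz.
have Mz t : 0 <= t <= 1 -> cb_set M (z t).
  by apply: cb_segment_closed; rewrite MKL; [left|right].
have disj t : 0 <= t <= 1 -> (cb_set K (z t)) <-> ~ cb_set L (z t).
  move=> t01; split=> [Kz Lz|nLz]; first by apply: noz; exists t.
  by have := Mz t t01; rewrite MKL => -[].
have cK : closed (z @^-1` K) by apply: closed_comp (@cb_closed _ _ K) => t _; exact: zc.
have cL : closed (z @^-1` L) by apply: closed_comp (@cb_closed _ _ L) => t _; exact: zc.
have itv01 t : `[0, 1]%classic t = (0 <= t <= 1) :> Prop by rewrite /= in_itv.
have z1 : z 1 = x by rewrite /z subrr scale0r addr0 scale1r.
have z0 : z 0 = y by rewrite /z subr0 scale0r add0r scale1r.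
have E : `[0, 1]%classic `&` z @^-1` K = `[0, 1]%classic.
  apply: (@segment_connected R 0 1).
  - by exists 1; split; [rewrite itv01 lexx ler01|rewrite /= z1].
  - exists (~` (z @^-1` L)); first by rewrite openC.
    by apply/seteqP; split => t [/[dup] t01 + tz]; rewrite itv01 => /disj h;
      split => //; apply/h.
  - by exists (z @^-1` K).
have : (`[0, 1]%classic `&` z @^-1` K) 0 by rewrite E itv01 lexx ler01.
by move=> [_ /=] /(disj 0 _)[]; rewrite ?lexx ?ler01// z0.
Qed.

Lemma cb_addU K L M S : M = K `|` L :> set _ ->
  cb_add M S = cb_add K S `|` cb_add L S :> set _.
Proof.
move=> MKL; apply/seteqP; split=> [z [x + [y Sy <-]]|z [|] [x Kx [y Sy <-]]].
- by rewrite MKL => -[Kx|Lx]; [left|right]; exists x => //; exists y.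
- by exists x; [rewrite MKL; left|exists y].
- by exists x; [rewrite MKL; right|exists y].
Qed.

(** Minkowski sums do not commute with intersections in general. Here a common point is x + y = x' +
    y' with x in K and x' in L; convexity of the union provides a point of [x, x'] in both, and the
    same combination of y and y' completes it. *)
Lemma cb_addI K L M N S : M = K `|` L :> set _ -> N = K `&` L :> set _ ->
  cb_add N S = cb_add K S `&` cb_add L S :> set _.
Proof.
move=> MKL NKL; apply/seteqP; split=> z.
  move=> [x + [y Sy <-]]; rewrite NKL => -[Kx Lx].
  by split; exists x => //; exists y.
move=> [[x Kx [y Sy <-]] [x' Lx [y' Sy' E]]].
have [t t01 z01] := union_convex_crossing MKL Kx Lx.
exists (t *: x + (1 - t) *: x'); first by rewrite NKL.
exists (t *: y + (1 - t) *: y'); first exact: cb_segment_closed.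
by rewrite addrACA -!scalerDr E -scalerDl addrC subrK scale1r.
Qed.

Definition hausdorff_set K L : set R := [set r : R | [/\ 0 <= r,
    (forall x, cb_set K x -> exists2 y, cb_set L y & enorm (x - y) <= r) &
    (forall y, cb_set L y -> exists2 x, cb_set K x & enorm (x - y) <= r)]].

Lemma hausdorff_dist_le K L r : hausdorff_set K L r -> hausdorff_dist K L <= r.
Proof. by move=> h; apply: ge_inf => //; exists 0 => s []. Qed.

Lemma hausdorff_set_nonempty K L : hausdorff_set K L !=set0.
Proof.
have [a a0 Ka] := cb_bounded K; have [b b0 Lb] := cb_bounded L.
have [x Kx] := @cb_nonempty _ _ K; have [y Ly] := @cb_nonempty _ _ L.
have H u v : cb_set K u -> cb_set L v -> enorm (u - v) <= a + b.
  move=> Ku Lv; apply: le_trans (enormD _ _) _; rewrite enormN.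
  by apply: lerD; [exact: Ka|exact: Lb].
exists (a + b); split; first exact: addr_ge0.
  by move=> u Ku; exists y => //; exact: H.
by move=> v Lv; exists x => //; exact: H.
Qed.

Lemma hausdorff_dist_add K L S :
  hausdorff_dist (cb_add K S) (cb_add L S) <= hausdorff_dist K L.
Proof.
apply: lb_le_inf; first exact: hausdorff_set_nonempty.
move=> r [r0 KL LK]; apply: hausdorff_dist_le; split => //.
  move=> _ [x Kx [s Ss <-]]; have [y Ly xy] := KL x Kx.
  by exists (y + s); [exists y => //; exists s|rewrite (addrC y) addrKA].
move=> _ [y Ly [s Ss <-]]; have [x Kx xy] := LK y Ly.
by exists (x + s); [exists x => //; exists s|rewrite (addrC y) addrKA].
Qed.

Definition val_delta S m K := m (cb_add K S) - m K.

Lemma val_delta_real_val S m : real_val m -> real_val (val_delta S m).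
Proof.
move=> [mv mc mt]; split.
- move=> K L M N MKL NKL; rewrite /val_delta (mv K L M N)//.
  rewrite (mv (cb_add K S) (cb_add L S) (cb_add M S) (cb_add N S)); first by ring.
    exact: cb_addU.
  exact: cb_addI MKL NKL.
- move=> K e e0; have e2 : 0 < e / 2 by rewrite divr_gt0.
  have [d d0 dP] := mc K _ e2; have [d' d'0 d'P] := mc (cb_add K S) _ e2.
  exists (Num.min d d'); first by rewrite lt_min d0.
  move=> L; rewrite lt_min => /andP[/dP h1 h2].
  have {}h2 := d'P (cb_add L S) (le_lt_trans (hausdorff_dist_add _ _ _) h2).
  rewrite /val_delta; move: h1 h2; rewrite !ltr_norml => /andP[? ?] /andP[? ?].
  by apply/andP; split; lra.
- move=> K L x LK; rewrite /val_delta (mt K L x)//; congr (_ - _).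
  apply: (mt _ _ x); apply/seteqP; split.
    by move=> _ [y + [s Ss <-]]; rewrite LK => -[z Kz <-];
      exists (z + s); [exists z => //; exists s|rewrite addrA].
  move=> _ [_ [z Kz [s Ss <-]] <-]; exists (x + z); first by rewrite LK; exists z.
  by exists s => //; rewrite addrA.
Qed.

(** K + [0, (j+1) w] is the union of K + [0, j w] and j w + K + [0, w], which meet in j w + K; so
    each step adds the same difference. *)
Lemma cb_add_seg_nat m K w (j : nat) : real_val m ->
  m (cb_add K (cb_seg (j%:R *: w))) = m K + j%:R * val_delta (cb_seg w) m K.
Proof.
move=> [mv mc mt]; elim: j => [|j IH].
  rewrite mul0r addr0; congr (m _); apply: cb_inj; apply/seteqP; split=> x /=.
    by move=> [y Ky [_ [t _ <-] <-]]; rewrite scale0r scaler0 addr0.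
  by move=> Kx; exists x => //; exists 0; rewrite ?addr0//; exists 0;
    rewrite /= ?lexx ?ler01 ?scale0r.
pose A := cb_add K (cb_seg (j%:R *: w)).
pose B := cb_shift (j%:R *: w) (cb_add K (cb_seg w)).
rewrite (mv A B _ (cb_shift (j%:R *: w) K)).
- rewrite IH (mt (cb_add K (cb_seg w)) B (j%:R *: w))//.
  rewrite (mt K (cb_shift (j%:R *: w) K) (j%:R *: w))// -natr1 /val_delta; ring.
- apply/seteqP; split=> z.
    move=> [x Kx [_ [t /andP[t0 t1] <-] <-]].
    have [tN|tN] := lerP (t * j.+1%:R) j%:R.
      left; exists x => //; exists (t * j.+1%:R *: w); last by rewrite scalerA.
      have [j0|j0] := eqVneq j 0%N.
        exists 0; first by rewrite /= lexx ler01.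
        have -> : t = 0 by move: tN; rewrite j0 mulr1; lra.
        by rewrite mul0r !scale0r.
      have Np : 0 < (j%:R : R) by rewrite ltr0n lt0n.
      exists (t * j.+1%:R / j%:R); last by rewrite scalerA divfK ?gt_eqF.
      by rewrite /= divr_ge0 ?mulr_ge0// ler_pdivrMr// mul1r.
    right; exists (x + (t * j.+1%:R - j%:R) *: w); last first.
      by rewrite scalerBl scalerA addrCA [X in _ + X]addrC subrK.
    exists x => //; exists ((t * j.+1%:R - j%:R) *: w) => //.
    exists (t * j.+1%:R - j%:R) => //=; rewrite subr_ge0 ltW//=.
    have : t * j.+1%:R <= j.+1%:R by rewrite ler_piMl.
    by rewrite -natr1; lra.
  move=> [[x Kx [_ [t /andP[t0 t1] <-] <-]]|[_ [x Kx [_ [t /andP[t0 t1] <-] <-]] <-]].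
    exists x => //; exists ((t * j%:R) *: w); last by rewrite scalerA.
    exists (t * j%:R / j.+1%:R); last by rewrite /= scalerA divfK.
    rewrite /= divr_ge0 ?mulr_ge0//= ler_pdivrMr// mul1r.
    by apply: (@le_trans _ _ j%:R); rewrite ?ler_nat// ler_piMl.
  exists x => //; exists ((j%:R + t) *: w); last by rewrite scalerDl addrCA.
  exists ((j%:R + t) / j.+1%:R); last by rewrite /= scalerA divfK.
  rewrite /= divr_ge0 ?addr_ge0//= ler_pdivrMr// mul1r -natr1; lra.
- apply/seteqP; split=> z.
    move=> [x Kx <-]; split.
      exists x => //; exists (j%:R *: w); last by rewrite addrC.
      by exists 1; rewrite ?scale1r//= lexx ler01.
    exists x => //; exists x => //; exists 0; rewrite ?addr0//.
    by exists 0; rewrite ?scale0r//= lexx ler01.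
  move=> [[x Kx [_ [t /andP[t0 t1] <-] <-]] [_ [y Ky [_ [s /andP[s0 s1] <-] <-]] E]].
  (* The common point is [j w + k], and [k] lies in K because it is between [y = k - s w] and
     [x = k + a w]. *)
  set k := y + s *: w; set a := j%:R * (1 - t).
  have a0 : 0 <= a by rewrite mulr_ge0// subr_ge0.
  exists k; last by rewrite -E.
  have xk : x = k + a *: w.
    apply: (@addIr _ (t *: (j%:R *: w))); rewrite -E -addrA !scalerA -scalerDl addrC.
    by rewrite (_ : a + t * j%:R = j%:R)// /a; ring.
  have yk : y = k - s *: w by rewrite addrK.
  have [as0|as0] := eqVneq (a + s) 0.
    have -> : k = x; last by [].
    by rewrite xk (_ : a = 0) ?scale0r ?addr0//; lra.
  have asp : 0 < a + s by rewrite lt_neqAle eq_sym as0 addr_ge0.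
  suff -> : k = (s / (a + s)) *: x + (1 - s / (a + s)) *: y.
    apply: cb_segment_closed => //; rewrite divr_ge0 ?(ltW asp)//=.
    by rewrite ler_pdivrMr// mul1r lerDr.
  by clearbody k; apply/rowP => i; rewrite xk yk !mxE; field.
Qed.

End RealValuations.

(** * Iterated differences as limits *)

Section SegmentLimits.
Variables (R : realType) (n : nat).
Implicit Types (K L S : convexBody R n) (x y w : 'rV[R]_n) (t : R)
  (m : convexBody R n -> R) (s : seq 'rV[R]_n).

Definition cb_addsegs K s := foldr (fun w K => cb_add K (cb_seg w)) K s.

Definition scale_seq t s : seq 'rV[R]_n := [seq t *: w | w <- s].

Definition val_deltas m s := foldl (fun m w => val_delta (cb_seg w) m) m s.

Lemma val_deltas_real_val m s : real_val m -> real_val (val_deltas m s).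
Proof. by elim: s m => [//|w s IH] m mv /=; apply: IH; exact: val_delta_real_val. Qed.

Lemma natrV_cvg0 : (i%:R^-1 : R) @[i --> \oo] --> 0.
Proof.
rewrite -(cvg_shiftS (fun i : nat => i%:R^-1 : R)).
exact: cvg_harmonic.
Qed.

Let oo_filter : Filter (\oo : set_system nat).
Proof. exact _. Qed.

(** Linearity in i along w splits the value into that of the sum without w, which is of lower order,
    and i times the difference valuation of that sum, to which the induction hypothesis applies. *)
Lemma addsegs_cvg m s K : real_val m ->
  (m (cb_addsegs K (scale_seq i%:R s)) / i%:R ^+ size s) @[i --> \oo] -->
  val_deltas m s K.
Proof.
elim: s m => [|w s IH] m mv /=.
  by rewrite (_ : (fun i => _) = fun=> m K); [exact: cvg_cst|
    apply/funext => i; rewrite expr0 divr1].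
have h1 := IH m mv; have h2 := IH _ (val_delta_real_val (cb_seg w) mv).
have h3 := cvgD (cvgM h1 natrV_cvg0) h2.
have {}h3 := h3 oo_filter oo_filter.
rewrite mulr0 add0r in h3.
apply: cvg_trans h3; apply: near_eq_cvg; near=> i.
have i0 : (i%:R : R) != 0.
  by rewrite pnatr_eq0 -lt0n; near: i; exact: nbhs_infty_gt.
rewrite !fctE /= cb_add_seg_nat// exprS; field.
by rewrite expf_neq0.
Unshelve. all: by end_near. Qed.

(** Makes the faces that lose a segment negligible: fewer than d segments cannot compensate for the
    division by i^d. *)
Lemma addsegs_cvg0 m s (d : nat) K : real_val m -> (size s < d)%N ->
  (m (cb_addsegs K (scale_seq i%:R s)) / i%:R ^+ d) @[i --> \oo] --> 0.
Proof.
move=> mv sd; have h1 := cvgM (@addsegs_cvg m s K mv) natrV_cvg0.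
have {}h1 := h1 oo_filter.
have h2 : (m (cb_addsegs K (scale_seq i%:R s)) / i%:R ^+ (size s).+1) @[i --> \oo] --> 0.
  rewrite mulr0 in h1; apply: cvg_trans h1; apply: near_eq_cvg; near=> i.
  by rewrite /= exprS invfM [i%:R^-1 * _]mulrC mulrA.
have [e ->] : exists e, d = ((size s).+1 + e)%N by exists (d - (size s).+1)%N; lia.
elim: e => [|e IH]; first by rewrite addn0.
have h3 := cvgM IH natrV_cvg0; have {}h3 := h3 oo_filter; rewrite mulr0 in h3.
apply: cvg_trans h3; apply: near_eq_cvg; near=> i.
by rewrite /= addnS exprS invfM [i%:R^-1 * _]mulrC mulrA.
Unshelve. all: by end_near. Qed.

Definition real_homogeneous (d : nat) m := forall K L t, 0 < t ->
  L = [set t *: y | y in K] :> set _ -> m L = t ^+ d * m K.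

Lemma scale_addsegs t K s :
  cb_scale t (cb_addsegs K s) = cb_addsegs (cb_scale t K) (scale_seq t s).
Proof.
elim: s => [//|w s IH] /=; rewrite -IH; apply: cb_inj; apply/seteqP; split.
  move=> _ [_ [x Kx [_ [r r01 <-] <-]] <-].
  exists (t *: x); first by exists x.
  exists (r *: (t *: w)); first by exists r.
  by rewrite scalerDr !scalerA (mulrC r).
move=> _ [_ [x Kx <-] [_ [r r01 <-] <-]].
exists (x + r *: w); last by rewrite scalerDr !scalerA (mulrC r).
by exists x => //; exists (r *: w) => //; exists r.
Qed.

(** Of the degree of m, [size s] is used up by the division, which leaves 1; the comparison runs
    along the subsequence [j i]. Natural factors suffice because the meshes are of the form 1/N. *)
Lemma val_deltas_scale_nat m s K (j : nat) : real_val m ->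
  real_homogeneous (size s).+1 m -> (0 < j)%N ->
  val_deltas m s (cb_scale j%:R K) = j%:R * val_deltas m s K.
Proof.
move=> mv mh j0.
have h1 := @addsegs_cvg m s (cb_scale j%:R K) mv.
have h2 := cvgMr (a := j%:R) (@addsegs_cvg m s K mv).
have jR : (j%:R : R) != 0 by rewrite pnatr_eq0 -lt0n.
have jinf := @cvg_mulnr j j0.
have h3 := cvg_comp _ _ jinf h1.
have {}h2 := h2 oo_filter.
apply: (cvg_unique _ h3); first exact: norm_hausdorff.
apply: cvg_trans h2; apply: near_eq_cvg; near=> i.
rewrite /= natrM [_ * j%:R]mulrC.
have -> : scale_seq (j%:R * i%:R) s = scale_seq j%:R (scale_seq i%:R s).
  by rewrite /scale_seq -map_comp; apply: eq_map => w /=; rewrite scalerA.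
rewrite -scale_addsegs (mh (cb_addsegs K (scale_seq i%:R s)) (cb_scale j%:R _) j%:R)// ?ltr0n//.
have i0 : (i%:R : R) != 0.
  by rewrite pnatr_eq0 -lt0n; near: i; exact: nbhs_infty_gt.
by rewrite exprMn exprS; field; rewrite !expf_neq0.
Unshelve. all: by end_near. Qed.

End SegmentLimits.

(** * Angles, faces and angular sums *)

Section OrthonormalBases.
Variables (R : realType) (n : nat).
Implicit Types (E U V : {vspace 'rV[R]_n}) (x y w : 'rV[R]_n) (t : R).

Lemma memv_orthv_line x y : (y \in orthv <[x]>%VS) = (dot y x == 0).
Proof.
apply/idP/eqP => [/mem_orthv|yx]; first by apply; exact: memv_line.
by apply/mem_orthv => _ /vlineP[t ->]; rewrite dotZr yx mulr0.
Qed.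

Lemma orthv_cap0 E : (E :&: orthv E = 0)%VS.
Proof.
apply/eqP; rewrite -subv0; apply/subvP => x; rewrite memv_cap memv0 => /andP[xE].
by move=> /mem_orthv/(_ x xE)/eqP; rewrite dot_eq0.
Qed.

Lemma orthonormal_exists E (d : nat) : \dim E = d -> exists u : 'I_d -> 'rV[R]_n,
  orthonormal_family u /\ forall i, u i \in E.
Proof.
elim: d E => [|d IH] E dE; first by exists (fun=> 0); split=> [[]|[]].
have v0 : vpick E != 0 by rewrite vpick0 -dimv_eq0 dE.
pose e := (enorm (vpick E))^-1 *: vpick E.
have ne0 : enorm (vpick E) != 0 by rewrite enorm_eq0.
have ee : dot e e = 1.
  by rewrite !dotD -sqr_enorm expr2; field.
have eE : e \in E by rewrite memvZ ?memv_pick.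
have e0 : e != 0 by rewrite -dot_eq0 ee oner_eq0.
clearbody e.
pose E' := (E :&: orthv <[e]>)%VS.
have sumE : (<[e]> + E' = E)%VS.
  apply/eqP; rewrite eqEsubv subv_add -memvE eE capvSl/=.
  apply/subvP => x xE; apply/memv_addP; exists (dot x e *: e).
    by rewrite memvZ ?memv_line.
  exists (x - dot x e *: e); last by rewrite addrC subrK.
  rewrite memv_cap; apply/andP; split; first by rewrite memvB// memvZ.
  by rewrite memv_orthv_line !dotD ee mulr1 subrr.
have capE : (<[e]> :&: E' = 0)%VS.
  by rewrite /E' capvA (capvC <[e]>%VS) -capvA orthv_cap0 capv0.
have dE' : \dim E' = d.
  by move: dE; rewrite -sumE dimv_disjoint_sum// dim_vline e0 => -[].
have [u [uo uE]] := IH _ dE'.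
exists (fun i => if unlift ord0 i is Some j then u j else e); split; last first.
  move=> i; case: unliftP => [j _|_]; last exact: eE.
  by have := uE j; rewrite memv_cap => /andP[].
have ue j : dot (u j) e = 0.
  by have := uE j; rewrite memv_cap memv_orthv_line => /andP[_ /eqP].
move=> i j; case: unliftP => [i' ->|->]; case: unliftP => [j' ->|->].
- by rewrite uo (inj_eq (@lift_inj _ _)).
- by rewrite ue eq_sym (negPf (neq_lift _ _)).
- by rewrite dotC ue (negPf (neq_lift _ _)).
- by rewrite eqxx ee.
Qed.

Lemma onbP E : (onb E *m (onb E)^T = 1%:M) /\ forall i, row i (onb E) \in E.
Proof.
have : [set B : 'M[R]_(\dim E, n) | orthonormal_family (fun i => row i B) /\
                  forall i, row i B \in E] (onb E).
  apply: xgetPex; have [u [uo uE]] := orthonormal_exists (erefl (\dim E)).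
  exists (\matrix_i u i); split=> [i j|i]; by rewrite !rowK.
move=> [bo bE]; split => //; apply/matrixP => i j.
have := bo i j; rewrite /dot !mxE => <-.
by apply: eq_bigr => l _; rewrite !mxE.
Qed.

Lemma dot_mulmx_frame (k : nat) (B : 'M[R]_(k, n)) (x y : 'rV[R]_k) :
  B *m B^T = 1%:M -> dot (x *m B) (y *m B) = dot x y.
Proof.
by move=> B1; rewrite /dot trmx_mul mulmxA -(mulmxA x) B1 mulmx1.
Qed.

Lemma frame_span E (k : nat) (B : 'M[R]_(k, n)) : k = \dim E -> B *m B^T = 1%:M ->
  (forall i, row i B \in E) -> forall x, x \in E -> x *m B^T *m B = x.
Proof.
move=> kE B1 BE; pose X := [tuple row i B | i < k].
have Xi (i : 'I_k) : X`_i = row i B by rewrite -tnth_nth tnth_mktuple.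
have Xfree : free X.
  apply/freeP => c c0 i.
  have c0' : (\row_i c i) *m B = 0.
    by rewrite mulmx_sum_row -[RHS]c0; apply: eq_bigr => j _; rewrite !mxE Xi.
  have : (\row_i c i) *m B *m B^T = 0 by rewrite c0' mul0mx.
  by rewrite -mulmxA B1 mulmx1 => /rowP/(_ i); rewrite !mxE.
have XE : <<X>>%VS = E.
  apply/eqP; rewrite eqEdim; apply/andP; split.
    by apply/span_subvP => _ /tnthP[i ->]; rewrite tnth_mktuple.
  by rewrite (eqnP Xfree) size_tuple kE.
move=> x; rewrite -{1}XE => /coord_span ->.
rewrite !mulmx_suml; apply: eq_bigr => i _.
by rewrite -!scalemxAl Xi rowE -!mulmxA (mulmxA B) B1 mul1mx.
Qed.

Lemma mulmx_frame_mem E (k : nat) (B : 'M[R]_(k, n)) (y : 'rV[R]_k) :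
  (forall i, row i B \in E) -> y *m B \in E.
Proof.
by move=> BE; rewrite mulmx_sum_row memv_suml// => i _; rewrite memvZ.
Qed.

Lemma dim_rV : \dim (fullv : {vspace 'rV[R]_n}) = n.
Proof. by rewrite dimvf /dim /= mul1n. Qed.

Lemma addv_orthv E : (E + orthv E = fullv)%VS.
Proof.
apply/eqP; rewrite eqEsubv subvf/=; apply/subvP => x _.
have [B1 BE] := onbP E.
apply/memv_addP; exists (x *m (onb E)^T *m onb E).
  exact: mulmx_frame_mem.
exists (x - x *m (onb E)^T *m onb E); last by rewrite addrC subrK.
apply/mem_orthv => y yE; rewrite -(frame_span erefl B1 BE yE).
rewrite dotBl dot_mulmx_frame//.
by rewrite /dot trmx_mul mulmxA subrr.
Qed.

Lemma dim_orthv E : (\dim E + \dim (orthv E))%N = n.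
Proof. by rewrite -dimv_disjoint_sum ?orthv_cap0// addv_orthv dim_rV. Qed.

End OrthonormalBases.

(** * External angles as planar areas *)

Section AngleArea.
Variables (R : realType) (n : nat).
Implicit Types (E U V : {vspace 'rV[R]_n}) (x y w : 'rV[R]_n) (t : R).

Definition plane_frame E (B : 'M[R]_(2, n)) := [/\ B *m B^T = 1%:M,
  (forall y : 'rV[R]_2, y *m B \in E) & forall x, x \in E -> x *m B^T *m B = x].

Lemma plane_frame_volume E : \dim E = 2 -> exists B, plane_frame E B /\
  forall A : set 'rV[R]_n, volume E A = area [set x *m B^T | x in A].
Proof.
move=> dE; rewrite /volume; have [B1 BE] := onbP E.
have Bs := frame_span erefl B1 BE; have Bm := fun y : 'rV[R]_(\dim E) => mulmx_frame_mem y BE.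
(* Generalizing over [onb E] allows [\dim E] to be replaced by 2 inside its type. *)
move: (onb E) B1 Bs Bm {BE}; rewrite dE => B B1 Bs Bm.
by exists B; split.
Qed.

(** The cone over the part of C on the sphere is the part of C in the unit disk. The origin belongs
    to the former only if C meets the sphere, whence the nonzero vector. The factor 2 is
    [\dim E]. *)
Lemma sphere_measure_area E (B : 'M[R]_(2, n)) (C : set 'rV[R]_n) :
  \dim E = 2 -> plane_frame E B ->
  (forall A : set 'rV[R]_n, volume E A = area [set x *m B^T | x in A]) ->
  (forall x t, C x -> 0 <= t -> C (t *: x)) ->
  (exists x, [/\ x \in E, x != 0 & C x]) ->
  sphere_measure E (C `&` sphere E) =
    2 * area (@unit_disk R `&` [set y | C (y *m B)]).
Proof.
move=> dE [B1 Bm Bs] Bv Cs [v [vE v0 Cv]].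
rewrite /sphere_measure dE Bv; congr (_ * area _); apply/seteqP; split.
  move=> _ [_ [t [x [t01 [Cx [xE x1]] ->]]] <-].
  have tE : t *: x \in E by rewrite memvZ.
  have t0 : 0 <= t by case/andP: t01.
  split; last by rewrite /= Bs//; exact: Cs.
  rewrite /unit_disk /= -(dot_mulmx_frame _ _ B1) Bs//.
  rewrite !dotD -sqr_enorm x1 expr1n mulr1.
  by case/andP: t01 => _ t1; rewrite mulr_ile1.
move=> y [y1 Cy]; exists (y *m B); last by rewrite -mulmxA B1 mulmx1.
have yE := Bm y.
have [yB0|yB0] := eqVneq (y *m B) 0.
  have nv0 : enorm v != 0 by rewrite enorm_eq0.
  exists 0, ((enorm v)^-1 *: v); rewrite lexx ler01 scale0r; split=> //.
  split; first by apply: Cs => //; rewrite invr_ge0 enorm_ge0.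
  split; first by rewrite memvZ.
  by rewrite enormZ ger0_norm ?invr_ge0 ?enorm_ge0// mulVf.
have ny0 : enorm (y *m B) != 0 by rewrite enorm_eq0.
exists (enorm (y *m B)), ((enorm (y *m B))^-1 *: (y *m B)); split.
- rewrite enorm_ge0/= -(@expr_le1 _ 2) ?enorm_ge0//.
  by rewrite sqr_enorm dot_mulmx_frame.
- split; first by apply: Cs => //; rewrite invr_ge0 enorm_ge0.
  split; first by rewrite memvZ.
  by rewrite enormZ ger0_norm ?invr_ge0 ?enorm_ge0// mulVf.
- by rewrite scalerA divff// scale1r.
Qed.

Lemma sphere_measure_sphere E : \dim E = 2 -> sphere_measure E (sphere E) = 2 * area (@unit_disk R).
Proof.
move=> dE; have [B [Bf Bv]] := plane_frame_volume dE.
rewrite -[sphere E]setTI (sphere_measure_area dE Bf Bv)//.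
  by congr (_ * area _); apply/seteqP; split=> [y []|y].
by exists (vpick E); rewrite memv_pick vpick0 -dimv_eq0 dE.
Qed.

Lemma external_angle_area (F P : set 'rV[R]_n) (B : 'M[R]_(2, n)) :
  let E := orthv (direction F) in
  \dim E = 2 -> plane_frame E B ->
  (forall A : set 'rV[R]_n, volume E A = area [set x *m B^T | x in A]) ->
  (exists x, [/\ x \in E, x != 0 & normal_cone P F x]) ->
  external_angle F P =
    area (@unit_disk R `&` [set y | normal_cone P F (y *m B)]) / area (@unit_disk R).
Proof.
move=> E dE Bf Bv Cex; rewrite /external_angle -/E -dimv_eq0 dE /=.
rewrite sphere_measure_sphere// (sphere_measure_area dE Bf Bv)//.
  by rewrite -mulf_div divff ?mul1r// pnatr_eq0.
move=> x t Cx t0 p q Fp Pq; rewrite !dotZl ler_wpM2l//; exact: Cx.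
Qed.

Lemma external_angle_bound (F P : set 'rV[R]_n) :
  \dim (orthv (direction F)) = 2 -> 0 <= external_angle F P <= 1.
Proof.
move=> dE; rewrite /external_angle -dimv_eq0 dE /=; set E := orthv _ in dE *.
have A0 := area_unit_disk_gt0 R.
rewrite sphere_measure_sphere//.
have [B [[B1 Bm Bs] Bv]] := plane_frame_volume dE.
rewrite /sphere_measure dE Bv -mulf_div divff ?pnatr_eq0// mul1r.
rewrite divr_ge0 ?area_ge0//= ler_pdivrMr// mul1r.
apply: le_area => // _ [_ [t [x [t01 [Cx [xE x1]] ->]]] <-].
have tE : t *: x \in E by rewrite memvZ.
rewrite /unit_disk /= -(dot_mulmx_frame _ _ B1) Bs//.
rewrite !dotD -sqr_enorm x1 expr1n mulr1.
by case/andP: t01 => t0 t1; rewrite mulr_ile1.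
Qed.

End AngleArea.

(** * Directions of affine hulls *)

Section Directions.
Variables (R : realType) (n : nat).
Implicit Types (E U V : {vspace 'rV[R]_n}) (x y w : 'rV[R]_n) (t : R)
  (A F P : set 'rV[R]_n).

Lemma sub_aff_hull A : A `<=` aff_hull A.
Proof.
move=> x Ax; exists 1%N, (fun=> x), (fun=> 1).
by rewrite !big_ord1 scale1r.
Qed.

Lemma aff_hull_subv A x U : (forall y, A y -> y - x \in U) ->
  forall y, aff_hull A y -> y - x \in U.
Proof.
move=> AU _ [k [p [l [Ap l1 ->]]]].
have -> : \sum_i l i *: p i - x = \sum_i l i *: (p i - x).
  rewrite -[X in _ - X]scale1r -l1 scaler_suml -sumrB.
  by apply: eq_bigr => i _; rewrite scalerBr.
by apply: memv_suml => i _; rewrite memvZ// AU.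
Qed.

(* [direction] defaults to the zero space, so a positive dimension certifies
   that it really is the direction of the affine hull. *)
Lemma directionP A : (0 < \dim (direction A))%N ->
  exists x, aff_hull A = [set x + v | v in [set` direction A]].
Proof.
rewrite /direction; case: xgetP => [E -> //|_]; by rewrite dimv0.
Qed.

Lemma mem_direction A x y : (0 < \dim (direction A))%N -> A x -> A y ->
  x - y \in direction A.
Proof.
move=> /directionP[z zA] /sub_aff_hull + /sub_aff_hull; rewrite zA.
move=> [v vA <-] [w wA <-]; rewrite opprD addrACA subrr add0r.
exact: memvB.
Qed.

Lemma direction_sub A x U : (0 < \dim (direction A))%N ->
  (forall y, A y -> y - x \in U) -> (direction A <= U)%VS.
Proof.
move=> /directionP[z zA] AU; apply/subvP => v vA.
have h w : w \in direction A -> z + w - x \in U.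
  by move=> wA; apply: aff_hull_subv AU _ _; rewrite zA; exists w.
have := memvB (h v vA) (h 0 (mem0v _)).
by rewrite addr0 opprB addrA subrK addrAC subrr add0r.
Qed.

(** [X] certifies both inclusions: it spans all differences and is realised by points of A. The
    subspace picked by [direction] is unique because it consists of the differences of points of the
    hull. *)
Lemma direction_eq A x (X : seq 'rV[R]_n) : A x -> (forall w, w \in X -> A (x + w)) ->
  (forall y, A y -> y - x \in <<X>>%VS) -> direction A = <<X>>%VS.
Proof.
move=> Ax AX AU.
have AE : aff_hull A = [set x + v | v in [set` <<X>>%VS]].
  apply/seteqP; split=> [y /(aff_hull_subv AU) yU|_ [v /= vX <-]].
    by exists (y - x) => //; rewrite addrC subrK.
  rewrite (coord_span (X := in_tuple X) vX).
  pose c i := coord (in_tuple X) i v.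
  exists (size X).+1, (fun i => if unlift ord0 i is Some j then x + X`_j else x),
    (fun i => if unlift ord0 i is Some j then c j else 1 - \sum_j c j).
  split.
  - by move=> i; case: unliftP => [j _|_]//; apply: AX; rewrite mem_nth.
  - rewrite big_ord_recl unlift_none.
    rewrite [X in _ + X](eq_bigr c); last by move=> i _; rewrite liftK.
    by rewrite subrK.
  - rewrite big_ord_recl unlift_none.
    rewrite [X in _ = _ + X](eq_bigr (fun i => c i *: x + c i *: X`_i)); last first.
      by move=> i _; rewrite liftK scalerDr.
    rewrite big_split /= -scaler_suml addrA -scalerDl subrK scale1r.
    by congr (_ + _); apply: eq_bigr => i _.
have [y yE] : exists y, aff_hull A = [set y + v | v in [set` direction A]].
  rewrite /direction; case: xgetP => [E -> //|/(_ <<X>>%VS)[]]; by exists x.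
apply/vspaceP => v; apply/idP/idP => vE.
  have : aff_hull A (y + v) by rewrite yE; exists v.
  have : aff_hull A y by rewrite yE; exists 0; rewrite ?addr0//= mem0v.
  rewrite AE => -[w wX xw] [w' w'X xw'].
  have -> : v = w' - w by move: xw'; rewrite -xw -addrA => /addrI ->; rewrite addrAC subrr add0r.
  exact: memvB.
have : aff_hull A (x + v) by rewrite AE; exists v.
have : aff_hull A x by rewrite AE; exists 0; rewrite ?addr0//= mem0v.
rewrite yE => -[w wX xw] [w' w'X xw'].
have -> : v = w' - w by move: xw'; rewrite -xw -addrA => /addrI ->; rewrite addrAC subrr add0r.
exact: memvB.
Qed.

End Directions.

(** * Faces of polytopes *)

Section Polytopes.
Variables (R : realType) (n : nat).
Implicit Types (x y w a : 'rV[R]_n) (t : R) (A F P V : set 'rV[R]_n)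
  (K L : convexBody R n).

(** Faces are indexed by an outer normal alone, since faces with the same normal add under Minkowski
    sums. *)
Definition max_face P a : set 'rV[R]_n :=
  [set x | P x /\ forall y, P y -> dot a y <= dot a x].

Lemma is_faceP P F : is_face P F -> exists2 a, F !=set0 & F = max_face P a.
Proof.
move=> [F0 [a [b [Pb FE]]]]; exists a => //.
move: (F0) => [z]; rewrite FE => -[Pz /= zb].
apply/seteqP; split=> x.
  by move=> [Px /= xb]; split=> // y /Pb; rewrite xb.
move=> [Px xmax]; split=> //=; apply/eqP; rewrite eq_le Pb//=.
by rewrite -zb xmax.
Qed.

Lemma max_face_is_face K a : is_face K (max_face K a).
Proof.
have [|c Kc cmax] := @compact_EVT_max 'rV[R]_n R (fun x => dot x a) K
    (@cb_nonempty _ _ K) (@cb_compact _ _ K).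
  by apply: continuous_subspaceT; exact: dot_continuousr.
have Mc : max_face K a c.
  split; first exact: set_mem.
  by move=> y Ky; rewrite !(dotC a); apply: cmax; rewrite inE.
split; first by exists c.
exists a, (dot a c); have [Kc' cm] := Mc; split=> //.
apply/seteqP; split=> x [Kx]; last first.
  by move=> /= xc; split=> // y /cm; rewrite xc.
by move=> xm; split=> //=; apply/eqP; rewrite eq_le cm// xm.
Qed.

Definition cb_face K a : convexBody R n.
Proof.
refine (@ConvexBody R n (max_face K a) _ _ _).
- by have [] := max_face_is_face K a.
- have [_ [c [b [cb ->]]]] := max_face_is_face K a.
  apply: compact_closedI (@cb_compact _ _ K) _ => //.
  rewrite (_ : [set x | dot c x = b] = (fun x => dot x c) @^-1` [set b]); last first.
    by apply/seteqP; split=> x /=; rewrite dotC.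
  by apply: closed_comp => [x _|]; [exact: dot_continuousr|exact: closed_eq].
- apply/convex_setP => x y t [Kx xm] [Ky ym] t01.
  split; first exact: cb_segment_closed.
  move=> z Kz; rewrite !dotD.
  have h1 := xm z Kz; have h2 := ym z Kz; case/andP: t01 => t0 t1.
  have : t * dot a z <= t * dot a x by rewrite ler_wpM2l.
  have : (1 - t) * dot a z <= (1 - t) * dot a y by rewrite ler_wpM2l// subr_ge0.
  lra.
Defined.

(** A linear functional maximal at a convex combination is maximal at every point of nonzero weight;
    a point of weight 0 may violate this and is exchanged for [p i0]. *)
Lemma conv_hull_max_face V a :
  max_face (conv_hull V) a = conv_hull (V `&` max_face (conv_hull V) a).
Proof.
have VV : V `<=` conv_hull V.
  move=> x Vx; exists 1%N, (fun=> x), (fun=> 1).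
  by rewrite !big_ord1 scale1r; split=> // _; exact: ler01.
apply/seteqP; split=> [x [[k [p [l [pV l0 l1 xE]]]] xm]|].
  have px i : dot a (p i) <= dot a x by apply/xm/VV.
  have pm i : l i != 0 -> max_face (conv_hull V) a (p i).
    move=> li; split; first exact: VV.
    move=> y /xm yx; apply: le_trans yx _.
    have : \sum_j l j * (dot a x - dot a (p j)) = 0.
      under eq_bigr do rewrite mulrBr.
      rewrite sumrB -mulr_suml l1 mul1r {1}xE [X in X - _]dotC dot_suml -sumrB.
      by apply: big1 => j _; rewrite dotZl (dotC (p j)) subrr.
    move=> /eqP; rewrite psumr_eq0 => [/allP/(_ i (mem_index_enum i))|j _]; last first.
      by rewrite mulr_ge0// subr_ge0.
    by rewrite mulf_eq0 (negPf li) subr_eq0 => /eqP ->.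
  have [i0 li0] : exists i0, l i0 != 0.
    apply: contrapT => /forallNP no; move: l1; rewrite big1 => [/esym/eqP|i _].
      by rewrite oner_eq0.
    by apply/eqP/negPn/negP/no.
  exists k, (fun i => if l i == 0 then p i0 else p i), l; split=> //.
    move=> i; case: ifPn => [_|li]; first by split=> //; exact: pm.
    by split=> //; exact: pm.
  rewrite xE; apply: eq_bigr => i _; case: eqP => // ->.
  by rewrite !scale0r.
move=> _ [k [p [l [pV l0 l1 ->]]]]; split.
  by exists k, p, l; split=> // i; have [] := pV i.
move=> y Vy; rewrite -[leLHS]mul1r -l1 mulr_suml [leRHS]dotC dot_suml.
apply: ler_sum => i _; rewrite dotZl (dotC _ a) ler_wpM2l//.
by have [_ [_]] := pV i; apply.
Qed.

Lemma polytope_face K a : is_polytope K -> is_polytope (cb_face K a).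
Proof.
move=> [V Vf KV]; exists (V `&` max_face (conv_hull V) a).
  by apply: finite_setIl.
by rewrite [LHS]/= KV; exact: conv_hull_max_face.
Qed.

(** A face is the hull of the generating points that lie on it, so there are no more faces than
    subsets of V. *)
Lemma finite_faces k K : is_polytope K -> finite_set (faces k K).
Proof.
move=> [V /finite_seqP[r ->] KV].
pose h (b : {ffun 'I_(size r) -> bool}) :=
  conv_hull [set x | exists2 i : 'I_(size r), b i & x = r`_i].
apply: (@sub_finite_set _ _ [set h b | b in [set: {ffun 'I_(size r) -> bool}]]).
  move=> F [/is_faceP[a _ ->] _]; rewrite KV.
  exists [ffun i : 'I_(size r) => `[< max_face (conv_hull [set` r]) a r`_i >]] => //.
  rewrite [RHS]conv_hull_max_face; congr conv_hull; apply/seteqP; split=> x /=.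
    by move=> [j + ->]; rewrite ffunE => /asboolP xm; split=> //=; exact: mem_nth.
  move=> [xr xm]; have ir : (index x r < size r)%N by rewrite index_mem.
  by exists (Ordinal ir); rewrite ?ffunE /= nth_index//; apply/asboolP.
by apply: finite_image; exact: finite_finset.
Qed.

End Polytopes.

(** * Angular sums and sums with segments *)

Section AngularSums.
Variables (R : realType) (n d : nat).
Hypothesis nd : n = d.+3.
Implicit Types (x y w a : 'rV[R]_n) (t : R) (A F P : set 'rV[R]_n)
  (K L S : convexBody R n) (s : seq 'rV[R]_n).

(** [g F] abstracts the Klain value times the volume; [angular_face] identifies it with a value of
    [m]. *)
Definition real_angular (m : convexBody R n -> R) (g : set 'rV[R]_n -> R) :=
  forall P : convexBody R n, is_polytope P ->
    m P = \sum_(F \in faces d.+1 P) g F * external_angle F P.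

Lemma dim_orthv_direction F : \dim (direction F) = d.+1 ->
  \dim (orthv (direction F)) = 2.
Proof. by move=> dF; have := dim_orthv (direction F); rewrite dF; lia. Qed.

Lemma external_angle_self F : \dim (direction F) = d.+1 -> external_angle F F = 1.
Proof.
move=> dF; rewrite /external_angle -dimv_eq0 dim_orthv_direction//=.
set E := orthv _; have dE : \dim E = 2 by exact: dim_orthv_direction.
rewrite (_ : normal_cone F F `&` sphere E = sphere E).
  rewrite divff// sphere_measure_sphere// mulf_neq0 ?pnatr_eq0//.
  by rewrite gt_eqF// area_unit_disk_gt0.
apply/seteqP; split=> v [] // vE v1; split=> // x y Fx Fy.
rewrite -subr_ge0 -dotBr; have /mem_orthv -> // := vE.
by apply: mem_direction => //; rewrite dF.
Qed.

(** A (d+1)-dimensional polytope is its own only (d+1)-face, with angle 1. Thus [g] can be replaced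
    by [m] on every face of the right dimension. *)
Lemma angular_face m g K : real_angular m g -> is_polytope K ->
  \dim (direction K) = d.+1 -> m K = g K.
Proof.
move=> ang Kp dK; rewrite (ang K Kp).
suff -> : faces d.+1 K = [set cb_set K] by rewrite fsbig_set1 external_angle_self// mulr1.
apply/seteqP; split=> F; last first.
  move=> ->; split=> //; split; first exact: cb_nonempty.
  by exists 0, 0; split=> [x _|]; [rewrite dot0l|apply/seteqP; split=> x //=;
    [rewrite dot0l|case]].
move=> [[[z Fz] [a [b [Kb FE]]]] dF] /=.
have FK : F `<=` K by rewrite FE => x [].
have dFK : (direction F <= direction K)%VS.
  apply: (@direction_sub _ _ _ z); first by rewrite dF.
  by move=> y Fy; apply: mem_direction; rewrite ?dK//; exact: FK.
have DE : direction F = direction K by apply/eqP; rewrite eqEdim dFK dF dK /=.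
apply/seteqP; split=> // x Kx; rewrite FE; split=> //=.
have xz : x - z \in direction F by rewrite DE; apply: mem_direction; rewrite ?dK//; exact: FK.
(* The normal [a] is orthogonal to the direction of F, which is also that of K, so it is constant on
   K. *)
have : (direction F <= orthv <[a]>)%VS.
  apply: (@direction_sub _ _ _ z); first by rewrite dF.
  move=> y Fy; rewrite memv_orthv_line dotC dotBr.
  by move: Fy Fz; rewrite FE => -[_ /= ->] [_ /= ->]; rewrite subrr.
move=> /subvP/(_ _ xz); rewrite memv_orthv_line dotC dotBr subr_eq0 => /eqP ->.
by move: Fz; rewrite FE => -[].
Qed.

Definition set_add A (B : set 'rV[R]_n) : set 'rV[R]_n := [set x + y | x in A & y in B].

Lemma max_face_add K S a :
  max_face (cb_add K S) a = set_add (max_face K a) (max_face S a).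
Proof.
apply/seteqP; split=> [_ [[x Kx [y Sy <-]] xym]|_ [x [Kx xm] [y [Sy ym] <-]]].
  exists x.
    split=> // x' Kx'; have := xym (x' + y); rewrite !dotDr lerD2r; apply.
    by exists x' => //; exists y.
  exists y => //; split=> // y' Sy'; have := xym (x + y'); rewrite !dotDr lerD2l; apply.
  by exists x => //; exists y'.
split; first by exists x => //; exists y.
by move=> _ [x' Kx' [y' Sy' <-]]; rewrite !dotDr lerD ?xm ?ym.
Qed.

Lemma max_face_seg w a : max_face (cb_seg w) a =
  if dot a w == 0 then cb_set (cb_seg w) else if dot a w < 0 then [set 0] else [set w].
Proof.
have S0 : cb_set (cb_seg w) 0 by exists 0; rewrite /= ?lexx ?ler01 ?scale0r.
have S1 : cb_set (cb_seg w) w by exists 1; rewrite /= ?lexx ?ler01 ?scale1r.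
apply/seteqP; split=> [_ [[t /andP[t0 t1] <-] tm]|x].
  have /(_ _ S0) := tm; have /(_ _ S1) := tm; rewrite dot0r dotZr.
  case: eqVneq => aw; first by move=> _ _; exists t => //=; rewrite t0.
  have [lt|gt] := ltP (dot a w) 0 => h1 h2 /=.
    by have -> : t = 0; [nra|rewrite scale0r].
  have {}gt : 0 < dot a w by rewrite lt_neqAle eq_sym aw.
  by have -> : t = 1; [nra|rewrite scale1r].
case: eqVneq => aw.
  move=> [t t01 <-]; split; first by exists t.
  by move=> _ [t' _ <-]; rewrite !dotZr aw !mulr0.
have [lt|gt] := ltP (dot a w) 0 => /= ->; split=> //; move=> _ [t /andP[t0 t1] <-].
  by rewrite dot0r dotZr; nra.
by rewrite dotZr; nra.
Qed.

(* [code] records, for each segment, whether a face of [K + sum of segments]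
   contains the whole segment (0), its initial point (1) or its end point (2). *)
Fixpoint cb_code K s (code : seq 'I_3) : convexBody R n :=
  match s, code with
  | w :: s', c :: code' =>
    if c == 0 then cb_add (cb_code K s' code') (cb_seg w)
    else if c == 1 then cb_code K s' code' else cb_shift w (cb_code K s' code')
  | _, _ => K
  end.

Definition code_of a s : seq 'I_3 :=
  [seq if dot a w == 0 then 0 else if dot a w < 0 then 1 else 2 | w <- s].

Lemma max_face_addsegs K s a :
  max_face (cb_addsegs K s) a = cb_code (cb_face K a) s (code_of a s).
Proof.
elim: s => [//|w s IH].
rewrite (_ : cb_addsegs K (w :: s) = cb_add (cb_addsegs K s) (cb_seg w))//.
rewrite max_face_add max_face_seg IH /=.
case: eqVneq => //= aw; have [lt|gt] := ltP (dot a w) 0 => /=.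
  apply/seteqP; split=> [_ [x Kx [_ -> <-]]|x Kx]; first by rewrite addr0.
  by exists x => //; exists 0; rewrite ?addr0.
apply/seteqP; split=> [_ [x Kx [_ -> <-]]|_ [x Kx <-]]; first by exists x => //; rewrite addrC.
by exists x => //; exists w => //; rewrite addrC.
Qed.

Lemma cb_code_translate K s code (m : convexBody R n -> R) : real_val m ->
  size code = size s -> exists s', [/\ (size s' <= size s)%N,
    ((exists2 c, c \in code & c != 0) -> (size s' < size s)%N) &
    forall t, m (cb_code K (scale_seq t s) code) = m (cb_addsegs K (scale_seq t s'))].
Proof.
move=> mv; suff H : size code = size s -> exists s', [/\ (size s' <= size s)%N,
    ((exists2 c, c \in code & c != 0) -> (size s' < size s)%N) &
    forall t, exists z, cb_code K (scale_seq t s) code =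
      [set z + x | x in cb_addsegs K (scale_seq t s')] :> set _].
  move=> /H[s' [h1 h2 h3]]; exists s'; split=> // t.
  by have [z zE] := h3 t; have [_ _ mt] := mv; exact: mt zE.
elim: s code => [|w s IH] [|c code] //=.
  move=> _; exists [::]; split=> //; first by move=> [].
  by move=> t; exists 0; apply/seteqP; split=> [x Kx|_ [x Kx <-]];
    [exists x; rewrite ?add0r|rewrite add0r].
move=> [/IH[s' [h1 h2 h3]]].
have [c0|c0] := eqVneq c 0.
  exists (w :: s'); split=> //=.
    move=> [e]; rewrite inE c0 => /orP[/eqP -> |ec e0]; first by rewrite eqxx.
    by rewrite ltnS; apply: h2; exists e.
  move=> t; have [z zE] := h3 t; exists z; apply/seteqP; split.
    move=> _ [x + [y Sy <-]]; rewrite zE => -[x' Kx' <-].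
    by exists (x' + y); [exists x' => //; exists y|rewrite addrA].
  move=> _ [_ [x Kx [y Sy <-]] <-]; exists (z + x); first by rewrite zE; exists x.
  by exists y => //; rewrite addrA.
exists s'; split; [exact: leqW| by rewrite ltnS | move=> t].
have [z zE] := h3 t; case: eqVneq => c1; first by exists z.
exists (t *: w + z); apply/seteqP; split.
  by move=> _ [x + <-]; rewrite zE => -[x' Kx' <-]; exists x'; rewrite ?addrA.
by move=> _ [x Kx <-]; exists (z + x); rewrite ?addrA// zE; exists x.
Qed.

(** [V] and [V + w] generate the sum: splitting each weight l_j into (1 - t) l_j and t l_j moves a
    combination by t w. *)
Lemma polytope_add_seg K w : is_polytope K -> is_polytope (cb_add K (cb_seg w)).
Proof.
move=> [V Vf KV]; exists (V `|` [set x + w | x in V]).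
  by rewrite finite_setU; split=> //; exact: finite_image.
rewrite /= KV; apply/seteqP; split.
  move=> _ [_ [k [p [l [pV l0 l1 ->]]]] [_ [t /andP[t0 t1] <-] <-]].
  have sl (j : 'I_k) : fintype.split (lshift k j) = inl j := unsplitK (inl j).
  have sr (j : 'I_k) : fintype.split (rshift k j) = inr j := unsplitK (inr j).
  exists (k + k)%N, (fun i => match fintype.split i with inl j => p j | inr j => p j + w end),
    (fun i => match fintype.split i with inl j => (1 - t) * l j | inr j => t * l j end).
  split.
  - by move=> i; case: (fintype.split i) => j; [left|right; exists (p j)].
  - by move=> i; case: (fintype.split i) => j; rewrite mulr_ge0// subr_ge0.
  - rewrite big_split_ord /= (eq_bigr (fun i => (1 - t) * l i)); last first.
      by move=> i _; rewrite sl.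
    rewrite [X in _ + X](eq_bigr (fun i => t * l i)); last by move=> i _; rewrite sr.
    by rewrite -!mulr_sumr l1 !mulr1 subrK.
  - rewrite [RHS]big_split_ord /= [X in _ = X + _](eq_bigr (fun i => ((1 - t) * l i) *: p i)).
      rewrite [X in _ = _ + X](eq_bigr (fun i => (t * l i) *: (p i + w))).
        rewrite -[RHS]big_split /=.
        rewrite [RHS](eq_bigr (fun i => l i *: p i + (t * l i) *: w)).
          by rewrite big_split/= -scaler_suml -mulr_sumr l1 mulr1.
        move=> i _; rewrite scalerDr addrA -scalerDl; congr (_ *: _ + _).
        by ring.
      by move=> i _; rewrite sr.
    by move=> i _; rewrite sl.
move=> _ [k [p [l [pV l0 l1 ->]]]].
have /choice[q qP] : forall i, exists q : 'rV[R]_n * bool, V q.1 /\ p i = q.1 + (if q.2 then w else 0).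
  move=> i; have [Vp|[x Vx <-]] := pV i.
    by exists (p i, false); rewrite addr0.
  by exists (x, true).
exists (\sum_i l i *: (q i).1).
  by exists k, (fun i => (q i).1), l; split=> // i; have [] := qP i.
exists ((\sum_i l i * (q i).2%:R) *: w).
  exists (\sum_i l i * (q i).2%:R) => //=; rewrite sumr_ge0/=; last by move=> i _; rewrite mulr_ge0.
  rewrite -[leRHS]l1; apply: ler_sum => i _; rewrite ler_piMr//.
  by case: (q i).2; rewrite ?lexx ?ler01.
rewrite scaler_suml -big_split/=; apply: eq_bigr => i _.
have [_ ->] := qP i; rewrite scalerDr; congr (_ + _).
by case: (q i).2; rewrite ?mulr1 ?mulr0 ?scale0r ?scaler0.
Qed.

Lemma polytope_addsegs K s : is_polytope K -> is_polytope (cb_addsegs K s).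
Proof. by move=> Kp; elim: s => //= w s; exact: polytope_add_seg. Qed.

End AngularSums.

(** * Reduction of angular sums to edges *)

Section EdgeSums.
Variables (R : realType) (n d r : nat).
Hypothesis nd : n = d.+3.
Variables (m : convexBody R n -> R) (g : set 'rV[R]_n -> R) (s : seq 'rV[R]_n).
Variables (P0 : convexBody R n) (v : 'I_r -> 'rV[R]_n).
Hypothesis mv : real_val m.
Hypothesis ang : real_angular d m g.
Hypothesis sized : size s = d.
Hypothesis P0E : P0 = conv_hull (range v) :> set _.
Hypothesis free2 : forall i j, i != j -> free (v j - v i :: s).
(** Any three of the points are affinely independent modulo the span of [s], so a face that contains
    three of them and all directions of [s] has dimension at least d + 2. *)
Hypothesis free3 : forall i j l, i != j -> i != l -> j != l ->
  free [:: v j - v i, v l - v i & s].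
Implicit Types (x y w a : 'rV[R]_n) (t : R) (A F P : set 'rV[R]_n)
  (K L S : convexBody R n).

(** The set of faces varies with t; this bounds a sum over it by a sum over a fixed finite index
    type, each face being charged to one of its indices. *)
Lemma fsum_le_index (X : choiceType) (T : finType) (A : set X) (Q : pred T) (h : T -> X)
    (f : X -> R) (phi : T -> R) : finite_set A ->
  (forall x : X, A x -> exists p, [/\ Q p, h p = x & `|f x| <= phi p]) ->
  (forall p, 0 <= phi p) -> `|\sum_(x \in A) f x| <= \sum_(p | Q p) phi p.
Proof.
move=> Afin AP phi0; rewrite fsbig_finite//; set r0 := finmap.enum_fset _.
have r0A (x : X) : x \in r0 -> A x by rewrite in_fset_set// inE.
have ur0 : uniq r0 by exact: finmap.fset_uniq.
apply: le_trans (ler_norm_sum _ _ _) _.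
apply: (@le_trans _ _ (\sum_(x <- r0) \sum_(p | Q p && (h p == x)) phi p)).
  rewrite big_seq [leRHS]big_seq; apply: ler_sum => x /r0A/AP[p [Qp hp fp]].
  rewrite (bigD1 p) ?Qp ?hp ?eqxx//=.
  by apply: le_trans fp _; rewrite lerDl sumr_ge0.
rewrite (exchange_big_dep Q) /=; last by move=> x p _ /andP[].
apply: ler_sum => p Qp; rewrite (eq_bigl (fun x : X => x == h p)); last first.
  by move=> x; rewrite Qp eq_sym.
have [hr|hr] := boolP (h p \in r0); last first.
  rewrite big_seq_cond big1// => x /andP[xr /eqP xh].
  by move: hr; rewrite -xh xr.
rewrite big_mkcond /= (bigD1_seq (h p))//= eqxx big1 ?addr0// => x /negPf ->//.
Qed.

Lemma conv_hull_dot_le (V : set 'rV[R]_n) a (c : R) : (forall y, V y -> dot a y <= c) ->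
  forall y, conv_hull V y -> dot a y <= c.
Proof.
move=> Vc _ [k [p [l [pV l0 l1 ->]]]].
rewrite dotC dot_suml -[leRHS]mul1r -l1 mulr_suml; apply: ler_sum => i _.
by rewrite dotZl dotC ler_wpM2l// Vc.
Qed.

Lemma vertex_mem i : cb_set P0 (v i).
Proof.
rewrite P0E; exists 1%N, (fun=> v i), (fun=> 1).
by rewrite !big_ord1 scale1r; split=> // _; exists i.
Qed.

Definition argmax a : {set 'I_r} := [set i | [forall l, dot a (v l) <= dot a (v i)]]%SET.

Lemma argmaxP a i : reflect (forall l, dot a (v l) <= dot a (v i)) (i \in argmax a).
Proof. by rewrite inE; exact: forallP. Qed.

Lemma max_face_vertices a : max_face P0 a = conv_hull [set v i | i in [set` argmax a]].
Proof.
rewrite P0E conv_hull_max_face; congr conv_hull; apply/seteqP; split.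
  move=> _ [[i _ <-] [_ im]]; exists i => //; apply/argmaxP => l.
  by apply: im; rewrite -P0E; exact: vertex_mem.
move=> _ [i /argmaxP im <-]; split; first by exists i.
split; first by rewrite -P0E; exact: vertex_mem.
by apply: conv_hull_dot_le => _ [l _ <-].
Qed.

Definition edge_body i j := cb_shift (v i) (cb_seg (v j - v i)).

Definition is_edge i j := exists2 a, (forall w, w \in s -> dot a w = 0) &
  argmax a = [set i; j]%SET.

Lemma conv_hull_pair x y : conv_hull [set x; y] = [set x + z | z in cb_seg (y - x)].
Proof.
apply/seteqP; split.
  move=> _ [k [p [l [pV l0 l1 ->]]]].
  have /choice[b bP] : forall i, exists b : bool, p i = x + b%:R *: (y - x).
    move=> i; have [->|->] := pV i; [exists false|exists true].
      by rewrite scale0r addr0.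
    by rewrite scale1r addrC subrK.
  exists ((\sum_i l i * (b i)%:R) *: (y - x)).
    exists (\sum_i l i * (b i)%:R) => //=; apply/andP; split.
      by rewrite sumr_ge0// => i _; rewrite mulr_ge0.
    rewrite -[leRHS]l1; apply: ler_sum => i _; rewrite ler_piMr//.
    by case: (b i).
  rewrite [RHS](eq_bigr (fun i => l i *: x + (l i * (b i)%:R) *: (y - x))).
    by rewrite big_split /= -!scaler_suml l1 scale1r.
  by move=> i _; rewrite bP scalerDr scalerA.
move=> _ [_ [t /andP[t0 t1] <-] <-].
exists 2, (fun i => if i == 0 then x else y), (fun i => if i == 0 then 1 - t else t).
split.
- by move=> i; case: ifP => _; [left|right].
- by move=> i; case: ifP => _ //; rewrite subr_ge0.
- by rewrite sum_ord2 /= subrK.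
- by rewrite big_ord_recl big_ord1 /= scalerBl scale1r scalerBr addrAC addrA.
Qed.

Lemma edge_bodyE i j a : argmax a = [set i; j]%SET -> cb_face P0 a = edge_body i j.
Proof.
move=> aij; apply: cb_inj; rewrite [LHS]/= max_face_vertices aij.
rewrite (_ : [set v l | l in _] = [set v i; v j]); last first.
  apply/seteqP; split=> [_ [l /= + <-]|_ [->|->]].
  - by rewrite finset.in_set2 => /orP[] /eqP ->; [left|right].
  - by exists i => //=; rewrite finset.set21.
  - by exists j => //=; rewrite finset.set22.
exact: conv_hull_pair.
Qed.

Lemma addsegs_mem K s' x : cb_set K x -> cb_set (cb_addsegs K s') x.
Proof.
move=> Kx; elim: s' => [//|w s' IH]; exists x => //; exists 0; rewrite ?addr0//.
by exists 0; rewrite ?scale0r//= lexx ler01.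
Qed.

Lemma addsegs_mem_add K s' x w : cb_set K x -> w \in s' ->
  cb_set (cb_addsegs K s') (x + w).
Proof.
move=> Kx; elim: s' => [//|w' s' IH]; rewrite inE => /orP[/eqP ->|ws].
  exists x; first exact: addsegs_mem.
  by exists w' => //; exists 1; rewrite ?scale1r//= lexx ler01.
exists (x + w); first exact: IH.
by exists 0; rewrite ?addr0//; exists 0; rewrite ?scale0r//= lexx ler01.
Qed.

Lemma addsegs_sub K s' y : cb_set (cb_addsegs K s') y ->
  exists2 x, cb_set K x & y - x \in << s'>>%VS.
Proof.
elim: s' y => [|w s' IH] y; first by exists y => //; rewrite subrr mem0v.
move=> [z /IH[x Kx zx] [_ [t _ <-] <-]]; exists x => //.
rewrite addrAC span_cons addrC memv_add//.
by rewrite memvZ// memv_line.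
Qed.

Lemma span_scale t : t != 0 -> << scale_seq t s>>%VS = << s>>%VS.
Proof.
move=> t0; apply/eqP; rewrite eqEsubv; apply/andP; split; apply/span_subvP.
  by move=> _ /seq.mapP[w ws ->]; rewrite memvZ// memv_span.
move=> w ws; rewrite -[w](scalerK t0) memvZ// memv_span//.
exact: map_f.
Qed.

Lemma edge_direction i j t : i != j -> 0 < t ->
  direction (cb_addsegs (edge_body i j) (scale_seq t s)) = <<v j - v i :: s>>%VS.
Proof.
move=> ij t0; set w := v j - v i.
have E : <<w :: scale_seq t s>>%VS = <<w :: s>>%VS.
  by rewrite !span_cons span_scale// gt_eqF.
have e0 : cb_set (edge_body i j) (v i).
  by exists 0; rewrite ?addr0//; exists 0; rewrite ?scale0r//= lexx ler01.
have e1 : cb_set (edge_body i j) (v i + w).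
  by exists w => //; exists 1; rewrite ?scale1r//= lexx ler01.
rewrite -E; apply: (direction_eq (x := v i)); first exact: addsegs_mem.
  move=> u; rewrite inE => /orP[/eqP ->|us]; first exact: addsegs_mem.
  exact: addsegs_mem_add.
move=> y /addsegs_sub[_ [_ [c _ <-] <-] yx].
rewrite span_cons; have -> : y - v i = c *: w + (y - (v i + c *: w)).
  by apply/rowP => l; rewrite !mxE; ring.
by rewrite memv_add// memvZ// memv_line.
Qed.

Lemma dim_edge_direction i j : i != j -> \dim <<v j - v i :: s>> = d.+1.
Proof. by move=> /free2/eqnP ->; rewrite /= sized. Qed.

Definition frame_of E : 'M[R]_(2, n) := xget 0 [set B | plane_frame E B /\
  forall A : set 'rV[R]_n, volume E A = area [set x *m B^T | x in A]].

Lemma frame_ofP E : \dim E = 2 -> plane_frame E (frame_of E) /\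
  forall A : set 'rV[R]_n, volume E A = area [set x *m (frame_of E)^T | x in A].
Proof.
move=> /plane_frame_volume ex.
exact: (xgetPex (0 : 'M[R]_(2, n)) ex).
Qed.

Definition edge_cone i j : set 'rV[R]_2 := [set y |
  forall l, dot (y *m frame_of (orthv <<v j - v i :: s>>)) (v l) <=
            dot (y *m frame_of (orthv <<v j - v i :: s>>)) (v i)].

Definition edge_angle i j : R :=
  area (@unit_disk R `&` edge_cone i j) / area (@unit_disk R).

Lemma edge_dim_orthv i j : i != j -> \dim (orthv <<v j - v i :: s>>) = 2.
Proof.
by move=> ij; have := dim_orthv <<v j - v i :: s>>; rewrite dim_edge_direction//; lia.
Qed.

(** Vectors orthogonal to [s] are constant on the sum of the segments, so within the complement the
    normal cone is that of the edge in P0: the angle does not depend on t. *)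
Lemma edge_external_angle i j t : i != j -> is_edge i j -> 0 < t ->
  external_angle (cb_addsegs (edge_body i j) (scale_seq t s))
    (cb_addsegs P0 (scale_seq t s)) = edge_angle i j.
Proof.
move=> ij [a as0 aij] t0; have dE := edge_dim_orthv ij.
have [Bf Bv] := frame_ofP dE.
set F := cb_addsegs (edge_body i j) _; set P := cb_addsegs P0 _.
have ncP x : x \in orthv <<v j - v i :: s>>%VS ->
    normal_cone P F x <-> forall l, dot x (v l) <= dot x (v i).
  move=> /mem_orthv xE.
  have xs w : w \in << scale_seq t s>>%VS -> dot x w = 0.
    rewrite span_scale ?gt_eqF// => ws; apply: xE.
    by rewrite span_cons -[w]add0r memv_add// mem0v.
  split=> [xn l|xl y z Fy Pz].
    apply: xn; last exact/addsegs_mem/vertex_mem.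
    by apply: addsegs_mem; exists 0; rewrite ?addr0//; exists 0; rewrite ?scale0r//= lexx ler01.
  have [y0 [_ [c _ <-] y0E] yy0] := addsegs_sub Fy.
  have [z0 Pz0 zz0] := addsegs_sub Pz.
  have -> : dot x y = dot x (v i).
    rewrite -[y](subrK y0) dotDr xs// add0r -y0E dotDr dotZr.
    by rewrite [X in _ * X]xE ?mulr0 ?addr0// memv_span// mem_head.
  rewrite -[z](subrK z0) dotDr xs// add0r.
  move: Pz0; rewrite P0E => /conv_hull_dot_le; apply.
  by move=> _ [l _ <-].
have dF : direction F = <<v j - v i :: s>>%VS := edge_direction ij t0.
rewrite (@external_angle_area _ _ F P (frame_of (orthv <<v j - v i :: s>>))) ?dF//.
  congr (area (_ `&` _) / _); apply/seteqP; split=> y /=.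
    by move=> /ncP; apply; have [_ + _] := Bf; exact.
  by move=> h; apply/ncP => //; have [_ + _] := Bf; exact.
have aE : a \in orthv <<v j - v i :: s>>%VS.
  apply/mem_orthv => u uX; apply/eqP; rewrite dotC -memv_orthv_line.
  move: u uX; apply/subvP/span_subvP => u; rewrite inE => /orP[/eqP ->|us].
    rewrite memv_orthv_line dotBl subr_eq0 -!(dotC a) eq_le.
    have /argmaxP ai : i \in argmax a by rewrite aij finset.set21.
    have /argmaxP aj : j \in argmax a by rewrite aij finset.set22.
    by rewrite ai aj.
  by rewrite memv_orthv_line dotC as0.
have /argmaxP ai : i \in argmax a by rewrite aij finset.set21.
(* A nonzero vector of the cone is needed. If [a = 0], every point attains the maximum, so [v i] and
   [v j] are the only ones and every vector of the complement is in the cone. *)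
have [a0|a0] := eqVneq a 0; last by exists a; split=> //; apply/ncP.
exists (vpick (orthv <<v j - v i :: s>>)); rewrite memv_pick vpick0 -dimv_eq0 dE.
split=> //; apply/ncP => [|l]; first exact: memv_pick.
have : l \in argmax a by apply/argmaxP => l'; rewrite a0 !dot0l.
rewrite aij finset.in_set2 => /orP[] /eqP -> //.
rewrite -subr_ge0 -dotBr.
have /mem_orthv -> // := memv_pick (orthv <<v j - v i :: s>>).
rewrite -opprB memvN memv_span// mem_head//.
Qed.

Lemma vertex_max_face a i : i \in argmax a -> max_face P0 a (v i).
Proof.
move=> /argmaxP ai; split; first exact: vertex_mem.
by move=> y; rewrite P0E => /conv_hull_dot_le; apply=> _ [l _ <-].
Qed.

Lemma argmax_nonempty a : exists i, i \in argmax a.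
Proof.
have [[x [Px xm]] _] := max_face_is_face P0 a.
apply: contrapT => /forallNP no.
have : max_face P0 a x by [].
rewrite max_face_vertices => -[k [p [l [pV _ l1 _]]]].
case: k p l pV l1 => [|k] p l pV l1.
  by move/eqP: l1; rewrite big_ord0 eq_sym oner_eq0.
by have [i /= ia _] := pV ord0; apply: no i ia.
Qed.

(** Dimension count for the faces that contain every segment fully: one vertex gives at most d
    dimensions, three give at least d + 2. *)
Lemma main_face a t : 0 < t ->
  \dim (direction (cb_addsegs (cb_face P0 a) (scale_seq t s))) = d.+1 ->
  exists i j : 'I_r, (i < j)%N /\ argmax a = [set i; j]%SET.
Proof.
move=> t0 dF; set F := cb_addsegs _ _ in dF.
have dF0 : (0 < \dim (direction F))%N by rewrite dF.
have [i ia] := argmax_nonempty a.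
have Fv l : l \in argmax a -> cb_set F (v l).
  by move=> la; apply/addsegs_mem/vertex_max_face.
have vF l : l \in argmax a -> v l - v i \in direction F.
  by move=> la; apply: mem_direction => //; exact: Fv.
have sF : (<< s>> <= direction F)%VS.
  rewrite -(@span_scale t) ?gt_eqF//; apply/span_subvP => w ws.
  have -> : w = (v i + w) - v i by rewrite addrC addKr.
  apply: mem_direction => //; last exact: Fv.
  by apply: addsegs_mem_add ws; exact: vertex_max_face.
have [[j ja ij]|/forall2NP noj] := pselect (exists2 j, j \in argmax a & i != j); last first.
  have : (direction F <= << s>>)%VS.
    apply: (direction_sub (x := v i)) => // y /addsegs_sub[x].
    rewrite /= max_face_vertices => -[k [p [l [pV _ l1 ->]]]].
    have pv q : p q = v i.
      have [i' /= i'a <-] := pV q; congr v; apply/esym/eqP.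
      by have [] := noj i' => // /negP; rewrite negbK.
    rewrite (eq_bigr (fun q => l q *: v i)) => [|q _]; last by rewrite pv.
    by rewrite -scaler_suml l1 scale1r span_scale ?gt_eqF.
  move=> /dimvS; rewrite dF => h; have := leq_trans h (dim_span _).
  by rewrite sized ltnn.
have aij : argmax a = [set i; j]%SET.
  apply/setP => l; rewrite finset.in_set2; apply/idP/idP; last first.
    by move=> /orP[] /eqP ->.
  move=> la; apply: contraT; rewrite negb_or => /andP[li lj].
  have fr : free [:: v j - v i, v l - v i & s] by apply: free3 => //; rewrite eq_sym.
  have : (<<[:: v j - v i, v l - v i & s]>> <= direction F)%VS.
    apply/span_subvP => w; rewrite !inE => /or3P[/eqP ->|/eqP ->|ws]; [exact: vF|exact: vF|].
    by apply: (subvP sF); rewrite memv_span.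
  by move=> /dimvS; rewrite (eqnP fr) /= sized dF ltnn.
have [lt|gt|eq] := ltngtP i j; first by exists i, j.
- by exists j, i; split=> //; rewrite aij finset.setUC.
- by move: ij; rewrite (val_inj eq) eqxx.
Qed.

(** A face of P0 is determined by the set of points where its normal is maximal, which provides a
    finite index. Sets not of this form get the junk value [P0], harmless in an upper bound. *)
Definition face_of (A : {set 'I_r}) : convexBody R n :=
  if pselect (exists a, argmax a = A) is left e then cb_face P0 (sval (cid e)) else P0.

Lemma face_ofE a : face_of (argmax a) = cb_face P0 a.
Proof.
rewrite /face_of; case: pselect => [e|[]]; last by exists a.
case: (cid e) => a' /= aa'.
by apply: cb_inj; rewrite /= !max_face_vertices aa'.
Qed.

Definition edges : pred ('I_r * 'I_r) := fun p => (p.1 < p.2)%N && `[< is_edge p.1 p.2 >].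

(** An overcount: the pairs need not come from any normal, but they range over a finite type
    independent of t, and each has a collapsed segment. *)
Definition other_faces : pred ({set 'I_r} * (size s).-tuple 'I_3) :=
  fun p => has (fun c => c != 0) p.2.

Lemma edges_neq p : edges p -> p.1 != p.2.
Proof. by move=> /andP[h _]; rewrite -val_eqE neq_ltn h. Qed.

Lemma edge_is_face i j t : i != j -> is_edge i j -> 0 < t ->
  faces d.+1 (cb_addsegs P0 (scale_seq t s))
    (cb_addsegs (edge_body i j) (scale_seq t s)).
Proof.
move=> ij [a as0 aij] t0; split; last by rewrite edge_direction// dim_edge_direction.
suff -> : cb_addsegs (edge_body i j) (scale_seq t s) =
    max_face (cb_addsegs P0 (scale_seq t s)) a :> set _ by exact: max_face_is_face.
rewrite max_face_addsegs (edge_bodyE aij).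
have {as0} : forall w, w \in scale_seq t s -> dot a w = 0.
  by move=> _ /seq.mapP[w ws ->]; rewrite dotZr as0// mulr0.
elim: (scale_seq t s) => //= w s' IH as0.
rewrite as0 ?mem_head// eqxx /= IH// => u us; apply: as0.
by rewrite inE us orbT.
Qed.

(** A normal that exposes the edge {i, j} is constant, at its maximum over P0, on the edge plus the
    segments; so [v i] and [v j] are the only points [v l] in that body. *)
Lemma edge_body_inj t : 0 < t ->
  {in edges &, injective (fun p => cb_set (cb_addsegs (edge_body p.1 p.2) (scale_seq t s)))}.
Proof.
move=> t0 [i j] [i' j'] /andP[/= ij /asboolP[a as0 aij]] /andP[/= i'j' /asboolP[a' _ a'ij']] E.
have H l : cb_set (cb_addsegs (edge_body i j) (scale_seq t s)) (v l) -> l \in [set i; j]%SET.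
  move=> /addsegs_sub[x [_ [c _ <-] <-] yx]; rewrite -aij; apply/argmaxP => l'.
  have /argmaxP ai : i \in argmax a by rewrite aij finset.set21.
  have /argmaxP aj : j \in argmax a by rewrite aij finset.set22.
  have e : dot a (v i) = dot a (v j) by apply/eqP; rewrite eq_le ai aj.
  suff -> : dot a (v l) = dot a (v i) by exact: ai.
  have : dot (v l - (v i + c *: (v j - v i))) a = 0.
    apply/eqP; rewrite -memv_orthv_line; move: yx; apply/subvP.
    rewrite span_scale ?gt_eqF//; apply/span_subvP => w ws.
    by rewrite memv_orthv_line dotC as0.
  by rewrite dotC !dotD e subrr mulr0 addr0 => /eqP; rewrite subr_eq0 => /eqP ->.
have Hi' : i' \in [set i; j]%SET.
  apply: H; rewrite E; apply: addsegs_mem; exists 0; rewrite ?addr0//.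
  by exists 0; rewrite ?scale0r//= lexx ler01.
have Hj' : j' \in [set i; j]%SET.
  apply: H; rewrite E; apply: addsegs_mem; exists (v j' - v i'); last by rewrite addrC subrK.
  by exists 1; rewrite ?scale1r//= lexx ler01.
move: Hi' Hj'; rewrite !finset.in_set2 => /orP[] /eqP ei /orP[] /eqP ej; subst i' j' => //.
- by move: i'j'; rewrite ltnn.
- by move: ij; rewrite ltnNge (ltnW i'j').
- by move: i'j'; rewrite ltnn.
Qed.

(** External angles lie in [0, 1], so the faces with a collapsed segment can be estimated by |m|
    alone. *)
Lemma real_angular_edges t : 0 < t ->
  `| m (cb_addsegs P0 (scale_seq t s)) - \sum_(p | edges p) edge_angle p.1 p.2 *
       m (cb_addsegs (edge_body p.1 p.2) (scale_seq t s)) |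
  <= \sum_(p | other_faces p) `|m (cb_code (face_of p.1) (scale_seq t s) p.2)|.
Proof.
move=> t0; set P := cb_addsegs P0 _.
have P0p : is_polytope P0.
  by exists (range v) => //; apply: finite_image; exact: finite_finset.
have Pp : is_polytope P by exact: polytope_addsegs.
pose h p : set 'rV[R]_n := cb_set (cb_addsegs (edge_body p.1 p.2) (scale_seq t s)).
pose Fm := [set h p | p in [set` edges]].
have FmF : Fm `<=` faces d.+1 P.
  move=> _ [p /= pe <-]; have pn := edges_neq pe.
  by move: pe => /andP[_ /asboolP pe]; exact: edge_is_face.
have face_poly K : is_face P (cb_set K) -> is_polytope K.
  move=> /is_faceP[a _ KE]; have -> : K = cb_face P a by exact: cb_inj.
  exact: polytope_face.
have gm K : faces d.+1 P (cb_set K) -> g K = m K.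
  by move=> [Kf dK]; apply/esym/(angular_face nd ang) => //; exact: face_poly.
have fin : finite_set (faces d.+1 P) by exact: finite_faces.
rewrite (ang Pp) (fsbigID Fm); last by apply: sub_finite_set fin => F [].
rewrite (_ : faces d.+1 P `&` Fm = Fm); last first.
  by rewrite setIidr.
rewrite (_ : \sum_(F \in Fm) _ = \sum_(p | edges p) edge_angle p.1 p.2 *
       m (cb_addsegs (edge_body p.1 p.2) (scale_seq t s))); last first.
  rewrite (fsbig_image [set` edges] h); last first.
    by move=> p q; rewrite !inE; exact: edge_body_inj.
  rewrite -(@bigfs _ _ _ _ (index_enum _)) ?index_enum_uniq//; last first.
    by move=> p _; rewrite mem_index_enum.
  apply: eq_bigr => p pe; have pn := edges_neq pe.
  have pe' : is_edge p.1 p.2 by move: pe => /andP[_ /asboolP].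
  rewrite gm; last exact: edge_is_face.
  by rewrite mulrC edge_external_angle.
rewrite addrAC subrr add0r.
pose hc (p : {set 'I_r} * (size s).-tuple 'I_3) : set 'rV[R]_n :=
  cb_set (cb_code (face_of p.1) (scale_seq t s) p.2).
apply: (@fsum_le_index _ _ _ _ hc) => //.
  by apply: sub_finite_set fin => F [].
move=> F [FF nFm].
have [/is_faceP[a _ FE] dF] := FF.
have cs : size (code_of a (scale_seq t s)) == size s by rewrite !size_map.
have hE : hc (argmax a, Tuple cs) = F by rewrite FE max_face_addsegs /hc /= face_ofE.
exists (argmax a, Tuple cs); split=> //.
(* If no segment is collapsed, F is [cb_face P0 a] plus all segments, hence an edge face by
   [main_face] and a member of [Fm]. *)
- rewrite /other_faces /=; apply: contraPT nFm => /hasPn nc.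
  have F0 : F = cb_set (cb_addsegs (cb_face P0 a) (scale_seq t s)).
    rewrite FE max_face_addsegs.
    move: nc; rewrite /code_of; elim: (scale_seq t s) => //= w s' IH nc.
    have := nc _ (mem_head _ _); case: eqVneq => // _ _ /=.
    by rewrite IH// => c cs'; apply: nc; rewrite inE cs' orbT.
  have [i [j [ij aij]]] : exists i j : 'I_r, (i < j)%N /\ argmax a = [set i; j]%SET.
    by apply: (main_face t0); rewrite -F0.
  apply; exists (i, j).
    suff : edges (i, j) by [].
    apply/andP; split=> //; apply/asboolP; exists a => // w ws.
    have := nc; rewrite /code_of => nc'.
    have ws' : t *: w \in scale_seq t s by exact: map_f.
    have := nc' _ (map_f (fun w => if dot a w == 0 then 0 else if dot a w < 0 then 1 else 2) ws').
    have [|_] := eqVneq (dot a (t *: w)) 0; last by case: ifP.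
    by rewrite dotZr => /eqP; rewrite mulf_eq0 gt_eqF//= => /eqP.
  by rewrite /h /= F0 (edge_bodyE aij).
- have dE : \dim (orthv (direction F)) = 2 := dim_orthv_direction nd dF.
  have /andP[e0 e1] := external_angle_bound P dE.
  rewrite normrM (ger0_norm e0) /=.
  have -> : g F = m (cb_code (face_of (argmax a)) (scale_seq t s) (code_of a (scale_seq t s))).
    by rewrite -gm /=; [congr g; rewrite -hE|move: FF; rewrite -{1}hE].
  by rewrite ler_piMr.
Qed.

Lemma val_deltas_edges :
  val_deltas m s P0 = \sum_(p | edges p) edge_angle p.1 p.2 *
       val_deltas m s (edge_body p.1 p.2).
Proof.
have oo_filter : Filter (\oo : set_system nat) by exact _.
pose u (i : nat) := m (cb_addsegs P0 (scale_seq i%:R s)) / i%:R ^+ size s.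
pose e p (i : nat) := m (cb_addsegs (edge_body p.1 p.2) (scale_seq i%:R s)) / i%:R ^+ size s.
pose o (p : {set 'I_r} * (size s).-tuple 'I_3) (i : nat) :=
  `|m (cb_code (face_of p.1) (scale_seq i%:R s) p.2)| / i%:R ^+ size s.
have ucv : u i @[i --> \oo] --> val_deltas m s P0 by exact: addsegs_cvg.
have ecv : (\sum_(p | edges p) edge_angle p.1 p.2 * e p i) @[i --> \oo] -->
    \sum_(p | edges p) edge_angle p.1 p.2 * val_deltas m s (edge_body p.1 p.2).
  apply: (@cvg_big) => //; first exact: add_continuous.
  by move=> p _; apply: cvgMr; exact: addsegs_cvg.
have ocv : (\sum_(p | other_faces p) o p i) @[i --> \oo] --> 0.
  suff : (\sum_(p | other_faces p) o p i) @[i --> \oo] --> \sum_(p | other_faces p) (0 : R).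
    by rewrite [X in _ --> X]big1.
  apply: (@cvg_big) => //; first exact: add_continuous.
  move=> [A c] /hasP[c0 /= cc0 c00].
  have cs : size (tval c) = size s by rewrite size_tuple.
  have [s' [_ h1 h2]] := cb_code_translate (face_of A) mv cs.
  have ss' : (size s' < size s)%N by apply: h1; exists c0.
  have := cvg_norm (addsegs_cvg0 (face_of A) mv ss').
  move=> /(_ oo_filter); rewrite normr0; apply: cvg_trans; apply: near_eq_cvg; apply: nearW => i.
  by rewrite /o /= h2 normrM [X in _ * X = _]ger0_norm// invr_ge0 exprn_ge0.
apply/eqP; rewrite -subr_eq0; apply/eqP.
have dcv := cvgB ucv ecv; have {}dcv := dcv oo_filter.
apply: (cvg_unique _ dcv); first exact: norm_hausdorff.
apply/norm_cvg0P; apply: (squeeze_cvgr _ (cvg_cst 0) ocv).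
near=> i; have i0 : (0 : R) < i%:R.
  by rewrite ltr0n; near: i; exact: nbhs_infty_gt.
rewrite normr_ge0 /= !fctE -mulr_suml.
rewrite (eq_bigr (fun p => (edge_angle p.1 p.2 *
   m (cb_addsegs (edge_body p.1 p.2) (scale_seq i%:R s))) / i%:R ^+ size s)); last first.
  by move=> p _; rewrite /e mulrA.
rewrite -mulr_suml -mulrBl normrM [X in _ * X](ger0_norm) ?invr_ge0 ?exprn_ge0//.
by rewrite ler_pM2r ?invr_gt0 ?exprn_gt0// real_angular_edges.
Unshelve. all: by end_near. Qed.

End EdgeSums.

(** * Thin pyramids *)

Section SegmentValues.
Variables (R : realType) (n : nat).
Variables (nu : convexBody R n -> R).
Hypothesis nuv : real_val nu.
Implicit Types (x y w : 'rV[R]_n) (t : R).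

Lemma seg_opp w : nu (cb_seg (- w)) = nu (cb_seg w).
Proof.
have [_ _ nt] := nuv; apply: (nt _ _ (- w)); apply/seteqP; split.
  move=> _ [t /andP[t0 t1] <-]; exists ((1 - t) *: w).
    by exists (1 - t) => //=; apply/andP; split; lra.
  by apply/rowP => i; rewrite !mxE; ring.
move=> _ [_ [t /andP[t0 t1] <-] <-]; exists (1 - t).
  by apply/andP; split; lra.
by apply/rowP => i; rewrite !mxE; ring.
Qed.

Lemma hausdorff_seg w w' : hausdorff_dist (cb_seg w) (cb_seg w') <= enorm (w - w').
Proof.
apply: hausdorff_dist_le; split; first exact: enorm_ge0.
  move=> _ [t /andP[t0 t1] <-]; exists (t *: w'); first by exists t; rewrite //= t0.
  by rewrite -scalerBr enormZ ger0_norm// ler_piMl// enorm_ge0.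
move=> _ [t /andP[t0 t1] <-]; exists (t *: w); first by exists t; rewrite //= t0.
by rewrite -scalerBr enormZ ger0_norm// ler_piMl// enorm_ge0.
Qed.

Lemma seg_cvg (T : Type) (F : set_system T) {FF : Filter F} w z (t : T -> R) :
  t i @[i --> F] --> 0 -> nu (cb_seg (w + t i *: z)) @[i --> F] --> nu (cb_seg w).
Proof.
move=> t0; have [_ nc _] := nuv; apply/cvgrPdist_lt => e e0.
have [dl d0 dP] := nc (cb_seg w) e e0.
have e1 : 0 < dl / (enorm z + 1) by rewrite divr_gt0// ltr_pwDr// enorm_ge0.
have /cvgrPdist_lt/(_ _ e1) := t0; apply: filterS => i.
rewrite sub0r normrN => ti; apply: dP; apply: le_lt_trans (hausdorff_seg _ _) _.
rewrite opprD addrA subrr sub0r enormN enormZ.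
move: ti; rewrite ltr_pdivlMr; last by rewrite ltr_pwDr// enorm_ge0.
by apply: le_lt_trans; rewrite ler_wpM2l// lerDl.
Qed.

Hypothesis nu_scale : forall K (j : nat), (0 < j)%N -> nu (cb_scale j%:R K) = j%:R * nu K.

Lemma nu_point x : nu (cb_point x) = 0.
Proof.
have [_ _ nt] := nuv; have := nu_scale (cb_point x) (ltn0Sn 1).
rewrite (nt (cb_point x) _ x); first by move=> h; lra.
apply/seteqP; split=> [_ [_ -> <-]|_ [_ -> <-]].
  by exists x; rewrite // scaler_nat mulr2n.
by exists x => //; rewrite scaler_nat mulr2n.
Qed.

(** On j-fold segments the value is j times a constant plus j^2 [dd], where [dd] is the mixed
    difference at a point; homogeneity at j = 2 forces [dd = 0]. *)
Lemma nu_seg_add w w' : nu (cb_add (cb_seg w) (cb_seg w')) = nu (cb_seg w) + nu (cb_seg w').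
Proof.
pose p0 := cb_point (0 : 'rV[R]_n).
have segE z : cb_add p0 (cb_seg z) = cb_seg z.
  apply: cb_inj; apply/seteqP; split=> [_ [_ -> [a Sa <-]]|a Sa]; first by rewrite add0r.
  by exists 0 => //; exists a; rewrite ?add0r.
have nu0 : nu p0 = 0 := nu_point 0.
have dv := val_delta_real_val (cb_seg w') nuv.
pose dw := val_delta (cb_seg w) nu p0; pose dw' := val_delta (cb_seg w') nu p0.
pose dd := val_delta (cb_seg w) (val_delta (cb_seg w') nu) p0.
have F (j : nat) : nu (cb_add (cb_seg (j%:R *: w)) (cb_seg (j%:R *: w'))) =
    j%:R * dw + j%:R * (dw' + j%:R * dd).
  rewrite -[cb_seg (j%:R *: w)]segE cb_add_seg_nat// cb_add_seg_nat// nu0 add0r.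
  by congr (_ + _ * _); rewrite (cb_add_seg_nat _ _ _ dv).
have F1 := F 1; have F2 := F 2.
have := nu_scale (cb_add (cb_seg w) (cb_seg w')) (ltn0Sn 1).
rewrite (_ : cb_scale _ _ = cb_add (cb_seg (2%:R *: w)) (cb_seg (2%:R *: w'))); last first.
  apply: cb_inj; apply/seteqP; split.
    move=> _ [_ [_ [t t01 <-] [_ [t' t01' <-] <-]] <-].
    exists (t *: (2%:R *: w)); first by exists t.
    exists (t' *: (2%:R *: w')); first by exists t'.
    by apply/rowP => i; rewrite !mxE; ring.
  move=> _ [_ [t t01 <-] [_ [t' t01' <-] <-]].
  exists (t *: w + t' *: w').
    by exists (t *: w); [exists t|exists (t' *: w') => //; exists t'].
  by apply/rowP => i; rewrite !mxE; ring.
rewrite F2; move: F1; rewrite !scale1r => ->.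
have -> : nu (cb_seg w) = dw by rewrite /dw /val_delta segE nu0 subr0.
have -> : nu (cb_seg w') = dw' by rewrite /dw' /val_delta segE nu0 subr0.
by lra.
Qed.

End SegmentValues.

(** * Areas of thin sectors *)

Section ThinSectors.
Variables (R : realType) (n : nat).
Implicit Types (x y u p q : 'rV[R]_n).

Definition sector_area (B : 'M[R]_(2, n)) p q : R :=
  area (sector (p *m B^T) (q *m B^T) `&` @unit_disk R).

Lemma dot_frame (E : {vspace 'rV[R]_n}) (B : 'M[R]_(2, n)) p q : plane_frame E B ->
  p \in E -> dot (p *m B^T) (q *m B^T) = dot p q.
Proof.
move=> [B1 Bm Bs] pE; have -> : dot (p *m B^T) (q *m B^T) = dot (p *m B^T *m B) q.
  by rewrite /dot trmx_mul trmxK mulmxA.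
by rewrite Bs.
Qed.

(** Both rays have product -1 with u, so the segment joining them stays at distance at least 1 from
    0 and, by convexity, at most sqrt H. [D] is their Gram determinant, the square of [det2]. *)
Lemma sector_area_bounds (E : {vspace 'rV[R]_n}) (B : 'M[R]_(2, n)) p q u (H D : R) :
  plane_frame E B -> p \in E -> q \in E -> dot u u = 1 ->
  dot p u = -1 -> dot q u = -1 -> dot p p <= H -> dot q q <= H ->
  D = dot p p * dot q q - dot p q ^+ 2 -> 0 < D ->
  Num.sqrt D * area (@triangle R) / H <= sector_area B p q <=
  Num.sqrt D * area (@triangle R).
Proof.
move=> Bf pE qE u1 pu qu pH qH DE D0.
have H0 : 0 < H.
  apply: lt_le_trans pH; apply: dot_gt0; apply: contra_eq_neq pu => ->.
  by rewrite dot0l eq_sym oppr_eq0 oner_eq0.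
have dD : `|det2 (p *m B^T) (q *m B^T)| = Num.sqrt D.
  by rewrite -sqrtr_sqr sqr_det2 !(dot_frame _ Bf)// DE.
have d0 : det2 (p *m B^T) (q *m B^T) != 0.
  by rewrite -normr_eq0 dD gt_eqF// sqrtr_gt0.
have lin s t : s *: (p *m B^T) + t *: (q *m B^T) = (s *: p + t *: q) *m B^T.
  by rewrite mulmxDl -!scalemxAl.
have mE s t : s *: p + t *: q \in E by rewrite memvD// memvZ.
apply/andP; split.
  have sH : H = Num.sqrt H ^+ 2 by rewrite sqr_sqrtr// ltW.
  rewrite -dD {1}sH; apply: sector_area_ge => //; first by rewrite sqrtr_gt0.
  move=> s t s0 t0 st; rewrite lin (dot_frame _ Bf)// -sH.
  have h : dot (s *: p + t *: q) (s *: p + t *: q) <= s * dot p p + t * dot q q.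
    have -> : s * dot p p + t * dot q q = dot (s *: p + t *: q) (s *: p + t *: q)
       + s * t * dot (p - q) (p - q).
      have -> : t = 1 - s by lra.
      by rewrite !dotD [dot q p]dotC; ring.
    by rewrite lerDl mulr_ge0 ?mulr_ge0 ?dot_ge0.
  apply: le_trans h _; have -> : t = 1 - s by lra.
  have : s * dot p p <= s * H by rewrite ler_wpM2l.
  have : (1 - s) * dot q q <= (1 - s) * H by rewrite ler_wpM2l//; lra.
  by lra.
rewrite -dD; have := @sector_area_le R (p *m B^T) (q *m B^T) 1 ltr01 d0.
rewrite expr1n divr1; apply=> s t s0 t0 st; rewrite lin (dot_frame _ Bf)//.
have h : dot (s *: p + t *: q) u = -1.
  rewrite (_ : t = 1 - s); last by lra.
  by rewrite !dotD pu qu; ring.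
have := dot_ge0 (s *: p + t *: q + u).
by rewrite dotDl !(dotDr _ _ u) [dot u _]dotC h u1; lra.
Qed.

(** Both rays tend to -u and their Gram determinant is eta^2 [S], with [S] tending to e1^2 + e2^2;
    so the upper and the lower triangle bound agree in the limit after division by eta. *)
Lemma thin_sector_cvg (T : Type) (F : set_system T) {FF : Filter F}
    (x y u : 'rV[R]_n) (e1 e2 : R) (h1 h2 eta : T -> R)
    (E : T -> {vspace 'rV[R]_n}) (B : T -> 'M[R]_(2, n)) :
  dot x x = 1 -> dot y y = 1 -> dot u u = 1 -> dot x y = 0 -> dot x u = 0 ->
  dot y u = 0 -> 0 < e1 ^+ 2 + e2 ^+ 2 ->
  h1 i @[i --> F] --> 0 -> h2 i @[i --> F] --> 0 -> eta i @[i --> F] --> 0 ->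
  (\forall i \near F, 0 < eta i) ->
  (\forall i \near F, [/\ plane_frame (E i) (B i),
     h1 i *: x + h2 i *: y - u \in E i &
     (h1 i + eta i * e1) *: x + (h2 i + eta i * e2) *: y - u \in E i]) ->
  (sector_area (B i) (h1 i *: x + h2 i *: y - u)
     ((h1 i + eta i * e1) *: x + (h2 i + eta i * e2) *: y - u) / eta i) @[i --> F] -->
  Num.sqrt (e1 ^+ 2 + e2 ^+ 2) * area (@triangle R).
Proof.
move=> xx yy uu xy xu yu ee h1c h2c etac eta0 framed.
pose k1 i := h1 i + eta i * e1; pose k2 i := h2 i + eta i * e2.
have k1c : k1 i @[i --> F] --> 0.
  have -> : (0 : R) = 0 + 0 * e1 by ring.
  by apply: cvgD => //; apply: cvgMl.
have k2c : k2 i @[i --> F] --> 0.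
  have -> : (0 : R) = 0 + 0 * e2 by ring.
  by apply: cvgD => //; apply: cvgMl.
pose S i := e1 ^+ 2 + e2 ^+ 2 + (h1 i * e2 - h2 i * e1) ^+ 2.
pose H i := 1 + h1 i ^+ 2 + h2 i ^+ 2 + k1 i ^+ 2 + k2 i ^+ 2.
have sq0 (f : T -> R) : f i @[i --> F] --> 0 -> (f i ^+ 2) @[i --> F] --> 0.
  move=> fc; have -> : (0 : R) = 0 * 0 by ring.
  by apply: cvgM.
have Sc : S i @[i --> F] --> e1 ^+ 2 + e2 ^+ 2.
  rewrite -[X in _ --> X]addr0; apply: cvgD; first exact: cvg_cst.
  apply: sq0; have -> : (0 : R) = 0 * e2 - 0 * e1 by ring.
  by apply: cvgB; apply: cvgMl.
have Hc : H i @[i --> F] --> (1 : R).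
  rewrite -[X in _ --> X]addr0; apply: cvgD; last exact: sq0.
  rewrite -[X in _ --> X]addr0; apply: cvgD; last exact: sq0.
  rewrite -[X in _ --> X]addr0; apply: cvgD; last exact: sq0.
  rewrite -[X in _ --> X]addr0; apply: cvgD; last exact: sq0.
  exact: cvg_cst.
have sSc : Num.sqrt (S i) @[i --> F] --> Num.sqrt (e1 ^+ 2 + e2 ^+ 2).
  exact: (continuous_cvg _ (@sqrt_continuous R _) Sc).
have up : (Num.sqrt (S i) * area (@triangle R)) @[i --> F] -->
    Num.sqrt (e1 ^+ 2 + e2 ^+ 2) * area (@triangle R) by apply: cvgMl.
have lo : (Num.sqrt (S i) * area (@triangle R) / H i) @[i --> F] -->
    Num.sqrt (e1 ^+ 2 + e2 ^+ 2) * area (@triangle R).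
  rewrite -[X in _ --> X]divr1; apply: cvgM => //.
  by apply: cvgV => //; exact: oner_neq0.
apply: squeeze_cvgr lo up.
near=> i.
have e0 : 0 < eta i by near: i.
have [Bf pE qE] : [/\ plane_frame (E i) (B i),
     h1 i *: x + h2 i *: y - u \in E i &
     k1 i *: x + k2 i *: y - u \in E i] by near: i.
have sE : Num.sqrt (eta i ^+ 2 * S i) = eta i * Num.sqrt (S i).
  by rewrite sqrtrM ?sqr_ge0// sqrtr_sqr gtr0_norm.
have S0 : 0 < S i by rewrite /S ltr_pwDl// sqr_ge0.
have D0 : 0 < eta i ^+ 2 * S i by rewrite mulr_gt0// exprn_gt0.
have := @sector_area_bounds (E i) (B i) _ _ u (H i) (eta i ^+ 2 * S i) Bf pE qE uu.
rewrite !dotD xx yy uu xy xu yu !(dotC y x) !(dotC u x) !(dotC u y) xy xu yu.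
move=> /(_ ltac:(ring) ltac:(ring)).
have h1' := sqr_ge0 (h1 i); have h2' := sqr_ge0 (h2 i).
have k1' := sqr_ge0 (k1 i); have k2' := sqr_ge0 (k2 i).
move=> /(_ ltac:(rewrite /H; lra) ltac:(rewrite /H; lra)).
move=> /(_ ltac:(rewrite /S /k1 /k2; ring) D0); rewrite sE.
move=> /andP[b1 b2]; apply/andP; split.
  rewrite ler_pdivlMr// mulrC; apply: le_trans b1.
  by rewrite !mulrA.
by rewrite ler_pdivrMr// [leRHS]mulrC mulrA.
Unshelve. all: by end_near. Qed.

End ThinSectors.

(** * Coordinate regions and the pyramid *)

Section Regions.
Variables (R : realType) (n : nat).
Implicit Types (D : set (R * R * R)) (A B C : 'rV[R]_n) (p q : R * R * R).

(** Bodies in span(A, B, C) are images of regions of coordinate triples, so that inclusions between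
    them become real inequalities. *)
Definition lin3 A B C p : 'rV[R]_n := p.1.1 *: A + p.1.2 *: B + p.2 *: C.

Definition segment_closed3 D := forall p q (t : R), D p -> D q -> 0 <= t <= 1 ->
  D (t * p.1.1 + (1 - t) * q.1.1, t * p.1.2 + (1 - t) * q.1.2, t * p.2 + (1 - t) * q.2).

Lemma coord11_continuous : continuous (fun p : R * R * R => p.1.1).
Proof. by move=> p; apply: (continuous_comp (f := fst) (g := fst)); exact: cvg_fst. Qed.

Lemma coord12_continuous : continuous (fun p : R * R * R => p.1.2).
Proof.
by move=> p; apply: (continuous_comp (f := fst) (g := snd)); [exact: cvg_fst|exact: cvg_snd].
Qed.

Lemma coord2_continuous : continuous (fun p : R * R * R => p.2).
Proof. by move=> p; exact: cvg_snd. Qed.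

Lemma lin3_continuous A B C : continuous (lin3 A B C).
Proof.
move=> p; apply: (@cvgD _ _ _ (nbhs p)).
  apply: (@cvgD _ _ _ (nbhs p)).
    by apply: cvgZr_tmp; exact: coord11_continuous.
  by apply: cvgZr_tmp; exact: coord12_continuous.
by apply: cvgZr_tmp; exact: coord2_continuous.
Qed.

Definition cb_region A B C D (D0 : D !=set0) (Dc : compact D) (Dv : segment_closed3 D) :
  convexBody R n.
Proof.
refine (@ConvexBody R n [set lin3 A B C p | p in D] _ _ _).
- by have [p Dp] := D0; exists (lin3 A B C p); exists p.
- by apply: continuous_compact Dc; apply: continuous_subspaceT; exact: lin3_continuous.
- apply/convex_setP => _ _ t [p Dp <-] [q Dq <-] t01.
  eexists; first exact: (Dv p q t Dp Dq t01).
  by apply/rowP => i; rewrite !mxE /=; ring.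
Defined.

Lemma compact_region D (M : R) : closed D ->
  (forall p, D p -> [/\ `|p.1.1| <= M, `|p.1.2| <= M & `|p.2| <= M]) -> compact D.
Proof.
move=> Dc DM; apply: subclosed_compact Dc _ _.
  apply: (compact_setX (compact_setX (segment_compact (a := - M) (b := M))
    (segment_compact (a := - M) (b := M))) (segment_compact (a := - M) (b := M))).
move=> p /DM[]; rewrite !ler_norml => h1 h2 h3.
by split=> /=; [split=> /=|]; rewrite in_itv.
Qed.

Lemma closed_le3 (f : R * R * R -> R) : continuous f -> closed [set p | 0 <= f p].
Proof.
move=> fc; rewrite (_ : [set p | 0 <= f p] = f @^-1` [set x | 0 <= x])//.
by apply: closed_comp => [p _|]; [exact: fc|exact: closed_ge].
Qed.

Definition pyramid : set (R * R * R) := [set p | `|p.1.1| + `|p.1.2| <= p.2 <= 1].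

Lemma pyramid_nonempty : pyramid !=set0.
Proof. by exists (0, 0, 0); rewrite /pyramid /= !normr0 addr0 lexx ler01. Qed.

Lemma pyramid_compact : compact pyramid.
Proof.
apply: (@compact_region _ 1) => [|p /andP[h1 h2]]; last first.
  have n1 := normr_ge0 p.1.1; have n2 := normr_ge0 p.1.2.
  by split; [lra|lra|rewrite ger0_norm; lra].
rewrite (_ : pyramid = [set p | 0 <= p.2 - (`|p.1.1| + `|p.1.2|)] `&` [set p | 0 <= 1 - p.2]).
  apply: closedI; apply: closed_le3 => p.
    apply: (@cvgB _ _ _ (nbhs p)); first exact: coord2_continuous.
    by apply: (@cvgD _ _ _ (nbhs p)); apply: cvg_norm;
      [exact: coord11_continuous|exact: coord12_continuous].
  by apply: (@cvgB _ _ _ (nbhs p)); [exact: cvg_cst|exact: coord2_continuous].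
apply/seteqP; split=> p; rewrite /pyramid /=; first by move=> /andP[]; split; lra.
by move=> [h1 h2]; apply/andP; split; lra.
Qed.

Lemma pyramid_segment_closed : segment_closed3 pyramid.
Proof.
move=> p q t /andP[p1 p2] /andP[q1 q2] /andP[t0 t1]; rewrite /pyramid /=.
have t1' : 0 <= 1 - t by lra.
have H (a b : R) : `|t * a + (1 - t) * b| <= t * `|a| + (1 - t) * `|b|.
  apply: le_trans (ler_normD _ _) _.
  by rewrite !normrM (ger0_norm t0) (ger0_norm t1').
have := H p.1.1 q.1.1; have := H p.1.2 q.1.2.
have : t * (`|p.1.1| + `|p.1.2|) <= t * p.2 by rewrite ler_wpM2l.
have : (1 - t) * (`|q.1.1| + `|q.1.2|) <= (1 - t) * q.2 by rewrite ler_wpM2l.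
have : t * p.2 <= t by rewrite ler_piMr.
have : (1 - t) * q.2 <= 1 - t by rewrite ler_piMr.
by move=> *; apply/andP; split; lra.
Qed.

Definition cb_pyramid A B C := cb_region A B C pyramid_nonempty pyramid_compact
  pyramid_segment_closed.

(** Vertex 0 is the apex, vertices 1 and 2 are +-A, and vertices 3 and 4 are +-B, the last four
    raised by C. *)
Definition pyr_p (i : 'I_5) : R := [:: 0; 1; -1; 0; 0]`_i.

Definition pyr_q (i : 'I_5) : R := [:: 0; 0; 0; 1; -1]`_i.

Definition pyr_z (i : 'I_5) : R := [:: 0; 1; 1; 1; 1]`_i.

Definition pyr_vertex A B C (i : 'I_5) : 'rV[R]_n :=
  pyr_p i *: A + pyr_q i *: B + pyr_z i *: C.

Lemma ord5P (P : 'I_5 -> Prop) : P (@Ordinal 5 0 isT) -> P (@Ordinal 5 1 isT) ->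
  P (@Ordinal 5 2 isT) -> P (@Ordinal 5 3 isT) -> P (@Ordinal 5 4 isT) -> forall i, P i.
Proof.
move=> h0 h1 h2 h3 h4 [[|[|[|[|[|i]]]]] hi] //;
  by rewrite (bool_irrelevance hi isT).
Qed.

Lemma sum_ord5 (V : zmodType) (f : 'I_5 -> V) : \sum_i f i =
  f (@Ordinal 5 0 isT) + f (@Ordinal 5 1 isT) + f (@Ordinal 5 2 isT) +
  f (@Ordinal 5 3 isT) + f (@Ordinal 5 4 isT).
Proof.
rewrite !big_ord_recl big_ord0 addr0 !addrA.
by congr (_ + f _ + f _ + f _ + f _); [congr f| | | |]; exact: val_inj.
Qed.

Lemma cb_pyramidE A B C : cb_pyramid A B C = conv_hull (range (pyr_vertex A B C)) :> set _.
Proof.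
apply/seteqP; split=> [_ [[[p q] z] /andP[/= h1 h2] <-]|_ [k [c [l [cV l0 l1 ->]]]]].
  (* Half of the slack z - |p| - |q| goes to each of the vertices A + C and -A + C, where the A
     components cancel; the apex takes 1 - z. *)
  pose r := (z - `|p| - `|q|) / 2.
  exists 5, (pyr_vertex A B C), (fun i => [:: 1 - z; Num.max p 0 + r; Num.max (- p) 0 + r;
    Num.max q 0; Num.max (- q) 0]`_i).
  have H (a : R) : Num.max a 0 - Num.max (- a) 0 = a /\ Num.max a 0 + Num.max (- a) 0 = `|a|.
    have [a0|a0] := boolP (0 <= a).
      rewrite max_l// max_r ?ger0_norm//; last by lra.
      by split; lra.
    rewrite -ltNge in a0.
    rewrite max_r ?(ltW a0)// max_l ?ltr0_norm//; last by lra.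
    by split; lra.
  have [hp1 hp2] := H p; have [hq1 hq2] := H q.
  have r0 : 0 <= r by rewrite /r; lra.
  split.
  - by move=> i; exists i.
  - by apply: ord5P => /=; rewrite ?subr_ge0 ?addr_ge0 ?le_max ?lexx ?orbT.
  - by rewrite sum_ord5 /= /r; lra.
  - rewrite sum_ord5 /lin3 /pyr_vertex /=; apply/rowP => i; rewrite !mxE /pyr_p /pyr_q /pyr_z /=.
    move: hp1 hp2 hq1 hq2; set a1 := Num.max p 0; set a2 := Num.max (- p) 0.
    set b1 := Num.max q 0; set b2 := Num.max (- q) 0 => hp1 hp2 hq1 hq2.
    have -> : z = (a1 + r) + (a2 + r) + b1 + b2 by rewrite /r; lra.
    by rewrite -{1}hp1 -{1}hq1; ring.
have /choice[f fP] : forall i, exists j, c i = pyr_vertex A B C j.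
  by move=> i; have [j _ <-] := cV i; exists j.
exists (\sum_i l i * pyr_p (f i), \sum_i l i * pyr_q (f i), \sum_i l i * pyr_z (f i)).
  apply/andP; split=> /=.
    have H (h : 'I_5 -> R) : `|\sum_i l i * h (f i)| <= \sum_i l i * `|h (f i)|.
      apply: le_trans (ler_norm_sum _ _ _) _; apply: ler_sum => i _.
      by rewrite normrM ger0_norm.
    apply: le_trans (lerD (H pyr_p) (H pyr_q)) _; rewrite -big_split /=.
    apply: ler_sum => i _; rewrite -mulrDr ler_wpM2l//.
    move: (f i); apply: ord5P; rewrite /pyr_p /pyr_q /pyr_z /= ?normrN ?normr0 ?normr1; lra.
  rewrite -[leRHS]l1; apply: ler_sum => i _; rewrite ler_piMr//.
  by move: (f i); apply: ord5P; rewrite /pyr_z /=; lra.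
rewrite /lin3 /= !scaler_suml -!big_split /=; apply: eq_bigr => i _.
by rewrite fP /pyr_vertex !scalerDr !scalerA.
Qed.

End Regions.

(** * Normal cones at the edges of the pyramid, in coordinates *)

Section PyramidCones.
Variable R : realType.
Implicit Types (p q P Q Z a b : R) (l : 'I_5).

Definition axis_dir p q := (p = 1 /\ q = 0) \/ (p = -1 /\ q = 0) \/
  (p = 0 /\ q = 1) \/ (p = 0 /\ q = -1).

(** Normals are written by their products with A, B, C. The triples (p + q, q - p, -1) and (p - q, q
    + p, -1) belong to the two lateral faces that meet at the edge from the apex to
    [p A + q B + C]. *)
Lemma lateral_cone_ge p q a b l : axis_dir p q -> 0 <= a -> 0 <= b ->
  pyr_p R l * (a * (p + q) + b * (p - q)) + pyr_q R l * (a * (q - p) + b * (q + p)) -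
  pyr_z R l * (a + b) <= 0.
Proof.
by move=> pq a0 b0; case: pq => [|[|[|]]] [-> ->]; move: l; apply: ord5P;
  rewrite /pyr_p /pyr_q /pyr_z /=; lra.
Qed.

Lemma lateral_cone_le p q P Q Z : axis_dir p q -> p * P + q * Q + Z = 0 ->
  (forall l, pyr_p R l * P + pyr_q R l * Q + pyr_z R l * Z <= 0) ->
  exists a b, [/\ 0 <= a, 0 <= b, P = a * (p + q) + b * (p - q), Q = a * (q - p) + b * (q + p) &
      Z = - (a + b)].
Proof.
move=> pq Z0 cone.
have := cone (@Ordinal 5 1 isT); have := cone (@Ordinal 5 2 isT).
have := cone (@Ordinal 5 3 isT); have := cone (@Ordinal 5 4 isT).
rewrite /pyr_p /pyr_q /pyr_z /= => h4 h3 h2 h1; clear cone.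
(* Solved from a + b = -Z and a - b = q P - p Q. *)
exists ((- Z - p * Q + q * P) / 2), ((- Z + p * Q - q * P) / 2).
by case: pq Z0 => [|[|[|]]] [-> ->] Z0; split; lra.
Qed.

(** At the base edge from [p A + C] to [q B + C], where [p P = q Q], two inequalities cut out the
    cone: the first compares with the opposite base vertices, the second with the apex. *)
Lemma base_cone_ge p q P Q Z l : p = 1 \/ p = -1 -> q = 1 \/ q = -1 -> p * P = q * Q ->
  0 <= p * P -> 0 <= p * P + Z ->
  pyr_p R l * P + pyr_q R l * Q + pyr_z R l * Z <= p * P + 0 * Q + 1 * Z.
Proof.
by move=> [] -> [] -> h1 h2 h3; move: l; apply: ord5P; rewrite /pyr_p /pyr_q /pyr_z /=; lra.
Qed.

Lemma base_cone_le p P Q Z : p = 1 \/ p = -1 ->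
  (forall l, pyr_p R l * P + pyr_q R l * Q + pyr_z R l * Z <= p * P + 0 * Q + 1 * Z) ->
  0 <= p * P /\ 0 <= p * P + Z.
Proof.
move=> p2 cone.
have := cone (@Ordinal 5 0 isT); have := cone (@Ordinal 5 1 isT).
have := cone (@Ordinal 5 2 isT).
rewrite /pyr_p /pyr_q /pyr_z /= => h2 h1 h0; clear cone.
by case: p2 h2 h1 h0 => -> h2 h1 h0; split; lra.
Qed.

Lemma pyr_coords_indep (i j l : 'I_5) (c : R) : i != j -> i != l -> j != l ->
  pyr_p R j - pyr_p R i = c * (pyr_p R l - pyr_p R i) ->
  pyr_q R j - pyr_q R i = c * (pyr_q R l - pyr_q R i) ->
  pyr_z R j - pyr_z R i = c * (pyr_z R l - pyr_z R i) -> False.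
Proof.
move: i j l; apply: ord5P; apply: ord5P => //; apply: ord5P => //;
  rewrite /pyr_p /pyr_q /pyr_z /= => _ _ _ h1 h2 h3; lra.
Qed.

End PyramidCones.

(** * Edges and angles of a tilted pyramid *)

Section Pyramid.
Variables (R : realType) (n d : nat) (s : seq 'rV[R]_n) (x y u : 'rV[R]_n).
Hypothesis nd : n = d.+3.
Hypothesis sized : size s = d.
Hypothesis frees : free s.
Hypotheses (xx : dot x x = 1) (yy : dot y y = 1) (uu : dot u u = 1).
Hypotheses (xy : dot x y = 0) (xu : dot x u = 0) (yu : dot y u = 0).
Hypothesis xs : forall w, w \in s -> dot x w = 0.
Hypothesis ys : forall w, w \in s -> dot y w = 0.
Hypothesis us : forall w, w \in s -> dot u w = 0.
Implicit Types (v w X : 'rV[R]_n) (a b t : R).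

Definition orth_to (s : seq 'rV[R]_n) v := forall w, w \in s -> dot v w = 0.

Lemma orth_to_lin v w a b : orth_to s v -> orth_to s w -> orth_to s (a *: v + b *: w).
Proof. by move=> vs ws z zs; rewrite !dotD vs// ws//; ring. Qed.

Lemma orth_to_span v (s' : seq 'rV[R]_n) : orth_to s' v -> v \in orthv << s'>>%VS.
Proof.
move=> vs; apply/mem_orthv => z zs; apply/eqP; rewrite dotC -memv_orthv_line.
move: z zs; apply/subvP/span_subvP => z zs.
by rewrite memv_orthv_line dotC vs.
Qed.

Lemma span_orth_to v (s' : seq 'rV[R]_n) : v \in orthv << s'>>%VS -> orth_to s' v.
Proof. by move=> /mem_orthv vs w ws; apply: vs; exact: memv_span. Qed.

Lemma notin_span v (s' : seq 'rV[R]_n) : v != 0 -> orth_to s' v -> v \notin << s'>>%VS.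
Proof.
move=> v0 /orth_to_span /mem_orthv vs; apply: contra v0 => /vs /eqP.
by rewrite dot_eq0.
Qed.

Lemma unit_neq0 v : dot v v = 1 -> v != 0.
Proof. by move=> v1; rewrite -dot_eq0 v1 oner_eq0. Qed.

(** x, y, u and s together are n free vectors, so the remainder, orthogonal to all of them, is 0. *)
Lemma expand3 v : orth_to s v -> v = dot v x *: x + dot v y *: y + dot v u *: u.
Proof.
move=> vs; pose z := v - (dot v x *: x + dot v y *: y + dot v u *: u).
have fr : free [:: x, y, u & s].
  rewrite !free_cons frees andbT; apply/and3P; split; apply: notin_span;
    rewrite ?unit_neq0// => w; rewrite ?inE.
  - by move=> /or3P[/eqP ->|/eqP ->|/xs].
  - by move=> /orP[/eqP ->|/ys].
have o0 : orthv <<[:: x, y, u & s]>>%VS = 0%VS.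
  apply/eqP; rewrite -dimv_eq0.
  have := dim_orthv <<[:: x, y, u & s]>>; rewrite (eqnP fr) /= sized; lia.
have : z \in orthv <<[:: x, y, u & s]>>%VS.
  apply: orth_to_span => w; rewrite !inE /z => /or4P[/eqP ->|/eqP ->|/eqP ->|ws].
  - by rewrite !dotD xx (dotC y x) (dotC u x) xy xu; ring.
  - by rewrite !dotD yy (dotC u y) xy yu; ring.
  - by rewrite !dotD uu xu yu; ring.
  - by rewrite !dotD vs// xs// ys// us//; ring.
by rewrite o0 memv0 /z subr_eq0 => /eqP.
Qed.

Variables (alpha beta sigma rho eta : R).
Hypotheses (alpha0 : 0 < alpha) (beta0 : 0 < beta) (eta0 : 0 < eta).

Let A := alpha *: x + sigma *: u.
Let B := beta *: y + rho *: u.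
Let C := eta *: u.
Let vtx := pyr_vertex A B C.

Lemma pyr_orth (p q z : R) : orth_to s (p *: A + q *: B + z *: C).
Proof. by move=> w ws; rewrite !dotD xs// ys// us//; ring. Qed.

Lemma dotA v : dot v A = alpha * dot v x + sigma * dot v u.
Proof. by rewrite !dotD. Qed.

Lemma dotB v : dot v B = beta * dot v y + rho * dot v u.
Proof. by rewrite !dotD. Qed.

Lemma dotC' v : dot v C = eta * dot v u.
Proof. by rewrite !dotD. Qed.

Lemma dot_vtx v i : dot v (vtx i) = pyr_p R i * dot v A + pyr_q R i * dot v B + pyr_z R i * dot v C.
Proof. by rewrite /vtx /pyr_vertex !dotD. Qed.

(** A, B, C form a basis of span(x, y, u), so normals orthogonal to s correspond to arbitrary
    triples of products with them; [dual_inj] is the uniqueness. *)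
Lemma dual_ex (P Q Z : R) : exists X,
  [/\ orth_to s X, dot X A = P, dot X B = Q & dot X C = Z].
Proof.
exists (((P - sigma * Z / eta) / alpha) *: x + ((Q - rho * Z / eta) / beta) *: y + (Z / eta) *: u).
have [e0 a0 b0] : [/\ eta != 0, alpha != 0 & beta != 0] by split; rewrite gt_eqF.
split.
- by move=> w ws; rewrite !dotD xs// ys// us//; ring.
- by rewrite dotA !dotD xx (dotC y x) (dotC u x) xy xu uu yu; field; rewrite ?e0 ?a0 ?b0.
- by rewrite dotB !dotD yy xy xu (dotC u y) uu yu; field; rewrite ?e0 ?a0 ?b0.
- by rewrite dotC' !dotD xu yu uu; field; rewrite ?e0 ?a0 ?b0.
Qed.

Lemma dual_inj X X' : orth_to s X -> orth_to s X' -> dot X A = dot X' A ->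
  dot X B = dot X' B -> dot X C = dot X' C -> X = X'.
Proof.
move=> Xs X's; rewrite !dotA !dotB !dotC'.
have [e0 a0 b0] : [/\ eta != 0, alpha != 0 & beta != 0] by split; rewrite gt_eqF.
move=> hA hB /(mulfI e0) hu; rewrite hu in hA hB.
move: hA hB => /addIr/(mulfI a0) hx /addIr/(mulfI b0) hy.
by rewrite (expand3 Xs) (expand3 X's) hx hy hu.
Qed.

Lemma vtx_coords i j l c : vtx j - vtx i = c *: (vtx l - vtx i) ->
  [/\ pyr_p R j - pyr_p R i = c * (pyr_p R l - pyr_p R i),
      pyr_q R j - pyr_q R i = c * (pyr_q R l - pyr_q R i) &
      pyr_z R j - pyr_z R i = c * (pyr_z R l - pyr_z R i)].
Proof.
move=> E.
have [XA [_ a1 a2 a3]] := dual_ex 1 0 0; have [XB [_ b1 b2 b3]] := dual_ex 0 1 0.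
have [XC [_ c1 c2 c3]] := dual_ex 0 0 1.
have H X := congr1 (dot X) E.
have := H XA; rewrite !(dotBr, dotZr) !dot_vtx a1 a2 a3.
have := H XB; rewrite !(dotBr, dotZr) !dot_vtx b1 b2 b3.
have := H XC; rewrite !(dotBr, dotZr) !dot_vtx c1 c2 c3.
by rewrite !mulr0 !mulr1 !add0r !addr0.
Qed.

Lemma vtx_orth i j : orth_to s (vtx j - vtx i).
Proof.
rewrite -[_ - _]/(vtx j - vtx i) => w ws; rewrite dotBl.
by rewrite (pyr_orth _ _ _ ws) (pyr_orth _ _ _ ws) subrr.
Qed.

Lemma vtx_free2 i j : i != j -> free (vtx j - vtx i :: s).
Proof.
move=> ij; rewrite free_cons frees andbT; apply: notin_span (@vtx_orth i j).
apply: contra_neqN ij => /eqP E; apply/eqP.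
have := @vtx_coords i j i 0; rewrite scale0r => /(_ E).
rewrite !mul0r; clear E; move: i j.
by apply: ord5P; apply: ord5P => //; rewrite /pyr_p /pyr_q /pyr_z /= => -[h1 h2 h3]; exfalso; lra.
Qed.

Lemma vtx_free3 i j l : i != j -> i != l -> j != l ->
  free [:: vtx j - vtx i, vtx l - vtx i & s].
Proof.
move=> ij il jl; rewrite free_cons vtx_free2// andbT.
apply/negP; rewrite span_cons => /memv_addP[_ /vlineP[c ->] [w ws E]].
have wo : orth_to s w.
  have -> : w = 1 *: (vtx j - vtx i) + (- c) *: (vtx l - vtx i).
    by rewrite E scale1r scaleNr addrAC subrr add0r.
  by apply: orth_to_lin; exact: vtx_orth.
have w0 : w = 0.
  by apply/eqP; rewrite -dot_eq0; apply/eqP; have /mem_orthv := orth_to_span wo; exact.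
by move: E; rewrite w0 addr0 => /vtx_coords[]; exact: pyr_coords_indep.
Qed.

(* The vector orthogonal to s whose products with A, B, C are a eta, b eta, - eta. *)
Definition ray a b : 'rV[R]_n :=
  ((sigma + a * eta) / alpha) *: x + ((rho + b * eta) / beta) *: y - u.

Lemma ray_orth a b : orth_to s (ray a b).
Proof. by move=> w ws; rewrite !dotD xs// ys// us//; ring. Qed.

Lemma ray_dual a b : [/\ dot (ray a b) A = a * eta, dot (ray a b) B = b * eta &
  dot (ray a b) C = - eta].
Proof.
have [a0 b0] : alpha != 0 /\ beta != 0 by split; rewrite gt_eqF.
split; rewrite ?dotA ?dotB ?dotC' /ray !dotD ?xx ?yy ?uu ?(dotC y x) ?(dotC u x) ?(dotC u y) ?xy ?xu ?yu.
- by field; rewrite ?a0 ?b0.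
- by field; rewrite ?a0 ?b0.
- by ring.
Qed.

Definition edge_space i j := orthv <<vtx j - vtx i :: s>>%VS.

Definition edge_frame i j : 'M[R]_(2, n) := frame_of (edge_space i j).

Lemma edge_frameP i j : i != j -> plane_frame (edge_space i j) (edge_frame i j).
Proof.
move=> ij; apply: (proj1 (frame_ofP _)).
exact: (edge_dim_orthv nd sized vtx_free2).
Qed.

Lemma edge_spaceP i j X : X \in edge_space i j <->
  orth_to s X /\ dot X (vtx j) = dot X (vtx i).
Proof.
split=> [/span_orth_to Xo|[Xs E]].
  split=> [w ws|]; first by apply: Xo; rewrite inE ws orbT.
  by apply/eqP; rewrite -subr_eq0 -dotBr Xo// mem_head.
apply: orth_to_span => w; rewrite inE => /orP[/eqP ->|/Xs//].
by rewrite dotBr E subrr.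
Qed.

Lemma ray_edge i j a b :
  pyr_p R j * a + pyr_q R j * b - pyr_z R j = pyr_p R i * a + pyr_q R i * b - pyr_z R i ->
  ray a b \in edge_space i j.
Proof.
move=> E; apply/edge_spaceP; split; first exact: ray_orth.
have [h1 h2 h3] := ray_dual a b; rewrite !dot_vtx h1 h2 h3.
have F k : pyr_p R k * (a * eta) + pyr_q R k * (b * eta) + pyr_z R k * - eta =
  (pyr_p R k * a + pyr_q R k * b - pyr_z R k) * eta by ring.
by rewrite !F E.
Qed.

Lemma sector_mem (E : {vspace 'rV[R]_n}) (F : 'M[R]_(2, n)) v w z : plane_frame E F ->
  v \in E -> w \in E -> sector (v *m F^T) (w *m F^T) z <->
  exists a b, [/\ 0 <= a, 0 <= b & z *m F = a *: v + b *: w].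
Proof.
move=> [F1 Fm Fs] vE wE; split=> -[a [b [a0 b0 zE]]]; exists a, b; split=> //.
  by rewrite zE mulmxDl -!scalemxAl !Fs.
by rewrite !scalemxAl -mulmxDl -zE -mulmxA F1 mulmx1.
Qed.

Local Notation o0 := (@Ordinal 5 0 isT).
Local Notation o1 := (@Ordinal 5 1 isT).
Local Notation o2 := (@Ordinal 5 2 isT).
Local Notation o3 := (@Ordinal 5 3 isT).
Local Notation o4 := (@Ordinal 5 4 isT).

Lemma pyr_val : (pyr_p R o0 = 0) * (pyr_q R o0 = 0) * (pyr_z R o0 = 0) *
  (pyr_p R o1 = 1) * (pyr_q R o1 = 0) * (pyr_z R o1 = 1) *
  (pyr_p R o2 = -1) * (pyr_q R o2 = 0) * (pyr_z R o2 = 1) *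
  (pyr_p R o3 = 0) * (pyr_q R o3 = 1) * (pyr_z R o3 = 1) *
  (pyr_p R o4 = 0) * (pyr_q R o4 = -1) * (pyr_z R o4 = 1).
Proof. by []. Qed.

(** Either the apex with a base vertex, or one of +-A with one of +-B; the diagonals {1, 2} and {3,
    4} of the base are excluded. *)
Definition pyr_edge (i j : 'I_5) := (i < j)%N && ((i == 0 :> nat) || (i < 3 <= j)%N).

Lemma pyr_edgeP (i j : 'I_5) : (i < j)%N -> is_edge s vtx i j <-> pyr_edge i j.
Proof.
move=> ij; split=> [[X Xs aij]|].
  rewrite /pyr_edge ij /=; apply: contraT => nij.
  have Cm k : k \in [set i; j]%SET <-> forall l, dot X (vtx l) <= dot X (vtx k).
    by rewrite -aij; split=> /argmaxP.
  have [Ci Cj] : (i \in [set i; j]%SET) /\ (j \in [set i; j]%SET).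
    by rewrite finset.set21 finset.set22.
  move: Ci Cj => /Cm Ci /Cm Cj.
  have h12 k l : dot X (vtx k) <= dot X (vtx l) -> k \in [set i; j]%SET -> l \in [set i; j]%SET.
    by move=> kl /Cm kP; apply/Cm => l'; apply: le_trans (kP l') kl.
  (* The diagonals share their midpoint, so a functional that is maximal at both ends of one is
     maximal at the ends of the other. *)
  have : exists k, (k \in [set i; j]%SET) /\ exists2 l, l \notin [set i; j]%SET &
      dot X (vtx k) <= dot X (vtx l).
    have := Ci o1; have := Ci o2; have := Ci o3; have := Ci o4.
    have := Cj o1; have := Cj o2; have := Cj o3; have := Cj o4.
    clear aij Cm Ci Cj h12; move: i j ij nij; apply: ord5P; apply: ord5P => //= _ _;
      rewrite !dot_vtx !pyr_val => h1 h2 h3 h4 h5 h6 h7 h8.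
      exists o1; split; first by rewrite finset.set21.
      exists o3; first by rewrite finset.in_set2.
      by rewrite !dot_vtx !pyr_val; lra.
    exists o3; split; first by rewrite finset.set21.
    exists o1; first by rewrite finset.in_set2.
    by rewrite !dot_vtx !pyr_val; lra.
  move=> [k [kij [l lij kl]]].
  by move: lij; rewrite (h12 k l kl kij).
have H (P Q Z : R) : (forall k, let f k := pyr_p R k * P + pyr_q R k * Q + pyr_z R k * Z in
    if k \in [set i; j]%SET then f k = f i else f k < f i) -> is_edge s vtx i j.
  move=> PQZ; have [X [Xs XA XB XC]] := dual_ex P Q Z; exists X => //.
  have fE k : dot X (vtx k) = pyr_p R k * P + pyr_q R k * Q + pyr_z R k * Z.
    by rewrite dot_vtx XA XB XC.
  apply/setP => k; apply/argmaxP/idP => [kX|kM l].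
    have := PQZ k => /=; case: ifP => // _.
    by have := kX i; rewrite !fE leNgt => /negbTE ->.
  have := PQZ k => /=; rewrite kM !fE => ->.
  by have := PQZ l => /=; case: ifP => _ => [->|/ltW].
(* The exposing functional adds the A and B coordinates of the two vertices; Z = -1 gives maximum 0
   at the apex edges, Z = 1 gives maximum 2 at the base edges. *)
move=> eij; apply: (H (pyr_p R i + pyr_p R j) (pyr_q R i + pyr_q R j)
  (if i == 0 :> nat then -1 else 1)); clear H.
move: i j ij eij; apply: ord5P; apply: ord5P => //= _ _; apply: ord5P;
  rewrite finset.in_set2 /= !pyr_val; lra.
Qed.

Lemma pyr_dir j : j != o0 -> pyr_z R j = 1 /\ axis_dir (pyr_p R j) (pyr_q R j).
Proof. by move: j; apply: ord5P => // _; rewrite /axis_dir !pyr_val; split=> //; tauto. Qed.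

(* At a lateral edge the normal cone is spanned by the normals of the two adjacent
   lateral faces. *)
Lemma lateral_angle j : j != o0 -> edge_angle s vtx o0 j =
  sector_area (edge_frame o0 j) (ray (pyr_p R j + pyr_q R j) (pyr_q R j - pyr_p R j))
    (ray (pyr_p R j - pyr_q R j) (pyr_q R j + pyr_p R j)) / area (@unit_disk R).
Proof.
move=> j0; rewrite /edge_angle /sector_area; congr (area _ / _).
have [zj pq] := pyr_dir j0.
set r1 := ray _ _; set r2 := ray _ _.
have fr : plane_frame (edge_space o0 j) (edge_frame o0 j).
  by apply: edge_frameP; rewrite eq_sym.
have r1E : r1 \in edge_space o0 j.
  apply: ray_edge; rewrite zj !pyr_val.
  by case: pq => [|[|[|]]] [-> ->]; lra.
have r2E : r2 \in edge_space o0 j.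
  apply: ray_edge; rewrite zj !pyr_val.
  by case: pq => [|[|[|]]] [-> ->]; lra.
have [r1A r1B r1C] := ray_dual (pyr_p R j + pyr_q R j) (pyr_q R j - pyr_p R j).
have [r2A r2B r2C] := ray_dual (pyr_p R j - pyr_q R j) (pyr_q R j + pyr_p R j).
have r1o : orth_to s r1 by exact: ray_orth.
have r2o : orth_to s r2 by exact: ray_orth.
rewrite -/r1 in r1A r1B r1C; rewrite -/r2 in r2A r2B r2C; clearbody r1 r2.
rewrite setIC; congr (_ `&` _); apply/seteqP; split=> z.
  move=> cz; apply/(sector_mem _ fr) => //.
  have [_ Fm _] := fr; set X := z *m _.
  have /edge_spaceP[Xs] : X \in edge_space o0 j by exact: Fm.
  rewrite !dot_vtx zj !pyr_val => Xj.
  have Z0 : pyr_p R j * dot X A + pyr_q R j * dot X B + dot X C = 0.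
    by rewrite -[dot X C]mul1r Xj !mul0r !addr0.
  have [|a [b [a0 b0 PE QE ZE]]] := lateral_cone_le pq Z0.
    move=> l; have := cz l; rewrite -/(edge_space o0 j) -/(edge_frame o0 j) -/X !dot_vtx.
    by rewrite !pyr_val !mul0r !addr0.
  have e0 : eta != 0 by rewrite gt_eqF.
  exists (a / eta), (b / eta); split; try exact: divr_ge0 (ltW eta0).
  apply: dual_inj => //; first exact: orth_to_lin.
  - by rewrite dotDl !dotZl r1A r2A PE; field.
  - by rewrite dotDl !dotZl r1B r2B QE; field.
  - by rewrite dotDl !dotZl r1C r2C ZE; field.
move=> /(sector_mem _ fr)[]// a [b [a0 b0 zE]] l.
rewrite -/(edge_space o0 j) -/(edge_frame o0 j) zE !dot_vtx !dotDl !dotZl r1A r1B r1C r2A r2B r2C !pyr_val.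
rewrite [leRHS](_ : _ = 0); last by rewrite !mul0r !addr0.
have := lateral_cone_ge l pq (mulr_ge0 a0 (ltW eta0)) (mulr_ge0 b0 (ltW eta0)).
by apply: le_trans; rewrite le_eqVlt; apply/orP; left; apply/eqP; ring.
Qed.

(* At a base edge the normal cone is a half-plane minus the thin sector between the
   normal of the base (pointing down) and that of the adjacent lateral face. *)
Lemma base_angle (i j : 'I_5) : (0 < i < 3)%N -> (3 <= j)%N -> edge_angle s vtx i j =
  1 / 2 - sector_area (edge_frame i j) (ray 0 0) (ray (pyr_p R i) (pyr_q R j)) /
    area (@unit_disk R).
Proof.
move=> hi hj; rewrite /edge_angle /sector_area.
have ij : i != j by rewrite -val_eqE /=; lia.
have [pi2 qi zi] : [/\ pyr_p R i = 1 \/ pyr_p R i = -1, pyr_q R i = 0 & pyr_z R i = 1].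
  by clear hj ij; move: i hi; apply: ord5P => // _; rewrite !pyr_val; split=> //; tauto.
have [qj2 pj zj] : [/\ pyr_q R j = 1 \/ pyr_q R j = -1, pyr_p R j = 0 & pyr_z R j = 1].
  by clear hi ij; move: j hj; apply: ord5P => // _; rewrite !pyr_val; split=> //; tauto.
set r1 := ray _ _; set r2 := ray _ _.
have fr : plane_frame (edge_space i j) (edge_frame i j) by exact: edge_frameP.
have r1E : r1 \in edge_space i j by apply: ray_edge; rewrite zj zi; ring.
have r2E : r2 \in edge_space i j.
  by apply: ray_edge; rewrite zj zi qi pj; case: pi2 qj2 => -> [] ->; ring.
have [r1A r1B r1C] := ray_dual 0 0.
have [r2A r2B r2C] := ray_dual (pyr_p R i) (pyr_q R j).
have r1o : orth_to s r1 by exact: ray_orth.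
have r2o : orth_to s r2 by exact: ray_orth.
rewrite -/r1 !mul0r in r1A r1B r1C; rewrite -/r2 in r2A r2B r2C; clearbody r1 r2.
set F := edge_frame i j in fr *.
have [F1 Fm Fs] := fr.
have dF z v : dot z (v *m F^T) = dot (z *m F) v.
  by rewrite /dot trmx_mul trmxK mulmxA.
have F0 z : (z *m F) *m F^T = z by rewrite -mulmxA F1 mulmx1.
(* [c] and [c'] represent the two inequalities of the base cone in plane coordinates: the first
   gives the half-disk [H], and the second separates the angle from the thin sector. *)
pose c := (pyr_p R i *: A) *m F^T; pose c' := (pyr_p R i *: A + C) *m F^T.
have cE z : dot z c = pyr_p R i * dot (z *m F) A by rewrite dF dotZr.
have c'E z : dot z c' = pyr_p R i * dot (z *m F) A + dot (z *m F) C.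
  by rewrite dF dotDr dotZr.
have c0 : c != 0.
  apply/eqP => c0; have h : pyr_p R i * (pyr_p R i * eta) = 0 :> R.
    by rewrite -r2A -[X in _ * dot X _](Fs _ r2E) -cE c0 dot0r.
  move/eqP: h; rewrite !mulf_eq0 (gt_eqF eta0) orbF orbb => /eqP h.
  by case: pi2; rewrite h => /eqP; rewrite eq_sym ?oppr_eq0 oner_eq0.
have c'0 : c' != 0.
  apply/eqP => c'0; have h : pyr_p R i * 0 + - eta = 0 :> R.
    by rewrite -[X in _ * X]r1A -r1C -(Fs _ r1E) -c'E c'0 dot0r.
  by move/eqP: h; rewrite mulr0 add0r oppr_eq0 gt_eqF.
pose H := @unit_disk R `&` [set z | 0 <= dot z c].
have HE := area_split c'0 (@subIsetl _ _ _ : H `<=` @unit_disk R).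
have edgeT z : let X := z *m F in pyr_p R i * dot X A = pyr_q R j * dot X B.
  have /edge_spaceP[_] : z *m F \in edge_space i j by exact: Fm.
  by rewrite !dot_vtx zj zi qi pj /= => h; lra.
have -> : @unit_disk R `&` edge_cone s vtx i j = H `&` [set z | 0 <= dot z c'].
  rewrite /H -setIA; congr (_ `&` _); apply/seteqP; split=> z.
    move=> cz; rewrite /= cE c'E.
    apply: (base_cone_le (Q := dot (z *m F) B)) => // l; have := cz l.
    by rewrite -/(edge_space i j) -/(edge_frame i j) -/F !dot_vtx zi qi.
  move=> [/= h1 h2]; rewrite cE in h1; rewrite c'E in h2.
  move=> l; rewrite -/(edge_space i j) -/(edge_frame i j) -/F !dot_vtx zi qi.
  exact: base_cone_ge (edgeT z) h1 h2.
have -> : sector (r1 *m F^T) (r2 *m F^T) `&` @unit_disk R = H `&` [set z | dot z c' <= 0].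
  rewrite /H -setIA setIC; congr (_ `&` _); apply/seteqP; split=> z.
    move=> /(sector_mem _ fr)[]// a [b [a0 b0 zE]]; rewrite /= cE c'E zE !dotDl !dotZl.
    rewrite r1A r1C r2A r2C.
    have ae : 0 <= a * eta by rewrite mulr_ge0// ltW.
    have be : 0 <= b * eta by rewrite mulr_ge0// ltW.
    by case: pi2 => ->; split; lra.
  move=> [/= h1 h2]; rewrite cE in h1; rewrite c'E in h2.
  apply/(sector_mem _ fr) => //; set X := z *m F in h1 h2 *.
  have /edge_spaceP[Xs _] : X \in edge_space i j by exact: Fm.
  have e0 : eta != 0 by rewrite gt_eqF.
  have h3 : pyr_p R i * dot X A = pyr_q R j * dot X B by exact: edgeT.
  have pp : pyr_p R i * pyr_p R i = 1 by case: pi2 => ->; ring.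
  have qq : pyr_q R j * pyr_q R j = 1 by case: qj2 => ->; ring.
  exists (- (pyr_p R i * dot X A + dot X C) / eta), (pyr_p R i * dot X A / eta); split.
  - by apply: divr_ge0 (ltW eta0); rewrite oppr_ge0.
  - exact: divr_ge0 (ltW eta0).
  apply: dual_inj => //; first exact: orth_to_lin.
  - rewrite dotDl !dotZl r1A r2A mulr0 add0r.
    transitivity (pyr_p R i * pyr_p R i * dot X A); first by rewrite pp mul1r.
    by field.
  - rewrite dotDl !dotZl r1B r2B mulr0 add0r h3.
    transitivity (pyr_q R j * pyr_q R j * dot X B); first by rewrite qq mul1r.
    by field.
  - by rewrite dotDl !dotZl r1C r2C; field.
have D0 : 0 < area (@unit_disk R) by exact: area_unit_disk_gt0.
have HD : area H = area (@unit_disk R) / 2 by exact: area_half_disk.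
rewrite HD in HE.
have D1 : area (@unit_disk R) != 0 by rewrite gt_eqF.
apply: (mulIf D1); rewrite mulrBl !(divfK D1).
have -> : area (H `&` [set z | 0 <= dot z c']) =
  area (@unit_disk R) / 2 - area (H `&` [set z | dot z c' <= 0]) by rewrite HE addrK.
by rewrite [1 / 2 * _]mulrC mul1r.
Qed.

Lemma sum_pyr_edges (f : 'I_5 -> 'I_5 -> R) : \sum_(p | edges s vtx p) f p.1 p.2 =
  f o0 o1 + f o0 o2 + f o0 o3 + f o0 o4 + (f o1 o3 + f o1 o4 + f o2 o3 + f o2 o4).
Proof.
rewrite (eq_bigl (fun p => pyr_edge p.1 p.2)); last first.
  move=> [i j]; rewrite /edges /=; case ij: (i < j)%N; last by rewrite /pyr_edge ij.
  by apply/asboolP/idP => /(pyr_edgeP ij).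
rewrite big_mkcond /= -(pair_big xpredT xpredT (fun i j => if pyr_edge i j then f i j else 0)) /=.
by rewrite sum_ord5 !sum_ord5 /pyr_edge /=; lra.
Qed.

Variables (m : convexBody R n -> R) (g : set 'rV[R]_n -> R).
Hypothesis mv : real_val m.
Hypothesis ang : real_angular d m g.

Let nu := val_deltas m s.
Let G w := nu (cb_seg w).

(** Opposite base edges are parallel, so their angles 1/2 add up to 1 and reproduce the value on the
    base, which is what is subtracted; only thin sectors remain. *)
Lemma pyramid_edges : nu (cb_pyramid A B C) - (G (A - B) + G (A + B)) =
  ((sector_area (edge_frame o0 o1) (ray 1 (-1)) (ray 1 1) * G (A + C) +
    sector_area (edge_frame o0 o2) (ray (-1) 1) (ray (-1) (-1)) * G (- A + C) +
    sector_area (edge_frame o0 o3) (ray 1 1) (ray (-1) 1) * G (B + C) +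
    sector_area (edge_frame o0 o4) (ray (-1) (-1)) (ray 1 (-1)) * G (- B + C)) -
   ((sector_area (edge_frame o1 o3) (ray 0 0) (ray 1 1) +
     sector_area (edge_frame o2 o4) (ray 0 0) (ray (-1) (-1))) * G (A - B) +
    (sector_area (edge_frame o1 o4) (ray 0 0) (ray 1 (-1)) +
     sector_area (edge_frame o2 o3) (ray 0 0) (ray (-1) 1)) * G (A + B)))
  / area (@unit_disk R).
Proof.
have nuv : real_val nu := val_deltas_real_val s mv.
rewrite {1}/nu (val_deltas_edges nd mv ang sized (cb_pyramidE A B C) vtx_free2 vtx_free3).
rewrite (sum_pyr_edges (fun i j => edge_angle s vtx i j * nu (edge_body vtx i j))).
have eb i j : nu (edge_body vtx i j) = G (vtx j - vtx i).
  by have [_ _ nt] := nuv; apply: nt.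
have lat j a1 b1 a2 b2 : j != o0 -> pyr_p R j + pyr_q R j = a1 ->
    pyr_q R j - pyr_p R j = b1 -> pyr_p R j - pyr_q R j = a2 ->
    pyr_q R j + pyr_p R j = b2 -> edge_angle s vtx o0 j =
    sector_area (edge_frame o0 j) (ray a1 b1) (ray a2 b2) / area (@unit_disk R).
  by move=> j0 <- <- <- <-; exact: lateral_angle.
have bas (i j : 'I_5) a2 b2 : (0 < i < 3)%N -> (3 <= j)%N -> pyr_p R i = a2 ->
    pyr_q R j = b2 -> edge_angle s vtx i j =
    1 / 2 - sector_area (edge_frame i j) (ray 0 0) (ray a2 b2) / area (@unit_disk R).
  by move=> hi hj <- <-; exact: base_angle.
have l1 : edge_angle s vtx o0 o1 =
    sector_area (edge_frame o0 o1) (ray 1 (-1)) (ray 1 1) / area (@unit_disk R).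
  by apply: lat => //; rewrite !pyr_val; ring.
have l2 : edge_angle s vtx o0 o2 =
    sector_area (edge_frame o0 o2) (ray (-1) 1) (ray (-1) (-1)) / area (@unit_disk R).
  by apply: lat => //; rewrite !pyr_val; ring.
have l3 : edge_angle s vtx o0 o3 =
    sector_area (edge_frame o0 o3) (ray 1 1) (ray (-1) 1) / area (@unit_disk R).
  by apply: lat => //; rewrite !pyr_val; ring.
have l4 : edge_angle s vtx o0 o4 =
    sector_area (edge_frame o0 o4) (ray (-1) (-1)) (ray 1 (-1)) / area (@unit_disk R).
  by apply: lat => //; rewrite !pyr_val; ring.
have l13 : edge_angle s vtx o1 o3 = 1 / 2 -
    sector_area (edge_frame o1 o3) (ray 0 0) (ray 1 1) / area (@unit_disk R).
  by apply: bas; rewrite ?pyr_val.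
have l14 : edge_angle s vtx o1 o4 = 1 / 2 -
    sector_area (edge_frame o1 o4) (ray 0 0) (ray 1 (-1)) / area (@unit_disk R).
  by apply: bas; rewrite ?pyr_val.
have l23 : edge_angle s vtx o2 o3 = 1 / 2 -
    sector_area (edge_frame o2 o3) (ray 0 0) (ray (-1) 1) / area (@unit_disk R).
  by apply: bas; rewrite ?pyr_val.
have l24 : edge_angle s vtx o2 o4 = 1 / 2 -
    sector_area (edge_frame o2 o4) (ray 0 0) (ray (-1) (-1)) / area (@unit_disk R).
  by apply: bas; rewrite ?pyr_val.
rewrite l1 l2 l3 l4 l13 l14 l23 l24 !eb.
have v0 : vtx o0 = 0 by rewrite /vtx /pyr_vertex !pyr_val !scale0r !addr0.
have v1 : vtx o1 = A + C by rewrite /vtx /pyr_vertex !pyr_val scale0r addr0 !scale1r.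
have v2 : vtx o2 = - A + C by rewrite /vtx /pyr_vertex !pyr_val scale0r addr0 scaleN1r scale1r.
have v3 : vtx o3 = B + C by rewrite /vtx /pyr_vertex !pyr_val scale0r add0r !scale1r.
have v4 : vtx o4 = - B + C by rewrite /vtx /pyr_vertex !pyr_val scale0r add0r scaleN1r scale1r.
rewrite v0 v1 v2 v3 v4 !subr0.
have -> : B + C - (A + C) = - (A - B) by apply/rowP => i; rewrite !mxE; ring.
have -> : - B + C - (A + C) = - (A + B) by apply/rowP => i; rewrite !mxE; ring.
have -> : B + C - (- A + C) = A + B by apply/rowP => i; rewrite !mxE; ring.
have -> : - B + C - (- A + C) = A - B by apply/rowP => i; rewrite !mxE; ring.
rewrite /G !(seg_opp nuv).
have : area (@unit_disk R) != 0 by rewrite gt_eqF// area_unit_disk_gt0.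
generalize (area (@unit_disk R)) (nu (cb_seg (A - B))) (nu (cb_seg (A + B)))
  (nu (cb_seg (A + C))) (nu (cb_seg (- A + C))) (nu (cb_seg (B + C))) (nu (cb_seg (- B + C)))
  (sector_area (edge_frame o0 o1) (ray 1 (-1)) (ray 1 1))
  (sector_area (edge_frame o0 o2) (ray (-1) 1) (ray (-1) (-1)))
  (sector_area (edge_frame o0 o3) (ray 1 1) (ray (-1) 1))
  (sector_area (edge_frame o0 o4) (ray (-1) (-1)) (ray 1 (-1)))
  (sector_area (edge_frame o1 o3) (ray 0 0) (ray 1 1))
  (sector_area (edge_frame o1 o4) (ray 0 0) (ray 1 (-1)))
  (sector_area (edge_frame o2 o3) (ray 0 0) (ray (-1) 1))
  (sector_area (edge_frame o2 o4) (ray 0 0) (ray (-1) (-1))).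
move=> D a1 a2 a3 a4 a5 a6 b1 b2 b3 b4 b5 b6 b7 b8 D0.
by field.
Qed.

End Pyramid.

Lemma edge_sum_div (K : fieldType) (e D a1 a2 a3 a4 a5 a6 b1 b2 b3 b4 b5 b6 b7 b8 : K) :
  (b1 / e * a1 + b2 / e * a2 + b3 / e * a3 + b4 / e * a4 -
   ((b5 / e + b6 / e) * a5 + (b7 / e + b8 / e) * a6)) / D =
  (b1 * a1 + b2 * a2 + b3 * a3 + b4 * a4 - ((b5 + b6) * a5 + (b7 + b8) * a6)) / D / e.
Proof. by rewrite [RHS]mulrAC; congr (_ / D); ring. Qed.

(** * The first-order term of a flat pyramid *)

Section PyramidLimit.
Variables (R : realType) (n d : nat) (s : seq 'rV[R]_n) (x y u : 'rV[R]_n).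
Hypothesis nd : n = d.+3.
Hypothesis sized : size s = d.
Hypothesis frees : free s.
Hypotheses (xx : dot x x = 1) (yy : dot y y = 1) (uu : dot u u = 1).
Hypotheses (xy : dot x y = 0) (xu : dot x u = 0) (yu : dot y u = 0).
Hypothesis xs : forall w, w \in s -> dot x w = 0.
Hypothesis ys : forall w, w \in s -> dot y w = 0.
Hypothesis us : forall w, w \in s -> dot u w = 0.
Variables (m : convexBody R n -> R) (g : set 'rV[R]_n -> R).
Hypothesis mv : real_val m.
Hypothesis ang : real_angular d m g.
Variables (alpha beta : R).
Hypotheses (alpha0 : 0 < alpha) (beta0 : 0 < beta).
(** The filter is abstract so that [sigma], [rho] and [eta] can be sent to 0 jointly, without any
    relation between them. *)
Variables (T : Type) (F : set_system T) (FF : Filter F) (sigma rho eta : T -> R).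
Hypothesis sigma_cvg : sigma i @[i --> F] --> 0.
Hypothesis rho_cvg : rho i @[i --> F] --> 0.
Hypothesis eta_cvg : eta i @[i --> F] --> 0.
Hypothesis eta_gt0 : \forall i \near F, 0 < eta i.

Let A i := alpha *: x + sigma i *: u.
Let B i := beta *: y + rho i *: u.
Let C i := eta i *: u.
Let nu := val_deltas m s.
Let G w := nu (cb_seg w).
Let sa i (j k : 'I_5) a1 b1 a2 b2 :=
  sector_area (edge_frame s x y u alpha beta (sigma i) (rho i) (eta i) j k)
    (ray x y u alpha beta (sigma i) (rho i) (eta i) a1 b1)
    (ray x y u alpha beta (sigma i) (rho i) (eta i) a2 b2).

Lemma thin_ray_cvg (j k : 'I_5) a1 b1 a2 b2 : j != k ->
  pyr_p R k * a1 + pyr_q R k * b1 - pyr_z R k = pyr_p R j * a1 + pyr_q R j * b1 - pyr_z R j ->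
  pyr_p R k * a2 + pyr_q R k * b2 - pyr_z R k = pyr_p R j * a2 + pyr_q R j * b2 - pyr_z R j ->
  0 < ((a2 - a1) / alpha) ^+ 2 + ((b2 - b1) / beta) ^+ 2 ->
  (sa i j k a1 b1 a2 b2 / eta i) @[i --> F] -->
  Num.sqrt (((a2 - a1) / alpha) ^+ 2 + ((b2 - b1) / beta) ^+ 2) * area (@triangle R).
Proof.
move=> jk e1 e2 e0.
have rayE i (a b : R) : ray x y u alpha beta (sigma i) (rho i) (eta i) a b =
  ((sigma i + a1 * eta i) / alpha + eta i * ((a - a1) / alpha)) *: x +
  ((rho i + b1 * eta i) / beta + eta i * ((b - b1) / beta)) *: y - u.
  by rewrite /ray; congr (_ *: _ + _ *: _ - _); ring.
have h1 : (sigma i + a1 * eta i) / alpha @[i --> F] --> 0.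
  have -> : (0 : R) = (0 + a1 * 0) / alpha by ring.
  by apply: cvgMl; apply: cvgD => //; apply: cvgMr.
have h2 : (rho i + b1 * eta i) / beta @[i --> F] --> 0.
  have -> : (0 : R) = (0 + b1 * 0) / beta by ring.
  by apply: cvgMl; apply: cvgD => //; apply: cvgMr.
have fr : \forall i \near F,
  [/\ plane_frame (edge_space s x y u alpha beta (sigma i) (rho i) (eta i) j k)
       (edge_frame s x y u alpha beta (sigma i) (rho i) (eta i) j k),
     ((sigma i + a1 * eta i) / alpha) *: x + ((rho i + b1 * eta i) / beta) *: y - u \in
       edge_space s x y u alpha beta (sigma i) (rho i) (eta i) j k &
     ((sigma i + a1 * eta i) / alpha + eta i * ((a2 - a1) / alpha)) *: x +
     ((rho i + b1 * eta i) / beta + eta i * ((b2 - b1) / beta)) *: y - u \in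
       edge_space s x y u alpha beta (sigma i) (rho i) (eta i) j k].
  near=> i; have ei0 : 0 < eta i by near: i.
  split.
  - exact: (edge_frameP nd sized frees xx yy uu xy xu yu xs ys us).
  - exact: (ray_edge xx yy uu xy xu yu xs ys us (sigma i) (rho i) (eta i) alpha0 beta0 e1).
  - rewrite -rayE.
    exact: (ray_edge xx yy uu xy xu yu xs ys us (sigma i) (rho i) (eta i) alpha0 beta0 e2).
have H := @thin_sector_cvg R n T F FF x y u _ _ _ _ _ _ _ xx yy uu xy xu yu e0 h1 h2 eta_cvg eta_gt0 fr.
apply: (cvg_trans _ H); apply: near_eq_cvg; apply: nearW => i.
by rewrite /sa (rayE i a2).
Unshelve. all: by end_near. Qed.

Lemma edge_sum_cvg (f1 f2 f3 f4 h1 h2 h3 h4 k1 k2 k3 k4 k5 k6 : T -> R)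
    (x1 x2 x3 x4 y1 y2 y3 y4 z1 z2 z3 z4 z5 z6 D : R) :
  f1 i @[i --> F] --> x1 -> f2 i @[i --> F] --> x2 -> f3 i @[i --> F] --> x3 ->
  f4 i @[i --> F] --> x4 -> h1 i @[i --> F] --> y1 -> h2 i @[i --> F] --> y2 ->
  h3 i @[i --> F] --> y3 -> h4 i @[i --> F] --> y4 -> k1 i @[i --> F] --> z1 ->
  k2 i @[i --> F] --> z2 -> k3 i @[i --> F] --> z3 -> k4 i @[i --> F] --> z4 ->
  k5 i @[i --> F] --> z5 -> k6 i @[i --> F] --> z6 ->
  ((f1 i * k1 i + f2 i * k2 i + f3 i * k3 i + f4 i * k4 i -
   ((h1 i + h2 i) * k5 i + (h3 i + h4 i) * k6 i)) / D) @[i --> F] -->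
  (x1 * z1 + x2 * z2 + x3 * z3 + x4 * z4 - ((y1 + y2) * z5 + (y3 + y4) * z6)) / D.
Proof.
move=> c1 c2 c3 c4 e1 e2 e3 e4 o1 o2 o3 o4 o5 o6.
apply: cvgM; last exact: cvg_cst.
apply: cvgB.
  apply: cvgD; last exact: (cvgM c4 o4).
  apply: cvgD; last exact: (cvgM c3 o3).
  by apply: cvgD; [exact: (cvgM c1 o1)|exact: (cvgM c2 o2)].
by apply: cvgD; apply: cvgM => //; apply: cvgD.
Qed.

Lemma pyramid_cvg :
  (nu (cb_pyramid (A i) (B i) (C i)) - (G (A i - B i) + G (A i + B i))) / eta i @[i --> F] -->
  area (@triangle R) / area (@unit_disk R) *
    (2 / beta * (2 * G (alpha *: x)) + 2 / alpha * (2 * G (beta *: y)) -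
     Num.sqrt ((1 / alpha) ^+ 2 + (1 / beta) ^+ 2) *
       (2 * G (alpha *: x - beta *: y) + 2 * G (alpha *: x + beta *: y))).
Proof.
have nuv : real_val nu := val_deltas_real_val s mv.
have ia : 0 < 1 / alpha by rewrite divr_gt0.
have ib : 0 < 1 / beta by rewrite divr_gt0.
have [ia2 ib2] : 0 < (1 / alpha) ^+ 2 /\ 0 < (1 / beta) ^+ 2 by split; rewrite exprn_gt0.
have sq (a : R) : 0 < a -> Num.sqrt ((2 / a) ^+ 2) = 2 / a.
  by move=> a0; rewrite sqrtr_sqr gtr0_norm// divr_gt0.
pose S := Num.sqrt ((1 / alpha) ^+ 2 + (1 / beta) ^+ 2).
(* The two rays of a lateral sector differ by 2 eta in a single product, with A or with B, hence by
   2 eta / alpha or 2 eta / beta in space; those of a base sector differ by eta in both. *)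
have lat j a1 b1 a2 b2 (c : R) : ord0 != j ->
    pyr_p R j * a1 + pyr_q R j * b1 - pyr_z R j = 0 ->
    pyr_p R j * a2 + pyr_q R j * b2 - pyr_z R j = 0 ->
    0 < c -> ((a2 - a1) / alpha) ^+ 2 + ((b2 - b1) / beta) ^+ 2 = c ^+ 2 ->
    (sa i ord0 j a1 b1 a2 b2 / eta i) @[i --> F] --> c * area (@triangle R).
  move=> j0 e1 e2 c0 E; have -> : c = Num.sqrt (c ^+ 2) by rewrite sqrtr_sqr gtr0_norm.
  by rewrite -E; apply: thin_ray_cvg => //;
    rewrite ?e1 ?e2 /pyr_p /pyr_q /pyr_z /= ?mul0r ?subr0 ?addr0// E exprn_gt0.
have bas (j k : 'I_5) a2 b2 : j != k ->
    pyr_p R k * 0 + pyr_q R k * 0 - pyr_z R k = pyr_p R j * 0 + pyr_q R j * 0 - pyr_z R j ->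
    pyr_p R k * a2 + pyr_q R k * b2 - pyr_z R k = pyr_p R j * a2 + pyr_q R j * b2 - pyr_z R j ->
    a2 ^+ 2 = 1 -> b2 ^+ 2 = 1 ->
    (sa i j k 0 0 a2 b2 / eta i) @[i --> F] --> S * area (@triangle R).
  move=> jk e1 e2 a21 b21.
  have E : ((a2 - 0) / alpha) ^+ 2 + ((b2 - 0) / beta) ^+ 2 = (1 / alpha) ^+ 2 + (1 / beta) ^+ 2.
    by rewrite !subr0 !expr_div_n a21 b21 !expr1n.
  by rewrite /S -E; apply: thin_ray_cvg => //; rewrite E addr_gt0.
have l1 := lat (Ordinal (isT : 1 < 5)%N) 1 (-1) 1 1 (2 / beta).
have {}l1 := l1 isT ltac:(rewrite /pyr_p /pyr_q /pyr_z /=; ring)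
  ltac:(rewrite /pyr_p /pyr_q /pyr_z /=; ring) (divr_gt0 (ltr0Sn _ 1) beta0) ltac:(field; rewrite ?gt_eqF//).
have l2 := lat (Ordinal (isT : 2 < 5)%N) (-1) 1 (-1) (-1) (2 / beta).
have {}l2 := l2 isT ltac:(rewrite /pyr_p /pyr_q /pyr_z /=; ring)
  ltac:(rewrite /pyr_p /pyr_q /pyr_z /=; ring) (divr_gt0 (ltr0Sn _ 1) beta0) ltac:(field; rewrite ?gt_eqF//).
have l3 := lat (Ordinal (isT : 3 < 5)%N) 1 1 (-1) 1 (2 / alpha).
have {}l3 := l3 isT ltac:(rewrite /pyr_p /pyr_q /pyr_z /=; ring)
  ltac:(rewrite /pyr_p /pyr_q /pyr_z /=; ring) (divr_gt0 (ltr0Sn _ 1) alpha0) ltac:(field; rewrite ?gt_eqF//).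
have l4 := lat (Ordinal (isT : 4 < 5)%N) (-1) (-1) 1 (-1) (2 / alpha).
have {}l4 := l4 isT ltac:(rewrite /pyr_p /pyr_q /pyr_z /=; ring)
  ltac:(rewrite /pyr_p /pyr_q /pyr_z /=; ring) (divr_gt0 (ltr0Sn _ 1) alpha0) ltac:(field; rewrite ?gt_eqF//).
have b13 := bas (Ordinal (isT : 1 < 5)%N) (Ordinal (isT : 3 < 5)%N) 1 1.
have {}b13 := b13 isT ltac:(rewrite /pyr_p /pyr_q /pyr_z /=; ring)
  ltac:(rewrite /pyr_p /pyr_q /pyr_z /=; ring) ltac:(ring) ltac:(ring).
have b14 := bas (Ordinal (isT : 1 < 5)%N) (Ordinal (isT : 4 < 5)%N) 1 (-1).
have {}b14 := b14 isT ltac:(rewrite /pyr_p /pyr_q /pyr_z /=; ring)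
  ltac:(rewrite /pyr_p /pyr_q /pyr_z /=; ring) ltac:(ring) ltac:(ring).
have b23 := bas (Ordinal (isT : 2 < 5)%N) (Ordinal (isT : 3 < 5)%N) (-1) 1.
have {}b23 := b23 isT ltac:(rewrite /pyr_p /pyr_q /pyr_z /=; ring)
  ltac:(rewrite /pyr_p /pyr_q /pyr_z /=; ring) ltac:(ring) ltac:(ring).
have b24 := bas (Ordinal (isT : 2 < 5)%N) (Ordinal (isT : 4 < 5)%N) (-1) (-1).
have {}b24 := b24 isT ltac:(rewrite /pyr_p /pyr_q /pyr_z /=; ring)
  ltac:(rewrite /pyr_p /pyr_q /pyr_z /=; ring) ltac:(ring) ltac:(ring).
clear lat bas.
pose a := alpha *: x; pose b := beta *: y.
have Gc w (h : T -> R) (k : T -> 'rV[R]_n) : h i @[i --> F] --> 0 ->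
    (forall i, k i = w + h i *: u) -> G (k i) @[i --> F] --> G w.
  move=> hc hk; have H := @seg_cvg _ _ nu nuv T F FF w u h hc.
  by apply: (cvg_trans _ H); apply: near_eq_cvg; apply: nearW => i; rewrite /G hk.
have c0 (p q r : R) : p * sigma i + q * rho i + r * eta i @[i --> F] --> 0.
  have -> : (0 : R) = p * 0 + q * 0 + r * 0 by ring.
  by apply: cvgD; [apply: cvgD|]; apply: cvgMr.
have g1 : G (A i + C i) @[i --> F] --> G a.
  by apply: (Gc _ _ _ (c0 1 0 1)) => i; apply/rowP => l; rewrite !mxE; ring.
have g2 : G (- A i + C i) @[i --> F] --> G a.
  rewrite /G -(seg_opp nuv a).
  by apply: (Gc _ _ _ (c0 (-1) 0 1)) => i; apply/rowP => l; rewrite !mxE; ring.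
have g3 : G (B i + C i) @[i --> F] --> G b.
  by apply: (Gc _ _ _ (c0 0 1 1)) => i; apply/rowP => l; rewrite !mxE; ring.
have g4 : G (- B i + C i) @[i --> F] --> G b.
  rewrite /G -(seg_opp nuv b).
  by apply: (Gc _ _ _ (c0 0 (-1) 1)) => i; apply/rowP => l; rewrite !mxE; ring.
have g5 : G (A i - B i) @[i --> F] --> G (a - b).
  by apply: (Gc _ _ _ (c0 1 (-1) 0)) => i; apply/rowP => l; rewrite !mxE; ring.
have g6 : G (A i + B i) @[i --> F] --> G (a + b).
  by apply: (Gc _ _ _ (c0 1 1 0)) => i; apply/rowP => l; rewrite !mxE; ring.
have H : ((sa i ord0 (Ordinal (isT : 1 < 5)%N) 1 (-1) 1 1 / eta i * G (A i + C i) +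
     sa i ord0 (Ordinal (isT : 2 < 5)%N) (-1) 1 (-1) (-1) / eta i * G (- A i + C i) +
     sa i ord0 (Ordinal (isT : 3 < 5)%N) 1 1 (-1) 1 / eta i * G (B i + C i) +
     sa i ord0 (Ordinal (isT : 4 < 5)%N) (-1) (-1) 1 (-1) / eta i * G (- B i + C i) -
     ((sa i (Ordinal (isT : 1 < 5)%N) (Ordinal (isT : 3 < 5)%N) 0 0 1 1 / eta i +
       sa i (Ordinal (isT : 2 < 5)%N) (Ordinal (isT : 4 < 5)%N) 0 0 (-1) (-1) / eta i) * G (A i - B i) +
      (sa i (Ordinal (isT : 1 < 5)%N) (Ordinal (isT : 4 < 5)%N) 0 0 1 (-1) / eta i +
       sa i (Ordinal (isT : 2 < 5)%N) (Ordinal (isT : 3 < 5)%N) 0 0 (-1) 1 / eta i) * G (A i + B i))) /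
    area (@unit_disk R)) @[i --> F] -->
    (2 / beta * area (@triangle R) * G a + 2 / beta * area (@triangle R) * G a +
     2 / alpha * area (@triangle R) * G b + 2 / alpha * area (@triangle R) * G b -
     ((S * area (@triangle R) + S * area (@triangle R)) * G (a - b) +
      (S * area (@triangle R) + S * area (@triangle R)) * G (a + b))) / area (@unit_disk R).
  exact: edge_sum_cvg l1 l2 l3 l4 b13 b24 b14 b23 g1 g2 g3 g4 g5 g6.
set L' := (X in _ --> X); move: H; set L := (X in _ --> X -> _).
have -> : L = L' by rewrite /L /L' /S; ring.
move=> H; apply: (cvg_trans _ H); apply: near_eq_cvg; near=> i; have ei0 : 0 < eta i by near: i.
have e0 : eta i != 0 by rewrite gt_eqF.
have := pyramid_edges nd sized frees xx yy uu xy xu yu xs ys us (sigma i) (rho i)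
  alpha0 beta0 ei0 mv ang.
rewrite -/nu -/(A i) -/(B i) -/(C i) => ->.
rewrite /=; exact: edge_sum_div.
Unshelve. all: by end_near. Qed.

End PyramidLimit.

(** * Cutting pyramids off a paraboloid *)

Section ParaboloidCells.
Variable R : realType.
Implicit Types (i j k l : int) (P Q t eta : R) (c : nat * nat) (L : seq (nat * nat)).

(* The chord of t^2 over [i eta, (i + 1) eta]; the maximum over i interpolates t^2 on
   the grid of mesh eta. *)
Definition lower_line (eta : R) i t := (2 * i%:~R + 1) * eta * t - i%:~R * (i%:~R + 1) * eta ^+ 2.

(* A pair c = (k, l) encodes the grid point (k + l, k - l): the diamonds
   |p| + |r| <= eta centred at the grid points with even coordinate sum have
   disjoint interiors. *)
Definition cell_i c : int := c.1%:Z + c.2%:Z.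

Definition cell_j c : int := c.1%:Z - c.2%:Z.

(* The tangent plane of p^2 + r^2 at the grid point of c, raised by eta^2. *)
Definition cut_plane (eta : R) c (v : R * R * R) : R :=
  2 * (cell_i c)%:~R * eta * v.1.1 + 2 * (cell_j c)%:~R * eta * v.1.2 -
  ((cell_i c)%:~R ^+ 2 + (cell_j c)%:~R ^+ 2) * eta ^+ 2 + eta ^+ 2.

(* The epigraph of the interpolant (up to height 3) with the vertices in L cut off. *)
Definition para (eta : R) L : set (R * R * R) := [set v |
  [/\ `|v.1.1| <= 1, `|v.1.2| <= 1, v.2 <= 3,
      forall i j, lower_line eta i v.1.1 + lower_line eta j v.1.2 <= v.2 &
      forall c, c \in L -> cut_plane eta c v <= v.2]].

(* Maps the unit pyramid onto the piece cut off at c; the shear makes the tangent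
   plane at the grid point horizontal. *)
Definition cell_map (eta : R) c (v : R * R * R) : R * R * R :=
  ((cell_i c)%:~R * eta + eta * v.1.1, (cell_j c)%:~R * eta + eta * v.1.2,
   ((cell_i c)%:~R ^+ 2 + (cell_j c)%:~R ^+ 2) * eta ^+ 2 +
   eta ^+ 2 * (2 * (cell_i c)%:~R * v.1.1 + 2 * (cell_j c)%:~R * v.1.2 + v.2)).

Lemma le_of_sub (a b c : R) : 0 <= c -> c = b - a -> a <= b.
Proof. by move=> c0 cE; rewrite -subr_ge0 -cE. Qed.

Lemma lower_line_le eta i t : lower_line eta i t <= t ^+ 2 + eta ^+ 2 / 4.
Proof.
apply: (le_of_sub (sqr_ge0 (t - i%:~R * eta - eta / 2))); rewrite /lower_line.
by field.
Qed.

(** Taken over the grid interval that contains t, where chord minus parabola equals (t - i eta) ((i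
    + 1) eta - t). *)
Lemma lower_line_ge eta t : 0 < eta -> exists i, t ^+ 2 <= lower_line eta i t.
Proof.
move=> e0; exists (Num.floor (t / eta)); set i := Num.floor _.
have h1 : i%:~R * eta <= t by rewrite -ler_pdivlMr// floor_le.
have h2 : t <= (i%:~R + 1) * eta.
  by rewrite -ler_pdivrMr// ltW// -[X in _ + X]/(1%:~R) -intrD floorD1_gt.
have := mulr_ge0 (_ : 0 <= t - i%:~R * eta) (_ : 0 <= (i%:~R + 1) * eta - t).
rewrite !subr_ge0 => /(_ h1 h2) h; apply: (le_of_sub h); rewrite /lower_line; ring.
Qed.

Lemma cut_plane_le eta c v : cut_plane eta c v <= v.1.1 ^+ 2 + v.1.2 ^+ 2 + eta ^+ 2.
Proof.
have h := addr_ge0 (sqr_ge0 (v.1.1 - (cell_i c)%:~R * eta))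
  (sqr_ge0 (v.1.2 - (cell_j c)%:~R * eta)).
by apply: (le_of_sub h); rewrite /cut_plane; ring.
Qed.

(** The case of mesh 1 at the grid point 0, where the tangent vanishes; [lower_line_cell] shears
    every grid point to it. Negative k reduces to natural k by k to -k - 1 and P to -P. *)
Lemma lower_line_int k P : `|P| <= 1 -> (2 * k%:~R + 1) * P - k%:~R * (k%:~R + 1) <= `|P|.
Proof.
move=> P1.
have H (n : nat) (Q : R) : `|Q| <= 1 -> (2 * n%:R + 1) * Q - n%:R * (n%:R + 1) <= `|Q|.
  move=> Q1; have Q0 := normr_ge0 Q.
  have n0 : (0 : R) <= n%:R by [].
  have h1 : (2 * n%:R + 1) * Q <= (2 * n%:R + 1) * `|Q|.
    by rewrite ler_wpM2l ?ler_norm// addr_ge0// mulr_ge0.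
  have h2 : n%:R * `|Q| <= n%:R :> R by rewrite ler_piMr.
  have h3 : (n%:R : R) <= n%:R * n%:R by rewrite -natrM ler_nat; nia.
  lra.
case: k => n; first exact: H.
have := H n (- P); rewrite normrN => /(_ P1); apply: le_trans.
by rewrite NegzE rmorphN /= -pmulrn -natr1 le_eqVlt; apply/orP; left; apply/eqP; ring.
Qed.

Lemma lower_line_cell eta i i' P : `|P| <= 1 ->
  lower_line eta i' (i%:~R * eta + eta * P) <= eta ^+ 2 * (i%:~R ^+ 2 + 2 * i%:~R * P + `|P|).
Proof.
move=> P1; rewrite (_ : lower_line _ _ _ = eta ^+ 2 * (i%:~R ^+ 2 + 2 * i%:~R * P +
  ((2 * (i' - i)%:~R + 1) * P - (i' - i)%:~R * ((i' - i)%:~R + 1)))).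
  by rewrite ler_wpM2l ?sqr_ge0// lerD2l; exact: lower_line_int.
by rewrite /lower_line rmorphB /=; ring.
Qed.

(** Keeps the cuts apart: over the diamond of one grid point the cut plane of any other lies below
    the lateral surface |P| + |Q|. Here k and l are differences of codes; as integers they satisfy
    |k| <= k^2. *)
Lemma cut_plane_int k l P Q : `|P| + `|Q| <= 1 -> (k, l) != (0, 0) ->
  2 * (k%:~R + l%:~R) * P + 2 * (k%:~R - l%:~R) * Q + 1 <=
  `|P| + `|Q| + 2 * k%:~R ^+ 2 + 2 * l%:~R ^+ 2.
Proof.
move=> PQ kl; pose mu : R := `|P| + `|Q|.
have S1 : `|P + Q| <= mu by exact: ler_normD.
have D1 : `|P - Q| <= mu by rewrite -[X in _ <= _ + X]normrN; exact: ler_normD.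
have sq (i : int) : `|i%:~R| <= (i%:~R ^+ 2 : R).
  rewrite -real_normK ?num_real// expr2 -!intr_norm -intrM ler_int.
  by have := normr_ge0 i; nia.
have up (i : int) (S : R) : `|S| <= mu -> i%:~R * S <= `|i%:~R| * mu.
  by move=> h; apply: le_trans (ler_norm _) _; rewrite normrM ler_wpM2l.
have h1 := up k _ S1; have h2 := up l _ D1.
have one : 1 <= `|k%:~R : R| + `|l%:~R : R|.
  rewrite -!intr_norm -intrD -[leLHS]/(1%:~R) ler_int.
  have : (k != 0) || (l != 0) by move: kl; rewrite xpair_eqE negb_and.
  have := normr_ge0 k; have := normr_ge0 l.
  by rewrite -!normr_gt0; lia.
have sk := sq k; have sl := sq l.
(* After the estimates above, what remains is (2 (|k| + |l|) - 1) (1 - mu) >= 0. *)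
have := mulr_ge0 (_ : 0 <= 2 * (`|k%:~R : R| + `|l%:~R : R|) - 1) (_ : 0 <= 1 - mu).
move=> /(_ ltac:(lra) ltac:(rewrite /mu; lra)); rewrite -/mu => h3.
move: sk sl h1 h2 h3.
set k2 := k%:~R ^+ 2; set l2 := l%:~R ^+ 2; set ka := `|k%:~R|; set la := `|l%:~R|.
move=> sk sl h1 h2 h3.
have -> : 2 * (k%:~R + l%:~R) * P + 2 * (k%:~R - l%:~R) * Q =
   2 * (k%:~R * (P + Q)) + 2 * (l%:~R * (P - Q)) by ring.
lra.
Qed.

Lemma cut_plane_cell eta c c' v : c != c' -> `|v.1.1| + `|v.1.2| <= 1 ->
  cut_plane eta c' (cell_map eta c v) <=
  ((cell_i c)%:~R ^+ 2 + (cell_j c)%:~R ^+ 2) * eta ^+ 2 +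
   eta ^+ 2 * (2 * (cell_i c)%:~R * v.1.1 + 2 * (cell_j c)%:~R * v.1.2 + (`|v.1.1| + `|v.1.2|)).
Proof.
move=> cc v1; pose k : int := c'.1%:Z - c.1%:Z; pose l : int := c'.2%:Z - c.2%:Z.
have kl : (k, l) != (0, 0).
  apply: contra cc; rewrite xpair_eqE !subr_eq0 => /andP[/eqP[e1] /eqP[e2]].
  by rewrite [c]surjective_pairing [c']surjective_pairing e1 e2.
have := cut_plane_int v1 kl; rewrite -subr_ge0 => h.
apply: (le_of_sub (mulr_ge0 (sqr_ge0 eta) h)).
rewrite /cut_plane /cell_map /k /l /cell_i /cell_j /= !rmorphB !rmorphD /=; ring.
Qed.

Lemma cut_plane_self eta c v :
  cut_plane eta c (cell_map eta c v) = (cell_map eta c v).2 + eta ^+ 2 * (1 - v.2).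
Proof. by rewrite /cut_plane /cell_map /=; ring. Qed.

Lemma para_cell eta L c v : 0 < eta -> eta <= 1 -> c \notin L ->
  (`|(cell_i c)%:~R| + 1) * eta <= 1 -> (`|(cell_j c)%:~R| + 1) * eta <= 1 ->
  pyramid v -> para eta L (cell_map eta c v).
Proof.
move=> e0 e1 cL ci cj /andP[v1 v2].
have vv : `|v.1.1| + `|v.1.2| <= 1 by apply: le_trans v1 v2.
have n1 := normr_ge0 v.1.1; have n2 := normr_ge0 v.1.2.
have nb (i : int) (t : R) : `|t| <= 1 -> (`|i%:~R| + 1) * eta <= 1 -> `|i%:~R * eta + eta * t| <= 1.
  move=> t1; apply: le_trans; rewrite mulrDl mul1r; apply: le_trans (ler_normD _ _) _.
  by rewrite !normrM (gtr0_norm e0) lerD2l ler_piMr// ltW.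
have e2 : eta ^+ 2 <= 1 by rewrite expr_le1// ltW.
have b1 : `|(cell_map eta c v).1.1| <= 1 by apply: nb => //; lra.
have b2 : `|(cell_map eta c v).1.2| <= 1 by apply: nb => //; lra.
have z1 : ((cell_i c)%:~R ^+ 2 + (cell_j c)%:~R ^+ 2) * eta ^+ 2 +
   eta ^+ 2 * (2 * (cell_i c)%:~R * v.1.1 + 2 * (cell_j c)%:~R * v.1.2 + (`|v.1.1| + `|v.1.2|))
   <= (cell_map eta c v).2.
  by rewrite /= lerD2l ler_wpM2l ?sqr_ge0// lerD2l.
split=> //.
- have := cut_plane_le eta c (cell_map eta c v); rewrite cut_plane_self.
  have sq (t : R) : `|t| <= 1 -> t ^+ 2 <= 1.
    by move=> t1; rewrite -real_normK ?num_real// expr_le1.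
  have := sq _ b1; have := sq _ b2.
  have : 0 <= eta ^+ 2 * (1 - v.2) by rewrite mulr_ge0 ?sqr_ge0// subr_ge0.
  lra.
- move=> i j; apply: le_trans z1.
  have := lower_line_cell eta (cell_i c) i (_ : `|v.1.1| <= 1).
  have := lower_line_cell eta (cell_j c) j (_ : `|v.1.2| <= 1).
  move=> /(_ ltac:(lra)) h2 /(_ ltac:(lra)) h1; rewrite /=.
  by apply: le_trans (lerD h1 h2) _; rewrite le_eqVlt; apply/orP; left; apply/eqP; ring.
- move=> c' c'L; apply: le_trans z1; apply: cut_plane_cell => //.
  by apply: contraNneq cL => ->.
Qed.

Lemma para_cut eta L c w : 0 < eta -> para eta L w -> w.2 <= cut_plane eta c w ->
  exists2 v, pyramid v & w = cell_map eta c v.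
Proof.
move=> e0 [_ _ _ low _] cut.
pose P := w.1.1 / eta - (cell_i c)%:~R; pose Q := w.1.2 / eta - (cell_j c)%:~R.
have en : eta != 0 by rewrite gt_eqF.
pose Z := w.2 / eta ^+ 2 - ((cell_i c)%:~R ^+ 2 + (cell_j c)%:~R ^+ 2) -
  (2 * (cell_i c)%:~R * P + 2 * (cell_j c)%:~R * Q).
have wE : w = cell_map eta c (P, Q, Z).
  rewrite [LHS]surjective_pairing [w.1]surjective_pairing /cell_map /= /Z /P /Q.
  by congr (_, _, _); field.
have e2 : 0 < eta ^+ 2 by rewrite exprn_gt0.
exists (P, Q, Z) => //; apply/andP; split => /=; last first.
  move: cut; rewrite wE cut_plane_self lerDl pmulr_rge0//= subr_ge0//.
(* In cell coordinates the four chord planes that meet at the grid point say +-P +- Q <= Z; the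
   chord to the left of the grid point has index one less. *)
have lo (a b : bool) : (if a then P else - P) + (if b then Q else - Q) <= Z.
  have := low (cell_i c - (~~ a)%:Z) (cell_j c - (~~ b)%:Z); rewrite wE /= -subr_ge0 => h.
  rewrite -subr_ge0 -(pmulr_rge0 _ e2); apply: (le_of_sub h); rewrite subr0.
  rewrite /lower_line !rmorphB /=.
  by clear h; case: a; case: b; rewrite /=; ring.
have := lo true true; have := lo true false; have := lo false true; have := lo false false.
rewrite /= => l1 l2 l3 l4; case: (ger0P P) => _; case: (ger0P Q) => _; lra.
Qed.

End ParaboloidCells.

(** * The paraboloid and its polyhedral approximations as compact convex regions *)

Section HalfspaceRegions.
Variables (R : realType).
Implicit Types (D : set (R * R * R)) (v w : R * R * R).

Definition affine3 (h : R * R * R * R) v : R :=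
  h.1.1.1 * v.1.1 + h.1.1.2 * v.1.2 + h.1.2 * v.2 + h.2.

(** Intersections of closed half-spaces, stated through all affine inequalities valid on D;
    closedness and convexity then follow at once for the curved and the polyhedral region. *)
Definition halfspace_region D := forall v,
  (forall h, (forall w, D w -> 0 <= affine3 h w) -> 0 <= affine3 h v) -> D v.

Lemma affine3_continuous h : continuous (affine3 h).
Proof.
move=> v; apply: (@cvgD _ _ _ (nbhs v)); last exact: cvg_cst.
apply: (@cvgD _ _ _ (nbhs v)); last by apply: cvgMr; exact: coord2_continuous.
by apply: (@cvgD _ _ _ (nbhs v)); apply: cvgMr;
  [exact: coord11_continuous|exact: coord12_continuous].
Qed.

Lemma halfspace_region_closed D : halfspace_region D -> closed D.
Proof.
move=> HD; rewrite (_ : D = \bigcap_(h in [set h | forall w, D w -> 0 <= affine3 h w])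
  [set v | 0 <= affine3 h v]).
  by apply: closed_bigI => h _; apply: closed_le3; exact: affine3_continuous.
apply/seteqP; split=> [v Dv h /=|v h]; first by apply.
by apply: HD => h' h'D; exact: h.
Qed.

Lemma halfspace_region_segment_closed D : halfspace_region D -> segment_closed3 D.
Proof.
move=> HD v w t Dv Dw /andP[t0 t1]; apply: HD => h hD.
apply: (le_of_sub (addr_ge0 (mulr_ge0 t0 (hD v Dv))
  (mulr_ge0 (_ : 0 <= 1 - t) (hD w Dw)))); first by rewrite subr_ge0.
by rewrite /affine3 /=; ring.
Qed.

Definition parab : set (R * R * R) := [set v |
  [/\ `|v.1.1| <= 1, `|v.1.2| <= 1, v.2 <= 3 & v.1.1 ^+ 2 + v.1.2 ^+ 2 <= v.2]].

Lemma halfspace_box D v : (forall w, D w -> [/\ `|w.1.1| <= 1, `|w.1.2| <= 1 & w.2 <= 3]) ->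
  (forall h, (forall w, D w -> 0 <= affine3 h w) -> 0 <= affine3 h v) ->
  [/\ `|v.1.1| <= 1, `|v.1.2| <= 1 & v.2 <= 3].
Proof.
move=> DB H.
have H1 := H (-1, 0, 0, 1); have H2 := H (1, 0, 0, 1); have H3 := H (0, -1, 0, 1).
have H4 := H (0, 1, 0, 1); have H5 := H (0, 0, -1, 3); rewrite /affine3 /= in H1 H2 H3 H4 H5.
have {}H1 := H1 ltac:(by move=> w /DB[/ler_normlP[? ?] _ _]; lra).
have {}H2 := H2 ltac:(by move=> w /DB[/ler_normlP[? ?] _ _]; lra).
have {}H3 := H3 ltac:(by move=> w /DB[_ /ler_normlP[? ?] _]; lra).
have {}H4 := H4 ltac:(by move=> w /DB[_ /ler_normlP[? ?] _]; lra).
have {}H5 := H5 ltac:(by move=> w /DB[_ _ ?]; lra).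
by split; rewrite ?ler_norml; try (apply/andP; split); lra.
Qed.

Lemma halfspace_parab : halfspace_region parab.
Proof.
move=> v H; have [h1 h2 h3] : [/\ `|v.1.1| <= 1, `|v.1.2| <= 1 & v.2 <= 3].
  by apply: halfspace_box H => w [].
(* The half-space above the tangent plane of the paraboloid over the base point of v. *)
have := H (- 2 * v.1.1, - 2 * v.1.2, 1, v.1.1 ^+ 2 + v.1.2 ^+ 2).
rewrite /affine3 /= => H4; split=> //.
have {}H4 := H4 ltac:(move=> w [_ _ _ w2];
  have := addr_ge0 (sqr_ge0 (w.1.1 - v.1.1)) (sqr_ge0 (w.1.2 - v.1.2)); nra).
nra.
Qed.

Lemma halfspace_para (eta : R) L : halfspace_region (para eta L).
Proof.
move=> v H; have [h1 h2 h3] : [/\ `|v.1.1| <= 1, `|v.1.2| <= 1 & v.2 <= 3].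
  by apply: halfspace_box H => w [].
split=> // [i j|c cL].
- have := H (- ((2 * i%:~R + 1) * eta), - ((2 * j%:~R + 1) * eta), 1,
    (i%:~R * (i%:~R + 1) + j%:~R * (j%:~R + 1)) * eta ^+ 2).
  have E w : affine3 (- ((2 * i%:~R + 1) * eta), - ((2 * j%:~R + 1) * eta), 1,
    (i%:~R * (i%:~R + 1) + j%:~R * (j%:~R + 1)) * eta ^+ 2) w =
    w.2 - (lower_line eta i w.1.1 + lower_line eta j w.1.2).
    by rewrite /affine3 /lower_line /=; ring.
  by rewrite E subr_ge0; apply=> w [_ _ _ low _]; rewrite E subr_ge0.
- have := H (- (2 * (cell_i c)%:~R * eta), - (2 * (cell_j c)%:~R * eta), 1,
    ((cell_i c)%:~R ^+ 2 + (cell_j c)%:~R ^+ 2) * eta ^+ 2 - eta ^+ 2).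
  have E w : affine3 (- (2 * (cell_i c)%:~R * eta), - (2 * (cell_j c)%:~R * eta), 1,
    ((cell_i c)%:~R ^+ 2 + (cell_j c)%:~R ^+ 2) * eta ^+ 2 - eta ^+ 2) w =
    w.2 - cut_plane eta c w by rewrite /affine3 /cut_plane /=; ring.
  by rewrite E subr_ge0; apply=> w [_ _ _ _ cut]; rewrite E subr_ge0; exact: cut.
Qed.

Lemma parab_compact : compact parab.
Proof.
apply: (@compact_region _ _ 3); first exact: halfspace_region_closed halfspace_parab.
move=> v [h1 h2 h3 h4]; have := addr_ge0 (sqr_ge0 v.1.1) (sqr_ge0 v.1.2).
by move=> h; split; [lra|lra|rewrite ger0_norm; lra].
Qed.

Lemma para_sub_parab (eta : R) L : 0 < eta -> para eta L `<=` parab.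
Proof.
move=> e0 v [h1 h2 h3 low _]; split=> //.
have [i hi] := lower_line_ge v.1.1 e0; have [j hj] := lower_line_ge v.1.2 e0.
exact: le_trans (lerD hi hj) (low i j).
Qed.

Lemma para_compact (eta : R) L : 0 < eta -> compact (para eta L).
Proof.
move=> e0; apply: subclosed_compact parab_compact (para_sub_parab e0).
exact: halfspace_region_closed (@halfspace_para eta L).
Qed.

(** Raising by eta^2 clears all chord and cut planes. The lid at height 3 is out of their reach:
    over the square they stay below p^2 + r^2 + eta^2 <= 3. *)
Lemma parab_raise (eta : R) L v : 0 < eta -> eta <= 1 -> parab v ->
  para eta L (v.1, Num.min (v.2 + eta ^+ 2) 3).
Proof.
move=> e0 e1 [h1 h2 h3 h4]; have e2 : eta ^+ 2 <= 1 by rewrite expr_le1// ltW.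
have e3 := sqr_ge0 eta.
have sq (t : R) : `|t| <= 1 -> t ^+ 2 <= 1.
  by move=> t1; rewrite -real_normK ?num_real// expr_le1.
have s1 := sq _ h1; have s2 := sq _ h2.
split=> //=; first by rewrite ge_min lexx orbT.
- move=> i j; have := lower_line_le eta i v.1.1; have := lower_line_le eta j v.1.2.
  by move=> l1 l2; rewrite le_min; apply/andP; split; lra.
- move=> c _; have := cut_plane_le eta c (v.1, Num.min (v.2 + eta ^+ 2) 3) => /= l1.
  by rewrite le_min; apply/andP; split; lra.
Qed.

Lemma parab_nonempty : parab !=set0.
Proof. by exists (0, 0, 0); split; rewrite /= ?normr0 ?expr0n /=; lra. Qed.

Lemma para_nonempty (eta : R) L : 0 < eta -> eta <= 1 -> para eta L !=set0.
Proof. by move=> e0 e1; have [v vP] := parab_nonempty; eexists; exact: parab_raise vP. Qed.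

End HalfspaceRegions.

(** * Removing the cells one at a time *)

Section ParaboloidBodies.
Variables (R : realType) (n : nat) (a b u : 'rV[R]_n) (nu : convexBody R n -> R).
Hypothesis nuv : real_val nu.
Hypothesis nu_scale : forall K (j : nat), (0 < j)%N -> nu (cb_scale j%:R K) = j%:R * nu K.
Hypothesis inj : injective (lin3 a b u).
Implicit Types (K : convexBody R n) (c : nat * nat) (L : seq (nat * nat)).

Lemma nu_shift z K : nu (cb_shift z K) = nu K.
Proof. by have [_ _ nt] := nuv; apply: nt. Qed.

Lemma nu_scaleV (j : nat) K : (0 < j)%N -> nu (cb_scale j%:R^-1 K) = j%:R^-1 * nu K.
Proof.
move=> j0; have j1 : j%:R != 0 :> R by rewrite pnatr_eq0 -lt0n.
have := nu_scale (cb_scale j%:R^-1 K) j0.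
rewrite (_ : cb_scale _ _ = K); first by move=> ->; rewrite mulKf.
apply: cb_inj; apply/seteqP; split=> [_ [_ [x Kx <-] <-]|x Kx].
  by rewrite scalerA divff// scale1r.
by exists (j%:R^-1 *: x); [exists x|rewrite scalerA divff// scale1r].
Qed.

Definition cb_parab : convexBody R n := cb_region a b u (parab_nonempty R) (@parab_compact R)
  (halfspace_region_segment_closed (@halfspace_parab R)).

Variable N : nat.
Hypothesis N0 : (0 < N)%N.
Let eta : R := N%:R^-1.

Let eta0 : 0 < eta.
Proof. by rewrite invr_gt0 ltr0n. Qed.

Let eta1 : eta <= 1.
Proof. by rewrite invf_le1 ?ltr0n// ler1n. Qed.

Definition cb_para L : convexBody R n := cb_region a b u (@para_nonempty R eta L eta0 eta1)
  (@para_compact R eta L eta0) (halfspace_region_segment_closed (@halfspace_para R eta L)).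

(** The coefficient of u is the slope of the tangent plane at the grid point, that is, the tilt of
    the pyramid cut off there. *)
Definition cell_a c : 'rV[R]_n := a + (2 * (cell_i c)%:~R * eta) *: u.

Definition cell_b c : 'rV[R]_n := b + (2 * (cell_j c)%:~R * eta) *: u.

Definition cell_origin c : 'rV[R]_n := ((cell_i c)%:~R * eta) *: a + ((cell_j c)%:~R * eta) *: b +
  (((cell_i c)%:~R ^+ 2 + (cell_j c)%:~R ^+ 2) * eta ^+ 2) *: u.

Definition cell_pyramid c := cb_pyramid (cell_a c) (cell_b c) (eta *: u).

Definition cb_cell c := cb_shift (cell_origin c) (cb_scale eta (cell_pyramid c)).

(** The base conv(+-A, +-B) is written as -A + [0, A - B] + [0, A + B], because nu is additive on
    sums of two segments. *)
Definition cb_cell_base c := cb_shift (cell_origin c + eta *: (eta *: u)) (cb_scale eta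
  (cb_shift (- cell_a c) (cb_add (cb_seg (cell_a c - cell_b c)) (cb_seg (cell_a c + cell_b c))))).

Lemma lin3_cell_map c v : lin3 a b u (cell_map eta c v) =
  cell_origin c + eta *: lin3 (cell_a c) (cell_b c) (eta *: u) v.
Proof. by apply/rowP => i; rewrite /lin3 /cell_a /cell_b /cell_origin !mxE /=; ring. Qed.

Definition good_cell c := (`|(cell_i c)%:~R| + 1) * eta <= 1 /\ (`|(cell_j c)%:~R| + 1) * eta <= 1.

Lemma cb_cellP c x : cb_set (cb_cell c) x <->
  exists2 v, pyramid v & x = lin3 a b u (cell_map eta c v).
Proof.
split=> [[_ [_ [v pv <-] <-] <-]|[v pv ->]].
  by exists v => //; rewrite lin3_cell_map.
exists (eta *: lin3 (cell_a c) (cell_b c) (eta *: u) v); last by rewrite lin3_cell_map.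
by exists (lin3 (cell_a c) (cell_b c) (eta *: u) v) => //; exists v.
Qed.

Lemma cb_cell_baseP c x : cb_set (cb_cell_base c) x <->
  exists2 v, pyramid v & v.2 = 1 /\ x = lin3 a b u (cell_map eta c v).
Proof.
split=> [[_ [_ [_ [_ [s /andP[s0 s1] <-] [_ [t /andP[t0 t1] <-] <-]] <-] <-] <-]|].
  exists (s + t - 1, t - s, 1).
    rewrite /pyramid /= lexx andbT.
    by case: (ger0P (s + t - 1)) => _; case: (ger0P (t - s)) => _; lra.
  by split=> //; rewrite lin3_cell_map; apply/rowP => i; rewrite /lin3 !mxE /=; ring.
move=> [[[P Q] z] /andP[/= pq _] [zE ->]]; rewrite zE in pq *; clear z zE.
have [] : P <= `|P| /\ - P <= `|P| by split; rewrite ?ler_norm// -normrN ler_norm.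
have [] : Q <= `|Q| /\ - Q <= `|Q| by split; rewrite ?ler_norm// -normrN ler_norm.
move=> Q1 Q2 P1 P2.
pose S := cb_set (cb_cell_base c); change (S (lin3 a b u (cell_map eta c (P, Q, 1)))).
suff H (s t : R) : 0 <= s <= 1 -> 0 <= t <= 1 ->
    S (cell_origin c + eta *: (eta *: u) + eta *: (- cell_a c + (s *: (cell_a c - cell_b c) +
      t *: (cell_a c + cell_b c)))).
  have := H ((P - Q + 1) / 2) ((P + Q + 1) / 2) _ _.
  rewrite (_ : _ + eta *: (- cell_a c + _) = lin3 a b u (cell_map eta c (P, Q, 1))).
    by apply; apply/andP; split; lra.
  by rewrite lin3_cell_map; apply/rowP => i; rewrite /lin3 !mxE /=; field.
move=> s01 t01; rewrite /S /=; eexists; last by [].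
eexists; last by []; eexists; last by [].
by exists (s *: (cell_a c - cell_b c)); [exists s|exists (t *: (cell_a c + cell_b c)) => //; exists t].
Qed.

(** The uncut body is the union of the cut body and the cell, which meet in the base of the cell;
    the factor eta comes from the homogeneity of nu. *)
Lemma para_step L c : c \notin L -> good_cell c ->
  nu (cb_para L) - nu (cb_para (c :: L)) = eta * (nu (cell_pyramid c) -
    (nu (cb_seg (cell_a c - cell_b c)) + nu (cb_seg (cell_a c + cell_b c)))).
Proof.
move=> cL [ci cj]; have [nv _ _] := nuv.
have cellE : nu (cb_cell c) = eta * nu (cell_pyramid c) by rewrite nu_shift nu_scaleV.
have baseE : nu (cb_cell_base c) =
    eta * (nu (cb_seg (cell_a c - cell_b c)) + nu (cb_seg (cell_a c + cell_b c))).
  by rewrite nu_shift nu_scaleV// nu_shift nu_seg_add.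
rewrite mulrBr -cellE -baseE (nv (cb_para (c :: L)) (cb_cell c) _ (cb_cell_base c)).
- by ring.
- apply/seteqP; split=> [_ [w [h1 h2 h3 h4 h5] <-]|x [[w [h1 h2 h3 h4 h5] <-]|]].
  + have [cut|cut] := lerP (cut_plane eta c w) w.2.
      left; exists w => //; split=> // c'; rewrite inE => /orP[/eqP -> //|]; exact: h5.
    right; apply/cb_cellP.
    have [v pv ->] : exists2 v, pyramid v & w = cell_map eta c v.
      by apply: (@para_cut _ _ L) => //; exact: ltW.
    by exists v.
  + by exists w => //; split=> // c' c'L; apply: h5; rewrite inE c'L orbT.
  + move=> /cb_cellP[v pv ->]; exists (cell_map eta c v) => //.
    exact: para_cell.
- apply/seteqP; split=> [x /cb_cell_baseP[v pv [v1 ->]]|x [[w [_ _ _ _ cut] <-] /cb_cellP[v pv]]].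
  + split; last by apply/cb_cellP; exists v.
    exists (cell_map eta c v) => //.
    have [h1 h2 h3 h4 h5] := para_cell eta0 eta1 cL ci cj pv.
    split=> // c'; rewrite inE => /orP[/eqP ->|]; last exact: h5.
    by rewrite cut_plane_self v1 subrr mulr0 addr0.
  + move=> /inj wE; apply/cb_cell_baseP; exists v => //; split; last by rewrite wE.
    have := cut c (mem_head _ _); rewrite wE cut_plane_self gerDl pmulr_rle0 ?exprn_gt0//.
    by move: pv => /andP[_ v1]; lra.
Qed.

Lemma para_sum L : uniq L -> (forall c, c \in L -> good_cell c) ->
  nu (cb_para [::]) - nu (cb_para L) = eta * \sum_(c <- L) (nu (cell_pyramid c) -
    (nu (cb_seg (cell_a c - cell_b c)) + nu (cb_seg (cell_a c + cell_b c)))).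
Proof.
elim: L => [|c L IH]; first by rewrite big_nil mulr0 subrr.
move=> /= /andP[cL uL] gL; rewrite big_cons mulrDr -IH//; last first.
  by move=> c' c'L; apply: gL; rewrite inE c'L orbT.
rewrite -(para_step cL); last by apply: gL; rewrite mem_head.
by ring.
Qed.

Lemma hausdorff_para L : hausdorff_dist cb_parab (cb_para L) <= eta ^+ 2 * enorm u.
Proof.
apply: hausdorff_dist_le; split; first by rewrite mulr_ge0 ?sqr_ge0 ?enorm_ge0.
  move=> _ [v pv <-]; exists (lin3 a b u (v.1, Num.min (v.2 + eta ^+ 2) 3)).
    by exists (v.1, Num.min (v.2 + eta ^+ 2) 3) => //; exact: parab_raise.
  rewrite (_ : _ - _ = (v.2 - Num.min (v.2 + eta ^+ 2) 3) *: u); last first.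
    by rewrite /lin3 /=; apply/rowP => i; rewrite !mxE; ring.
  rewrite enormZ ler_wpM2r ?enorm_ge0//.
  have [_ _ v3 _] := pv; have e3 := sqr_ge0 eta.
  rewrite ler0_norm; last by rewrite subr_le0 le_min v3 andbT lerDl.
  by rewrite opprB lerBlDl ge_min lexx.
move=> _ [v pv <-]; exists (lin3 a b u v); first by exists v => //; exact: para_sub_parab pv.
by rewrite subrr enorm0 mulr_ge0 ?sqr_ge0 ?enorm_ge0.
Qed.

End ParaboloidBodies.

Lemma cell_bound (R : realType) (k l m : nat) : (k < m)%N -> (l < m)%N ->
  `|(cell_i (k, l))%:~R : R| + 1 <= (2 * m)%:R /\ `|(cell_j (k, l))%:~R : R| + 1 <= (2 * m)%:R.
Proof.
move=> km lm; have H (i : int) : `|i| + 1 <= (2 * m)%:Z -> `|i%:~R : R| + 1 <= (2 * m)%:R.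
  by rewrite -(ler_int R) intrD intr_norm.
by rewrite /cell_i /cell_j /=; split; apply: H; lia.
Qed.

(** * The parallelogram law on segments *)

Section SegmentParallelogram.
Variables (R : realType) (n d : nat) (s : seq 'rV[R]_n) (x y u : 'rV[R]_n).
Hypothesis nd : n = d.+3.
Hypothesis sized : size s = d.
Hypothesis frees : free s.
Hypotheses (xx : dot x x = 1) (yy : dot y y = 1) (uu : dot u u = 1).
Hypotheses (xy : dot x y = 0) (xu : dot x u = 0) (yu : dot y u = 0).
Hypothesis xs : forall w, w \in s -> dot x w = 0.
Hypothesis ys : forall w, w \in s -> dot y w = 0.
Hypothesis us : forall w, w \in s -> dot u w = 0.
Variables (m : convexBody R n -> R) (g : set 'rV[R]_n -> R).
Hypothesis mv : real_val m.
Hypothesis mh : real_homogeneous d.+1 m.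
Hypothesis ang : real_angular d m g.
Variables (alpha beta : R).
Hypotheses (alpha0 : 0 < alpha) (beta0 : 0 < beta).

Let nu := val_deltas m s.
Let G w := nu (cb_seg w).

Lemma lin3_inj : injective (lin3 (alpha *: x) (beta *: y) u).
Proof.
move=> v w E; have H z := congr1 (fun t => dot t z) E.
have := H x; rewrite /lin3 !dotD xx (dotC y x) (dotC u x) xy xu !mulr0 !addr0 !mulr1.
move=> /(mulIf (lt0r_neq0 alpha0)) e1.
have := H y; rewrite /lin3 !dotD yy (dotC u y) xy yu !mulr0 !addr0 !add0r !mulr1.
move=> /(mulIf (lt0r_neq0 beta0)) e2.
have := H u; rewrite /lin3 !dotD uu xu yu !mulr0 !add0r !mulr1 => e3.
by rewrite [v]surjective_pairing [v.1]surjective_pairing e1 e2 e3 -!surjective_pairing.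
Qed.

(** Uniformity in the slopes: the limit is taken along the filter of all triples tending to 0 with
    eta > 0, so one delta serves every cell. *)
Lemma pyramid_cvg_eps (l e : R) : 0 < e ->
  l = area (@triangle R) / area (@unit_disk R) *
    (2 / beta * (2 * G (alpha *: x)) + 2 / alpha * (2 * G (beta *: y)) -
     Num.sqrt ((1 / alpha) ^+ 2 + (1 / beta) ^+ 2) *
       (2 * G (alpha *: x - beta *: y) + 2 * G (alpha *: x + beta *: y))) ->
  exists2 delta : R, 0 < delta & forall sigma rho eta : R, `|sigma| < delta -> `|rho| < delta ->
    0 < eta < delta -> let A := alpha *: x + sigma *: u in let B := beta *: y + rho *: u in
    `|(nu (cb_pyramid A B (eta *: u)) - (G (A - B) + G (A + B))) / eta - l| < e.
Proof.
move=> e0 ->; pose near0 (delta : R) (p : R * R * R) :=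
  [/\ `|p.1.1| < delta, `|p.1.2| < delta & 0 < p.2 < delta].
pose F : set_system (R * R * R) := [set A | exists2 delta, 0 < delta & near0 delta `<=` A].
have FF : Filter F.
  split.
  - by exists 1.
  - move=> A B [d1 d10 h1] [d2 d20 h2]; exists (Num.min d1 d2); first by rewrite lt_min d10.
    move=> p [p1 p2 /andP[p3 p4]]; rewrite !lt_min in p1 p2 p4.
    move: p1 p2 p4 => /andP[p1 p1'] /andP[p2 p2'] /andP[p4 p4'].
    by split; [apply: h1|apply: h2]; split=> //; apply/andP.
  - by move=> A B AB [delta d0 h]; exists delta => // p /h; exact: AB.
have c1 : p.1.1 @[p --> F] --> (0 : R).
  apply/cvgrPdist_lt => r r0; exists r => // p [h _ _] /=.
  by rewrite sub0r normrN.
have c2 : p.1.2 @[p --> F] --> (0 : R).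
  apply/cvgrPdist_lt => r r0; exists r => // p [_ h _] /=.
  by rewrite sub0r normrN.
have c3 : p.2 @[p --> F] --> (0 : R).
  apply/cvgrPdist_lt => r r0; exists r => // p [_ _ /andP[h1 h2]] /=.
  by rewrite sub0r normrN gtr0_norm.
have c0 : \forall p \near F, 0 < p.2.
  by exists 1 => // p [_ _ /andP[]].
have := pyramid_cvg nd sized frees xx yy uu xy xu yu xs ys us mv ang alpha0 beta0 FF c1 c2 c3 c0.
move=> /cvgrPdist_lt/(_ e e0) [delta d0 h]; exists delta => // sigma rho eta s0 r0 e1.
by have := h (sigma, rho, eta); rewrite /= distrC; apply; split.
Qed.

Lemma seg_parallelogram :
  2 / beta * (2 * G (alpha *: x)) + 2 / alpha * (2 * G (beta *: y)) =
  Num.sqrt ((1 / alpha) ^+ 2 + (1 / beta) ^+ 2) *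
    (2 * G (alpha *: x - beta *: y) + 2 * G (alpha *: x + beta *: y)).
Proof.
have nuv : real_val nu := val_deltas_real_val s mv.
have nus K (j : nat) : (0 < j)%N -> nu (cb_scale j%:R K) = j%:R * nu K.
  by move=> j0; apply: val_deltas_scale_nat; rewrite ?sized.
apply/eqP; rewrite -subr_eq0; set l0 := _ - _.
have kappa : 0 < area (@triangle R) / area (@unit_disk R).
  by rewrite divr_gt0 ?area_triangle_gt0 ?area_unit_disk_gt0.
rewrite -(mulrI_eq0 l0 (lregP (lt0r_neq0 kappa))); set l := _ * l0.
apply: contraT => ln0; exfalso.
have l2 : 0 < `|l| / 2 by rewrite divr_gt0 ?normr_gt0.
have [delta d0 dP] := pyramid_cvg_eps l2 erefl.
(* Grid coordinates in the patch are at most 2 / T, so slopes are at most 4 / T < delta; T >= 2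
   keeps the cells inside the square. *)
pose T := (Num.truncn (4 / delta)).+2.
have T2 : (2 <= T)%N by [].
have T0 : (0 : R) < T%:R by rewrite ltr0n.
have Td : 4 / T%:R < delta.
  rewrite ltr_pdivrMr// mulrC -ltr_pdivrMr//.
  by apply: lt_le_trans (truncnS_gt _) _; rewrite ler_nat.
clearbody T.
have [_ nc _] := nuv.
(* There will be m1^2 cells, each changing nu by at least eta^2 |l| / 2. As eta m1 = 1 / T, this
   totals |l| / (2 T^2) = 2 e, while continuity allows strictly less. *)
pose e : R := `|l| / (4 * T%:R ^+ 2).
have e0 : 0 < e by rewrite divr_gt0 ?normr_gt0// mulr_gt0// exprn_gt0.
have [dl dl0 dlP] := nc (cb_parab (alpha *: x) (beta *: y) u) e e0.
pose m1 := (Num.truncn (1 / Num.min dl delta)).+1.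
have min0 : 0 < Num.min dl delta by rewrite lt_min dl0.
have mm : 1 / Num.min dl delta < m1%:R by exact: truncnS_gt.
have m10 : (0 < m1)%N by [].
(* The mesh 1 / (m1 T) is below [dl] and [delta], while the patch has size of order 1 / T whatever
   m1 is. *)
clearbody m1; pose N := (m1 * T)%N.
have N0 : (0 < N)%N by rewrite muln_gt0 m10 ltnW.
pose eta : R := N%:R^-1.
have eta0 : 0 < eta by rewrite invr_gt0 ltr0n.
have etad : eta < Num.min dl delta.
  rewrite -[X in _ < X]invrK ltf_pV2 ?posrE ?invr_gt0 ?ltr0n// -div1r.
  by apply: lt_le_trans mm _; rewrite ler_nat leq_pmulr// ltnW.
move: etad; rewrite lt_min => /andP[eta_dl eta_d].
have eta1 : eta <= 1 by rewrite invf_le1 ?ltr0n// ler1n.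
pose L := [seq (k, l) | k <- iota 0 m1, l <- iota 0 m1].
have uL : uniq L by apply: allpairs_uniq; rewrite ?iota_uniq// => -[? ?] [? ?] _ _ [-> ->].
have sL : size L = (m1 * m1)%N by rewrite size_allpairs size_iota.
have LP c : c \in L -> `|(cell_i c)%:~R : R| + 1 <= (2 * m1)%:R /\ `|(cell_j c)%:~R : R| + 1 <= (2 * m1)%:R.
  move=> /allpairsP[[k1 k2] [/=]]; rewrite !mem_iota /= => k1m k2m ->.
  exact: cell_bound.
have m1eta : (2 * m1)%:R * eta = 2 / T%:R.
  rewrite /eta /N !natrM; field.
  by rewrite !pnatr_eq0 -!lt0n m10 ltnW.
have good c : c \in L -> good_cell R N c.
  move=> /LP[h1 h2]; have h3 : 2 / T%:R <= 1 :> R by rewrite ler_pdivrMr// mul1r ler_nat.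
  by split; apply: le_trans h3; rewrite -m1eta ler_pM2r.
have small c : c \in L -> `|2 * (cell_i c)%:~R * eta| < delta /\ `|2 * (cell_j c)%:~R * eta| < delta.
  have H (t : R) : `|t| + 1 <= (2 * m1)%:R -> `|2 * t * eta| < delta.
    move=> h; apply: le_lt_trans Td; rewrite !normrM (gtr0_norm eta0) ger0_norm//.
    have -> : 4 / T%:R = 2 * ((2 * m1)%:R * eta) :> R by rewrite m1eta; field; rewrite gt_eqF.
    by rewrite -mulrA ler_pM2l// ler_pM2r//; lra.
  by move=> /LP[h1 h2]; split; exact: H.
pose a := alpha *: x; pose b := beta *: y.
pose f c := nu (cell_pyramid a b u N c) -
  (G (cell_a a u N c - cell_b b u N c) + G (cell_a a u N c + cell_b b u N c)).
(* The sign of l makes all contributions positive, so that they add up without cancellation. *)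
have key c : c \in L -> eta * (`|l| / 2) <= Num.sg l * f c.
  move=> cL; have [h1 h2] := small c cL.
  have := dP _ _ eta h1 h2; rewrite eta0 => /(_ eta_d) /=.
  rewrite -/(cell_a a u N c) -/(cell_b b u N c) -/(cell_pyramid a b u N c) -/(f c) => h.
  rewrite mulrC -ler_pdivlMr// -mulrA.
  have -> : `|l| / 2 = Num.sg l * l - `|l| / 2 by rewrite -normrEsg; lra.
  have : Num.sg l * (l - f c / eta) <= `|l| / 2.
    apply: le_trans (ler_norm _) _; rewrite normrM normr_sg ln0 mul1r distrC.
    exact: ltW.
  by rewrite mulrBr; lra.
have h0 := para_sum nuv nus (@lin3_inj) N0 uL good.
have hd L' : hausdorff_dist (cb_parab a b u) (cb_para a b u N0 L') < dl.
  apply: le_lt_trans (hausdorff_para _ _ _ _ _) _; rewrite /enorm uu sqrtr1 mulr1.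
  by apply: le_lt_trans eta_dl; rewrite expr2 ler_piMl// ltW.
have := dlP _ (hd L); have := dlP _ (hd [::]) => n1 n2.
have : `|nu (cb_para a b u N0 [::]) - nu (cb_para a b u N0 L)| < e + e.
  rewrite (_ : _ - _ = (nu (cb_parab a b u) - nu (cb_para a b u N0 L)) -
    (nu (cb_parab a b u) - nu (cb_para a b u N0 [::]))); last by ring.
  by apply: le_lt_trans (ler_normB _ _) _; exact: ltrD.
apply/negP; rewrite -leNgt.
apply: le_trans (_ : Num.sg l * (nu (cb_para a b u N0 [::]) - nu (cb_para a b u N0 L)) <= _).
  rewrite h0 mulrCA mulr_sumr.
  apply: le_trans (_ : eta * \sum_(c <- L) (eta * (`|l| / 2)) <= _); last first.
    by rewrite ler_pM2l// big_seq [leRHS]big_seq; apply: ler_sum => c; exact: key.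
  rewrite big_const_seq count_predT iter_addr_0 sL /e.
  rewrite le_eqVlt; apply/orP; left; apply/eqP.
  rewrite -[X in _ = _ * X]mulr_natr natrM /eta /N natrM; field.
  by rewrite !pnatr_eq0 -!lt0n m10 ltnW.
by apply: le_trans (ler_norm _) _; rewrite normrM normr_sg ln0 mul1r.
Qed.

End SegmentParallelogram.

(** * The parallelogram law for Klain functions *)

Section BoxVolumes.
Variables (R : realType) (n : nat).
Implicit Types (E : {vspace 'rV[R]_n}) (x y w : 'rV[R]_n) (s : seq 'rV[R]_n) (t : R).

(** In an orthonormal basis of E the parallelotope is the image of the cube under [T], and
    [T *m T^T] is the Gram matrix of the rows of M. *)
Lemma parallelotope_volume E (k : nat) (M : 'M[R]_(k, n)) : \dim E = k ->
  (forall i, row i M \in E) -> \det (M *m M^T) != 0 ->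
  volume E [set c *m M | c in @cube R k] = Num.sqrt (\det (M *m M^T)).
Proof.
move=> dE; move: M; rewrite -dE => M ME dM.
have [B1 BE] := onbP E; have Bs := frame_span erefl B1 BE.
set B := onb E in B1 BE Bs *; pose T := M *m B^T.
have TT : T *m T^T = M *m M^T.
  rewrite /T trmx_mul trmxK mulmxA; congr (_ *m _).
  by apply/row_matrixP => i; rewrite !row_mul Bs.
have dT : \det T ^+ 2 = \det (M *m M^T) by rewrite -TT det_mulmx det_tr expr2.
have uT : T \in unitmx.
  rewrite unitmxE unitfE; apply: contra_neq dM => dT0.
  by rewrite -dT dT0 expr0n.
rewrite /volume -dT sqrtr_sqr -/B.
rewrite (_ : [set _ | _ in _] = [set c *m T | c in @cube R (\dim E)]).
  by rewrite lebesgue_rV_mulmx// lebesgue_rV_cube mule1.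
apply/seteqP; split=> [_ [_ [c cc <-] <-]|_ [c cc <-]].
  by exists c => //; rewrite mulmxA.
by exists (c *m M); [exists c|rewrite mulmxA].
Qed.

Lemma cb_addsegsP K s y : cb_set (cb_addsegs K s) y <-> exists2 x, cb_set K x &
  exists2 c : nat -> R, (forall j, 0 <= c j <= 1) & y = x + \sum_(j < size s) c j *: s`_j.
Proof.
elim: s y => [|w s IH] y /=.
  split=> [Ky|[x Kx [c _ ->]]]; last by rewrite big_ord0 addr0.
  by exists y => //; exists (fun=> 0) => [j|]; rewrite ?lexx ?ler01// big_ord0 addr0.
split=> [[z /IH[x Kx [c c01 ->]] [_ [t t01 <-] <-]]|[x Kx [c c01 ->]]].
  exists x => //; exists (fun j => if j is j'.+1 then c j' else t) => [[|j]//|].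
  by rewrite big_ord_recl /= -addrA [_ + t *: w]addrC.
exists (x + \sum_(j < size s) c j.+1 *: s`_j).
  by apply/IH; exists x => //; exists (fun j => c j.+1).
exists (c 0%N *: w); first by exists (c 0%N).
by rewrite big_ord_recl /= -addrA [_ + c 0%N *: w]addrC.
Qed.

Definition orthonormal_seq s := forall i j, (i < size s)%N -> (j < size s)%N ->
  dot s`_i s`_j = (i == j)%:R.

Lemma orthonormal_seq_free s : orthonormal_seq s -> free s.
Proof.
move=> so; change (free (in_tuple s)); apply/freeP => c c0 i.
have := congr1 (fun v => dot v s`_i) c0; rewrite dot_suml dot0l (bigD1 i)//= big1.
  by rewrite dotZl so// eqxx mulr1 addr0.
by move=> j ji; rewrite dotZl so// (_ : (j == i :> nat) = false) ?mulr0//; exact/negbTE.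
Qed.

Lemma seg_box_volume E w s t : 0 < t -> w != 0 -> orthonormal_seq s ->
  (forall z, z \in s -> dot w z = 0) -> E = <<w :: s>>%VS -> \dim E = (size s).+1 ->
  volume E (cb_addsegs (cb_seg w) (scale_seq t s)) = t ^+ size s * enorm w.
Proof.
move=> t0 w0 so ws EE dE; pose X := w :: scale_seq t s.
pose M : 'M[R]_((size s).+1, n) := \matrix_(j < (size s).+1) X`_j.
have Xs j : (j < size s)%N -> (scale_seq t s)`_j = t *: s`_j.
  by move=> js; rewrite (nth_map 0).
have MM : M *m M^T = diag_mx (\row_j if j == 0 :> nat then dot w w else t ^+ 2).
  apply/matrixP => i j; have -> : (M *m M^T) i j = dot X`_i X`_j.
    by rewrite dotE !mxE; apply: eq_bigr => l _; rewrite !mxE.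
  rewrite !mxE; case: i j => [[|i] hi] [[|j] hj]; rewrite -val_eqE /=.
  - by rewrite mulr1n.
  - by rewrite Xs// dotZr ws ?mulr0// mem_nth.
  - by rewrite Xs// dotZl dotC ws ?mulr0// mem_nth.
  - rewrite !Xs// dotZl dotZr so// eqSS.
    by case: eqP => _; rewrite ?mulr1n ?mulr0n ?mulr0// mulr1.
have dM : \det (M *m M^T) = (t ^+ size s * enorm w) ^+ 2.
  rewrite MM det_diag big_ord_recl mxE /= -sqr_enorm exprMn mulrC; congr (_ * _).
  rewrite (eq_bigr (fun=> t ^+ 2)) => [|i _]; last by rewrite mxE.
  by rewrite prodr_const card_ord exprAC.
have pos : 0 < t ^+ size s * enorm w.
  by rewrite mulr_gt0 ?exprn_gt0// lt_neqAle enorm_ge0 eq_sym enorm_eq0 w0.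
rewrite (_ : cb_set _ = [set c *m M | c in @cube R (size s).+1]).
  rewrite parallelotope_volume//.
  - by rewrite dM sqrtr_sqr gtr0_norm.
  - move=> i; rewrite rowK EE; case: i => [[|i] hi] /=; first by rewrite memv_span ?mem_head.
    by rewrite Xs// memvZ// memv_span// inE mem_nth ?orbT.
  - by rewrite dM expf_neq0// gt_eqF.
have ss : size (scale_seq t s) = size s by rewrite size_map.
apply/seteqP; split=> y.
  move=> /cb_addsegsP[_ [a a01 <-] [c c01 ->]].
  exists (\row_j if (j : nat) is j'.+1 then c j' else a).
    by move=> j; rewrite !mxE; case: j => [[|j] hj] /=; [exact: a01|exact: c01].
  rewrite mulmx_sum_row big_ord_recl mxE rowK /=; congr (_ + _).
  rewrite ss; apply: eq_bigr => j _; rewrite mxE rowK /=.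
  by [].
move=> [c cc <-]; apply/cb_addsegsP; exists (c 0 ord0 *: w).
  by exists (c 0 ord0) => //=; have := cc ord0; rewrite !mxE.
exists (fun j => c 0 (inord j.+1)).
  by move=> j; have := cc (inord j.+1); rewrite !mxE.
rewrite mulmx_sum_row big_ord_recl rowK /=; congr (_ + _).
rewrite ss; apply: eq_bigr => j _; rewrite rowK /=; congr (c _ _ *: _).
by apply: val_inj; rewrite /= inordK// ltnS.
Qed.

End BoxVolumes.

(** * From segments to the Klain function *)

Section KlainParallelogram.
Variables (R : realType) (n d : nat).
Hypothesis nd : n = d.+3.
Variables (mu : convexBody R n -> R[i]).
Hypothesis mua : angular d.+1 mu.
(** [rho] stands for the real or the imaginary part: additive, homogeneous for real factors and
    bounded by the modulus. *)
Variable rho : R[i] -> R.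
Hypothesis rhoD : forall z w, rho (z + w) = rho z + rho w.
Hypothesis rhoZ : forall z (t : R), rho (z * (t%:C)%C) = rho z * t.
Hypothesis rho_lt : forall z (e : R), `|z| < (e%:C)%C -> `|rho z| < e.
Implicit Types (x y w v u : 'rV[R]_n) (s : seq 'rV[R]_n).

Let m K := rho (mu K).
Let g (F : set 'rV[R]_n) := rho (klain mu (direction F)) * volume (direction F) F.

Lemma rho0 : rho 0 = 0.
Proof. by have := rhoD 0 0; rewrite addr0 => h; lra. Qed.

Lemma rhoB (z w : R[i]) : rho (z - w) = rho z - rho w.
Proof. by have := rhoD (z - w) w; rewrite subrK => ->; rewrite addrK. Qed.

Lemma rho_real_val : real_val m.
Proof.
have [[v1 v2 v3 _ _] _] := mua; split.
- by move=> K L M N MKL NKL; rewrite /m (v1 K L M N)// rhoB rhoD.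
- move=> K e /(v2 K)[dl d0 h]; exists dl => // L /h h1.
  by rewrite -rhoB; exact: rho_lt.
- by move=> K L x KL; rewrite /m (v3 K L x).
Qed.

Lemma rho_homogeneous : real_homogeneous d.+1 m.
Proof.
have [[_ _ _ v4 _] _] := mua => K L t t0 KL.
by rewrite /m (v4 K L t)// mulrC rhoZ mulrC.
Qed.

Lemma rho_angular : real_angular d m g.
Proof.
have [_ v] := mua => P PP; rewrite /m v// !fsbig_finite; try exact: finite_faces.
rewrite (big_morph rho rhoD rho0); apply: eq_bigr => F _.
by rewrite !rhoZ /g mulrAC.
Qed.

(** On the box [0, w] plus the i-fold segments, m is the Klain value times the volume i^d |w|; so
    the sequence converging to the iterated difference is eventually constant. *)
Lemma seg_klain w s : size s = d -> orthonormal_seq s -> w != 0 ->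
  (forall z, z \in s -> dot w z = 0) ->
  val_deltas m s (cb_seg w) = enorm w * rho (klain mu <<w :: s>>%VS).
Proof.
move=> sd so w0 ws; have mv := rho_real_val.
have fr : free (w :: s).
  rewrite free_cons; apply/andP; split; last exact: orthonormal_seq_free.
  exact: notin_span.
have dE : \dim <<w :: s>>%VS = (size s).+1 by rewrite (eqnP fr).
have oo_filter : Filter (\oo : set_system nat) by exact _.
have H := @addsegs_cvg _ _ m s (cb_seg w) mv.
apply: (cvg_unique _ H); first exact: norm_hausdorff.
apply: cvg_near_cst; near=> i.
have i0 : (0 : R) < i%:R by rewrite ltr0n; near: i; exact: nbhs_infty_gt.
set K := cb_addsegs _ _.
have K0 : cb_set K 0.
  by apply: addsegs_mem; exists 0; rewrite ?scale0r//= lexx ler01.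
have Kw : cb_set K w.
  by apply: addsegs_mem; exists 1; rewrite ?scale1r//= lexx ler01.
have Es : <<w :: scale_seq i%:R s>>%VS = <<w :: s>>%VS.
  by rewrite !span_cons span_scale// gt_eqF.
have dK : direction K = <<w :: s>>%VS.
  rewrite -Es; apply: (direction_eq (x := 0)) => //.
    move=> z; rewrite inE add0r => /orP[/eqP -> //|zs]; rewrite -[z]add0r.
    apply: addsegs_mem_add => //; exists 0; rewrite ?scale0r//= lexx ler01//.
  move=> y /addsegs_sub[_ [t _ <-] yt]; rewrite subr0 span_cons -(subrK (t *: w) y) addrC.
  by rewrite memv_add// memvZ// memv_line.
have Kp : is_polytope K.
  apply: polytope_addsegs; exists [set 0; w]; first exact: finite_set2.
  rewrite conv_hull_pair subr0; apply/seteqP; split=> [_ [t t01 <-]|_ [_ [t t01 <-] <-]].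
    by exists (t *: w); rewrite ?add0r//; exists t.
  by rewrite add0r; exists t.
rewrite (angular_face nd rho_angular Kp) ?dK ?dE ?sd// /g dK.
rewrite (seg_box_volume i0 w0 so ws erefl dE) sd; field.
by rewrite expf_neq0 ?gt_eqF.
Unshelve. all: by end_near. Qed.

Lemma orthv_plane x y v s : size s = d -> orthonormal_seq s -> x != 0 -> y != 0 -> v != 0 ->
  dot x v = 0 -> dot y x = 0 -> dot y v = 0 -> (forall z, z \in s -> dot x z = 0) ->
  (forall z, z \in s -> dot y z = 0) -> (forall z, z \in s -> dot v z = 0) ->
  orthv <<[:: x; v]>>%VS = <<y :: s>>%VS.
Proof.
move=> sd so x0 y0 v0 xv yx yv xs ys vs; apply/esym/eqP; rewrite eqEdim; apply/andP; split.
  apply/span_subvP => z; rewrite inE => /orP[/eqP ->|zs]; apply: orth_to_span => w;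
    rewrite !inE => /orP[] /eqP -> //.
    by rewrite dotC xs.
  by rewrite dotC vs.
have f1 : free (y :: s).
  by rewrite free_cons orthonormal_seq_free// andbT; apply: notin_span.
have f2 : free [:: x; v].
  rewrite free_cons seq1_free v0 andbT; apply: notin_span => // z.
  by rewrite inE => /eqP ->.
have := dim_orthv <<[:: x; v]>>; rewrite (eqnP f1) (eqnP f2) /= sd; lia.
Qed.

Lemma complement_basis x y v : dot x x = 1 -> dot y y = 1 -> dot v v = 1 ->
  dot x y = 0 -> dot x v = 0 -> dot y v = 0 -> exists s, [/\ size s = d, orthonormal_seq s,
    (forall z, z \in s -> dot x z = 0), (forall z, z \in s -> dot y z = 0) &
    (forall z, z \in s -> dot v z = 0)].
Proof.
move=> xx yy vv xy xv yv.
have fr : free [:: x; y; v].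
  rewrite !free_cons nil_free andbT; apply/and3P; split; apply: notin_span;
    rewrite ?unit_neq0// => z; rewrite !inE.
  - by move=> /orP[] /eqP ->.
  - by move=> /eqP ->.
have [e [eo eE]] : exists e : 'I_d -> 'rV[R]_n, orthonormal_family e /\
    forall i, e i \in orthv <<[:: x; y; v]>>%VS.
  apply: orthonormal_exists; have := dim_orthv <<[:: x; y; v]>>.
  by rewrite (eqnP fr) /=; lia.
have sE i (hi : (i < d)%N) : [tuple e j | j < d]`_i = e (Ordinal hi).
  by have := tnth_mktuple e (Ordinal hi); rewrite (tnth_nth 0).
have so z : z \in [tuple e j | j < d] -> orth_to [:: x; y; v] z.
  by move=> /seq.mapP[j _ ->]; exact: span_orth_to.
exists [tuple e j | j < d]; split.
- by rewrite size_tuple.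
- by move=> i j; rewrite size_tuple => hi hj; rewrite !sE eo.
- by move=> z /so zo; rewrite dotC zo// !inE eqxx.
- by move=> z /so zo; rewrite dotC zo// !inE eqxx orbT.
- by move=> z /so zo; rewrite dotC zo// !inE eqxx !orbT.
Qed.

(* The factor |w|^2 makes this vanish at w = 0, whatever the junk value of the Klain
   function there. *)
Definition klain_form v w := dot w w * rho (klain mu (orthv <<[:: w; v]>>%VS)).

(* The complement of span(w, v) is spanned by s and the rotation of w by a right angle
   in the plane of x and y, so the law for segments is applied to beta x and alpha y. *)
Lemma klain_form_parallelogram v x y (alpha beta : R) : dot x x = 1 -> dot y y = 1 ->
  dot v v = 1 -> dot x y = 0 -> dot x v = 0 -> dot y v = 0 -> 0 < alpha -> 0 < beta ->
  klain_form v (alpha *: x + beta *: y) + klain_form v (alpha *: x - beta *: y) =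
  2 * klain_form v (alpha *: x) + 2 * klain_form v (beta *: y).
Proof.
move=> xx yy vv xy xv yv a0 b0.
have [s [sd so xs ys vs]] := complement_basis xx yy vv xy xv yv.
have v0 := unit_neq0 vv.
have sqn (a b : R) : dot (a *: x + b *: y) (a *: x + b *: y) = a ^+ 2 + b ^+ 2.
  by rewrite !dotD xx yy (dotC y x) xy; ring.
have lin (a b : R) : 0 < a ^+ 2 + b ^+ 2 -> klain_form v (a *: x + b *: y) =
    Num.sqrt (a ^+ 2 + b ^+ 2) * val_deltas m s (cb_seg (- b *: x + a *: y)).
  move=> ab; rewrite /klain_form seg_klain//; last first.
  - by move=> z zs; rewrite !dotD xs// ys//; ring.
  - by rewrite -dot_eq0 sqn sqrrN addrC gt_eqF.
  rewrite (@orthv_plane (a *: x + b *: y) (- b *: x + a *: y) v s sd so) //.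
  - rewrite mulrA /enorm !sqn sqrrN [b ^+ 2 + _]addrC -expr2 sqr_sqrtr//; exact: ltW.
  - by rewrite -dot_eq0 sqn gt_eqF.
  - by rewrite -dot_eq0 sqn sqrrN addrC gt_eqF.
  - by rewrite !dotD xv yv; ring.
  - by rewrite !dotD xx yy xy (dotC y x) xy; ring.
  - by rewrite !dotD xv yv; ring.
  - by move=> z zs; rewrite !dotD xs// ys//; ring.
  - by move=> z zs; rewrite !dotD xs// ys//; ring.
have [a2 b2] : 0 < alpha ^+ 2 /\ 0 < beta ^+ 2 by split; rewrite exprn_gt0.
have e1 : klain_form v (alpha *: x) = alpha * val_deltas m s (cb_seg (alpha *: y)).
  have := lin alpha 0; rewrite expr0n addr0 !scale0r addr0 oppr0 scale0r add0r => -> //.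
  by rewrite sqrtr_sqr gtr0_norm.
have nuv := val_deltas_real_val s rho_real_val.
have e2 : klain_form v (beta *: y) = beta * val_deltas m s (cb_seg (beta *: x)).
  have := lin 0 beta; rewrite expr0n add0r !scale0r add0r addr0 => -> //.
  by rewrite sqrtr_sqr gtr0_norm// scaleNr seg_opp.
have e3 := lin alpha beta (addr_gt0 a2 b2).
have e4 : klain_form v (alpha *: x - beta *: y) = Num.sqrt (alpha ^+ 2 + beta ^+ 2) *
    val_deltas m s (cb_seg (beta *: x + alpha *: y)).
  have := lin alpha (- beta); rewrite sqrrN opprK scaleNr; apply; exact: addr_gt0.
have := seg_parallelogram nd sd (orthonormal_seq_free so) xx yy vv xy xv yv xs ys vs
  rho_real_val rho_homogeneous rho_angular b0 a0.
have -> : (1 / beta) ^+ 2 + (1 / alpha) ^+ 2 = (alpha ^+ 2 + beta ^+ 2) / (alpha * beta) ^+ 2.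
  by field; rewrite !gt_eqF.
rewrite sqrtrM; last by rewrite ltW// addr_gt0.
rewrite sqrtrV ?sqr_ge0// sqrtr_sqr gtr0_norm ?mulr_gt0//.
rewrite e1 e2 e3 e4.
have -> : - beta *: x + alpha *: y = - (beta *: x - alpha *: y).
  by rewrite opprB scaleNr addrC.
rewrite (seg_opp nuv).
move: (val_deltas m s _) (val_deltas m s _) (val_deltas m s _) (val_deltas m s _)
  (Num.sqrt _) => g1 g2 g3 g4 S.
(* The factor alpha beta / 2 clears the denominators 1 / alpha, 1 / beta and the one extracted from
   the square root. *)
move=> /(congr1 (fun t => t * (alpha * beta) / 2)) h.
have -> : S * g2 + S * g1 = S / (alpha * beta) * (2 * g2 + 2 * g1) * (alpha * beta) / 2.
  by field; rewrite !gt_eqF.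
by rewrite -h; field; rewrite !gt_eqF.
Qed.

End KlainParallelogram.

(** * Averaging over signs *)

Section SignSums.
Variables (R : realType) (n : nat) (v : 'rV[R]_n) (F : 'rV[R]_n -> R[i]).
Hypothesis F0 : F 0 = 0.
Hypothesis FE : forall x y, dot x y = 0 -> dot x v = 0 -> dot y v = 0 ->
  F (x + y) + F (x - y) = 2 * F x + 2 * F y.
Variables (N : nat) (u : 'I_N -> 'rV[R]_n).
Hypothesis uo : orthonormal_family u.
Hypothesis uv : forall i, dot (u i) v = 0.

Definition sign_sum (k : nat) (eps : {ffun 'I_N -> bool}) : 'rV[R]_n :=
  \sum_(i < N | (i < k)%N) (-1) ^+ eps i *: u i.

Definition flip (j : 'I_N) (eps : {ffun 'I_N -> bool}) : {ffun 'I_N -> bool} :=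
  [ffun i => eps i (+) (i == j)].

Lemma flipK j : involutive (flip j).
Proof. by move=> eps; apply/ffunP => i; rewrite !ffunE -addbA addbb addbF. Qed.

Lemma sign_sumS (j : 'I_N) eps :
  sign_sum j.+1 eps = sign_sum j eps + (-1) ^+ eps j *: u j.
Proof.
rewrite /sign_sum (bigD1 j)//= addrC; congr (_ + _); apply: eq_bigl => i.
by rewrite ltnS ltn_neqAle andbC.
Qed.

Lemma sign_sum_flip (j : 'I_N) eps : sign_sum j (flip j eps) = sign_sum j eps.
Proof.
apply: eq_bigr => i ij; rewrite ffunE (_ : i == j = false) ?addbF//.
by apply/eqP => e; move: ij; rewrite e ltnn.
Qed.

(** Summing over full sign vectors keeps one index type through the induction. Pairing eps with its
    flip at j gives the parallelogram law for [u j] and the partial sum before it, which is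
    orthogonal to [u j]. *)
Lemma sum_sign_sums (k : nat) : (k <= N)%N -> \sum_eps F (sign_sum k eps) =
  #|{ffun 'I_N -> bool}|%:R * \sum_(i < N | (i < k)%N) F (u i).
Proof.
elim: k => [_|k IH kN].
  rewrite [X in _ * X]big_pred0// mulr0 big1// => eps _.
  by rewrite /sign_sum big_pred0.
have {}IH := IH (ltnW kN); pose j := Ordinal kN.
have two : (2 : R[i]) != 0 by rewrite pnatr_eq0.
apply: (mulfI two); rewrite (bigD1 j)//=.
rewrite (eq_bigl (fun i : 'I_N => (i < k)%N)); last first.
  by move=> i; rewrite ltnS [RHS]ltn_neqAle andbC -(inj_eq val_inj).
rewrite mulrDr -IH mulrDr.
have -> : 2 * \sum_eps F (sign_sum k.+1 eps) =
    \sum_eps (F (sign_sum k.+1 eps) + F (sign_sum k.+1 (flip j eps))).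
  rewrite big_split /= [X in _ = _ + X](_ : _ = \sum_eps F (sign_sum k.+1 eps)).
    by rewrite -mulr2n mulr_natl.
  by rewrite [RHS](reindex_inj (inv_inj (flipK j))).
transitivity (\sum_(eps : {ffun 'I_N -> bool}) (2 * F (sign_sum k eps) + 2 * F (u j))); last first.
  rewrite big_split /= -!mulr_sumr sumr_const addrC.
  by congr (_ * _ + _); rewrite [RHS]mulr_natl; congr (_ *+ _); exact: eq_card.
apply: eq_bigr => eps _.
rewrite -[k.+1]/(j.+1) !(sign_sumS j) sign_sum_flip.
have o1 : dot (sign_sum k eps) (u j) = 0.
  rewrite dot_suml big1// => i ij; rewrite dotZl uo (_ : i == j = false) ?mulr0//.
  by apply/eqP => e; move: ij; rewrite e ltnn.
have o2 : dot (sign_sum k eps) v = 0.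
  by rewrite dot_suml big1// => i ij; rewrite dotZl uv mulr0.
rewrite -(FE o1 o2 (uv j)) ffunE eqxx.
case: (eps j); rewrite /= ?expr1 ?expr0 ?scaleN1r ?scale1r//.
by rewrite addrC.
Qed.

Lemma sum_signs : \sum_(eps : {ffun 'I_N -> bool}) F (\sum_(i < N) (-1) ^+ eps i *: u i) =
  #|{ffun 'I_N -> bool}|%:R * \sum_(i < N) F (u i).
Proof.
have := sum_sign_sums (leqnn N); rewrite (eq_bigl xpredT (fun i => F (u i))); last first.
  by move=> i; rewrite ltn_ord.
move=> <-; apply: eq_bigr => eps _; congr F; apply: eq_bigl => i.
by rewrite ltn_ord.
Qed.

End SignSums.

(** * The complex form and the sign average of the Klain function *)

Section ComplexKlainForm.
Variables (R : realType) (n d : nat).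
Hypothesis nd : n = d.+3.
Variables (mu : convexBody R n -> R[i]).
Hypothesis mua : angular d.+1 mu.
Implicit Types (x y v : 'rV[R]_n).

Definition complex_klain_form v x : R[i] :=
  ((dot x x)%:C)%C * klain mu (orthv <<[:: x; v]>>%VS).

Lemma span_scale_head v x (c : R) : c != 0 -> <<[:: c *: x; v]>>%VS = <<[:: x; v]>>%VS.
Proof.
move=> c0; apply/eqP; rewrite eqEsubv; apply/andP; split; apply/span_subvP => z;
  rewrite !inE => /orP[] /eqP ->.
- by rewrite memvZ// memv_span ?mem_head.
- by rewrite memv_span// !inE eqxx orbT.
- by rewrite -{1}[x](scalerK c0) memvZ// memv_span ?mem_head.
- by rewrite memv_span// !inE eqxx orbT.
Qed.

Lemma norm_Re_lt (z : R[i]) (e : R) : `|z| < (e%:C)%C -> `|complex.Re z| < e.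
Proof.
case: z => a b; rewrite normc_def ltcR /=; apply: le_lt_trans.
by rewrite -sqrtr_sqr ler_wsqrtr// lerDl sqr_ge0.
Qed.

Lemma norm_Im_lt (z : R[i]) (e : R) : `|z| < (e%:C)%C -> `|complex.Im z| < e.
Proof.
case: z => a b; rewrite normc_def ltcR /=; apply: le_lt_trans.
by rewrite -sqrtr_sqr ler_wsqrtr// lerDr sqr_ge0.
Qed.

Lemma complex_klain_form0 v : complex_klain_form v 0 = 0.
Proof. by rewrite /complex_klain_form dot0l mul0r. Qed.

Lemma complex_klain_formN v x : complex_klain_form v (- x) = complex_klain_form v x.
Proof.
rewrite /complex_klain_form -scaleN1r span_scale_head ?oppr_eq0 ?oner_eq0//.
by rewrite scaleN1r dotNl dotNr opprK.
Qed.

Lemma complex_klain_form_parallelogram v x y : dot v v = 1 ->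
  dot x y = 0 -> dot x v = 0 -> dot y v = 0 ->
  complex_klain_form v (x + y) + complex_klain_form v (x - y) =
  2 * complex_klain_form v x + 2 * complex_klain_form v y.
Proof.
move=> vv xy xv yv.
(* The real law is stated with unit directions and positive lengths; the zero cases follow from
   evenness of the form and its value 0 at 0. *)
have [->|x0] := eqVneq x 0.
  by rewrite add0r sub0r complex_klain_formN complex_klain_form0; ring.
have [->|y0] := eqVneq y 0.
  by rewrite addr0 subr0 complex_klain_form0; ring.
have unit (z : 'rV[R]_n) : z != 0 -> [/\ 0 < enorm z, dot ((enorm z)^-1 *: z) ((enorm z)^-1 *: z) = 1 &
    enorm z *: ((enorm z)^-1 *: z) = z].
  move=> z0; have e0 : enorm z != 0 by rewrite enorm_eq0.
  split.
  - by rewrite lt_neqAle enorm_ge0 eq_sym e0.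
  - by rewrite dotZl dotZr -sqr_enorm; field.
  - by rewrite scalerA divff// scale1r.
have [ex0 xx xE] := unit x x0; have [ey0 yy yE] := unit y y0.
have H (rho : R[i] -> R) : (forall z w, rho (z + w) = rho z + rho w) ->
    (forall z (t : R), rho (z * (t%:C)%C) = rho z * t) ->
    (forall z (e : R), `|z| < (e%:C)%C -> `|rho z| < e) ->
    rho (complex_klain_form v (x + y) + complex_klain_form v (x - y)) =
    rho (2 * complex_klain_form v x + 2 * complex_klain_form v y).
  move=> rD rZ rn.
  have fE z : rho (complex_klain_form v z) = klain_form mu rho v z.
    by rewrite /complex_klain_form mulrC rZ mulrC.
  have := @klain_form_parallelogram R n d nd mu mua rho rD rZ rn v _ _ _ _ xx yy vv _ _ _ ex0 ey0.
  rewrite !xE !yE dotZl dotZr !dotZl xy xv yv !mulr0 => /(_ erefl erefl erefl) H.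
  have r2 z : rho (2 * z) = 2 * rho z.
    by have -> : 2 * z = z + z; [rewrite mulr_natl mulr2n|rewrite rD mulr_natl mulr2n].
  by rewrite rD !fE H -!fE -!r2 -rD.
apply/eqP; rewrite eq_complex; apply/andP; split; apply/eqP; apply: H.
- by move=> [a b] [a' b'].
- by move=> [a b] t /=; rewrite mulr0 subr0.
- exact: norm_Re_lt.
- by move=> [a b] [a' b'].
- by move=> [a b] t /=; rewrite mulr0 add0r.
- exact: norm_Im_lt.
Qed.

End ComplexKlainForm.

(* The basis u_1, ..., u_n is indexed by 'I_n.-1.+1 (n.-1.+1 = n as n >= 3):
   u_i is u (lift ord_max i) for i : 'I_n.-1, and u_n is u ord_max.
   The sign vectors are encoded as eps : {ffun 'I_n.-1 -> bool}. *)
Theorem proposition1p4 (R : realType) (n : nat) (hn : (3 <= n)%N)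
    (mu : convexBody R n -> R[i]) (hmu : angular (n - 2) mu)
    (u : 'I_n.-1.+1 -> 'rV[R]_n) (hu : orthonormal_family u) :
  let f := fun E : {vspace 'rV[R]_n} => klain mu (orthv E) in
  n.-1%:R *
    uniform_mean (fun eps : {ffun 'I_n.-1 -> bool} =>
      eval_wedge f
        ((Num.sqrt n.-1%:R)^-1 *:
           \sum_(i < n.-1) (-1) ^+ eps i *: u (lift ord_max i))
        (u ord_max))
  = \sum_(i < n.-1) eval_wedge f (u (lift ord_max i)) (u ord_max).
Proof.
move=> f; pose v := u ord_max; pose e (i : 'I_n.-1) := u (lift ord_max i).
have nd : n = (n - 3).+3 by lia.
have mua : angular (n - 3).+1 mu by have -> : (n - 3).+1 = (n - 2)%N by lia.
have vv : dot v v = 1 by rewrite hu eqxx.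
have eo : orthonormal_family e by move=> i j; rewrite hu (inj_eq (@lift_inj _ _)).
have ev i : dot (e i) v = 0 by rewrite hu eq_sym (negPf (neq_lift _ _)).
have FE x y := @complex_klain_form_parallelogram R n (n - 3) nd mu mua v x y vv.
have := sum_signs (complex_klain_form0 mu v) FE eo ev.
have N0 : (0 : R) < n.-1%:R by rewrite ltr0n; lia.
(* The signed sum has squared length n - 1, which is the factor in front of the mean, while
   normalising it does not change the span. *)
have FS (eps : {ffun 'I_n.-1 -> bool}) : complex_klain_form mu v (\sum_(i < n.-1) (-1) ^+ eps i *: e i) = n.-1%:R *
    eval_wedge f ((Num.sqrt n.-1%:R)^-1 *: \sum_(i < n.-1) (-1) ^+ eps i *: u (lift ord_max i)) v.
  rewrite /eval_wedge span_scale_head; last by rewrite invr_eq0 gt_eqF// sqrtr_gt0.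
  rewrite /complex_klain_form; congr (_ * _).
  rewrite dot_suml (eq_bigr (fun=> 1)) => [|i _]; last first.
    rewrite dotC dot_suml (bigD1 i)//= big1 => [|j ji].
      by rewrite !dotZl dotZr eo eqxx addr0 mulr1 -expr2 sqrr_sign.
    by rewrite dotZl dotZr eo (negPf ji) !mulr0.
  by rewrite sumr_const card_ord rmorph_nat.
rewrite (eq_bigr _ (fun eps _ => FS eps)) -mulr_sumr.
rewrite (eq_bigr (fun i => eval_wedge f (e i) v)) => [H|i _]; last first.
  by rewrite /complex_klain_form eo eqxx mul1r.
rewrite /uniform_mean mulrCA H mulKf// pnatr_eq0 -lt0n.
by apply/card_gt0P; exists [ffun=> true].
Qed.
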